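(* Fix $u_-<u_+$, $\kappa>0$, $\alpha\in(0,\frac12]$, and the front $\bar u$ described in the context. There exist constants $\varepsilon_1>0$ and $c_0>0$ such that the following holds. Let $T_0>0$, let $\phi$ be an admissible perturbation on $[0,T_0]$ (in the sense of the context), with associated shift $\delta$ satisfying $$\dot\delta(t)=-\eta\int_{\mathbb R}\bar u'(x)\phi(x,t)\,dx,\quad\delta(0)=0,\qquad \eta=4\kappa^3L .$$ If $$\sup_{0\le t\le T_0}\|\phi(\cdot,t)\|_{L^2(\mathbb R)}\le\varepsilon_1,$$ then for all $t\in[0,T_0]$ $$\|\phi(\cdot,t)\|_{L^2(\mathbb R)}^2+c_0\int_0^t\mathcal D(s)\,ds\le\|\phi(\cdot,0)\|_{L^2(\mathbb R)}^2,$$ where $$\mathcal D(s):=\|\phi_x(\cdot,s)\|_{H^1(\mathbb R)}^2+\|\sqrt{\bar u'}\,\phi(\cdot,s)\|_{L^2(\mathbb R)}^2+|\dot\delta(s)|^2 .$$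
   Context: Let $L:=u_+-u_-$, $x_0\in\mathbb R$ fixed, $\bar u(x)=\frac{u_-+u_+}{2}+\frac L2\tanh\left(\frac{\kappa L}{2}(x-x_0)\right)$, and consider the Cahn--Hilliard equation $u_t=(-u_{xx}+B(u))_{xx}$ on $\mathbb R$, with $B(u)=\kappa^2(u_-+u_+-2u)(u-u_-)(u_+-u)$. H\''older spaces consist of bounded functions. For $\Omega=I\times J\subset\mathbb R\times[0,\infty)$, $C^{\alpha,\alpha/4}(\Omega)$ has norm $\|f\|_{L^\infty(\Omega)}+\sup_{x\ne y\in I,\,t\in J}\frac{|f(x,t)-f(y,t)|}{|x-y|^\alpha}+\sup_{x\in I,\,t\ne s\in J}\frac{|f(x,t)-f(x,s)|}{|t-s|^{\alpha/4}}$, and $C^{4+\alpha,1+\alpha/4}(\Omega)$ consists of bounded $f$ whose derivatives $\partial_x^jf$ ($0\le j\le4$), $\partial_tf$ exist classically, with finite norm $\sum_{j=0}^3\|\partial_x^jf\|_{L^\infty(\Omega)}+\|\partial_x^4f\|_{C^{\alpha,\alpha/4}(\Omega)}+\|\partial_tf\|_{C^{\alpha,\alpha/4}(\Omega)}$. Given a solution $u$ of the Cahn--Hilliard equation, the shift $\delta$ is defined as the solution of the ODE $\dot\delta(t)=-\eta\int_{\mathbb R}\bar u'(x)\big(u(x+\delta(t),t)-\bar u(x)\big)dx$, $\delta(0)=0$, $\eta=4\kappa^3L$, and the perturbation is $\phi(x,t):=u(x+\delta(t),t)-\bar u(x)$. The perturbation $\phi$ is called admissible on $[0,T_0]$ if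 $\phi\in C([0,T_0];L^2(\mathbb R))$, $\delta\in C^1([0,T_0])$, and the underlying solution satisfies $u\in C^{\alpha,\alpha/4}(\mathbb R\times[0,T_0])\cap C^{4+\alpha,1+\alpha/4}(\mathbb R\times[\sigma,T_0])$ for any $\sigma\in(0,T_0)$ (the equation holding classically for $0<t\le T_0$). *)

(* Defs.v *)
From HB Require Import structures.
From mathcomp Require Import all_boot all_order all_algebra.
From mathcomp Require Import all_classical all_reals all_analysis.

Set Implicit Arguments.
Unset Strict Implicit.
Unset Printing Implicit Defensive.

Import Order.TTheory GRing.Theory Num.Theory.
Import numFieldNormedType.Exports.

Local Open Scope classical_set_scope.
Local Open Scope ring_scope.

Section one_sided_derivatives.
Context {R : realType}.
Implicit Types (J : set R) (g : R -> R) (t : R).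

(* The derivative of [g] at [t] relative to [J]: the increment stays in [J], so
   that at an endpoint of an interval this is the one-sided derivative, and
   values of [g] outside [J] are irrelevant. *)
Definition diff_quot g t (s : R) : R := (g s - g t) / (s - t).

Definition derivable_within J g t : Prop :=
  cvg (diff_quot g t s @[s --> within J t^']).

Definition deriv_within J g t : R :=
  lim (diff_quot g t s @[s --> within J t^']).

Definition C1_on J g : Prop :=
  (forall t, J t -> derivable_within J g t) /\
  {within J, continuous (deriv_within J g)}.

End one_sided_derivatives.

Section hoelder_spaces.
Context {R : realType}.
Implicit Types (J : set R) (f : R -> R -> R).

(* Supremum of a set of nonnegative quantities, so that the empty set has
   supremum 0 rather than -oo. *)
Definition nneg_sup (A : set R) : \bar R := maxe 0%E (ereal_sup (EFin @` A)).

(* Functions of [(x, t)] are considered on the strip where [x] is any real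
   number and [t] is in [J]; elements of the Hoelder spaces are genuine
   functions, so the sup norm is a pointwise supremum. *)
Definition strip_sup_norm J f : \bar R :=
  nneg_sup [set r | exists x t, J t /\ r = `|f x t|].

Definition hoelder_x alpha J f : \bar R :=
  nneg_sup [set r | exists x y t, [/\ x != y, J t &
    r = `|f x t - f y t| / `|x - y| `^ alpha]].

Definition hoelder_t beta J f : \bar R :=
  nneg_sup [set r | exists x t s, [/\ t != s, J t, J s &
    r = `|f x t - f x s| / `|t - s| `^ beta]].

Definition hoelder_norm alpha J f : \bar R :=
  (strip_sup_norm J f + hoelder_x alpha J f + hoelder_t (alpha / 4) J f)%E.

Definition hoelder_space alpha J f : Prop := (hoelder_norm alpha J f < +oo)%E.

Definition dx (j : nat) f : R -> R -> R := fun x t => derive1n j (f ^~ t) x.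

Definition dt J f : R -> R -> R := fun x t => deriv_within J (f x) t.

Definition hoelder_norm4 alpha J f : \bar R :=
  (\sum_(j < 4) strip_sup_norm J (dx j f)
   + hoelder_norm alpha J (dx 4 f) + hoelder_norm alpha J (dt J f))%E.

Definition hoelder_space4 alpha J f : Prop :=
  [/\ forall (j : nat) x t, (j < 4)%N -> J t -> derivable (dx j f ^~ t) x 1,
      forall x t, J t -> derivable_within J (f x) t &
      (hoelder_norm4 alpha J f < +oo)%E].

End hoelder_spaces.

Section L2_norms.
Context {R : realType}.
Local Notation mu := (@lebesgue_measure R).

Definition L2norm (f : R -> R) : \bar R := ('N[mu]_2%:E[EFin \o f])%E.

Definition H1norm_sq (f : R -> R) : \bar R :=
  (L2norm f ^+ 2 + L2norm (derive1 f) ^+ 2)%E.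

Definition continuous_L2 (J : set R) (f : R -> R -> R) : Prop :=
  (forall t, J t -> f ^~ t \in Lfun mu 2%:E) /\
  (forall t, J t ->
     L2norm (fun x => f x s - f x t) @[s --> within J (nbhs t)] --> 0%E).

End L2_norms.

Section cahn_hilliard.
Context {R : realType}.
Variables um up kappa x0 : R.
Local Notation mu := (@lebesgue_measure R).
Local Notation L := (up - um).

Definition tanh (y : R) : R := (expR y - expR (- y)) / (expR y + expR (- y)).

Definition front (x : R) : R :=
  (um + up) / 2 + L / 2 * tanh (kappa * L / 2 * (x - x0)).

Definition B (v : R) : R :=
  kappa ^+ 2 * (um + up - 2 * v) * (v - um) * (up - v).

Definition eta : R := 4 * kappa ^+ 3 * L.

Definition cahn_hilliard (T0 : R) (u : R -> R -> R) : Prop :=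
  forall x t, 0 < t <= T0 ->
    dt `[0, T0] u x t = dx 2 (fun y s => - dx 2 u y s + B (u y s)) x t.

Definition perturbation (u : R -> R -> R) (delta : R -> R) : R -> R -> R :=
  fun x t => u (x + delta t) t - front x.

Definition is_shift (T0 : R) (u : R -> R -> R) (delta : R -> R) : Prop :=
  delta 0 = 0 /\
  forall t, 0 <= t <= T0 ->
    derivable_within `[0, T0] delta t /\
    deriv_within `[0, T0] delta t =
      - eta * (\int[mu]_x (derive1 front x * perturbation u delta x t))%R.

Definition admissible (alpha T0 : R) (u : R -> R -> R) (delta : R -> R) : Prop :=
  [/\ continuous_L2 `[0, T0] (perturbation u delta),
      C1_on `[0, T0] delta,
      hoelder_space alpha `[0, T0] u,
      forall sigma, 0 < sigma < T0 -> hoelder_space4 alpha `[sigma, T0] u &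
      cahn_hilliard T0 u].

(* The spatial derivatives of the perturbation need only exist for [0 < s]; the
   value at [s = 0] does not affect the time integral. *)
Definition dissipation (T0 : R) (u : R -> R -> R) (delta : R -> R) (s : R)
    : \bar R :=
  let phi := perturbation u delta in
  (H1norm_sq (dx 1 phi ^~ s)
   + L2norm (fun x => Num.sqrt (derive1 front x) * phi x s)%R ^+ 2
   + (`|deriv_within `[0%R, T0] delta s| ^+ 2)%:E)%E.

End cahn_hilliard.

(* Main.v *)
Require Import Defs.
From HB Require Import structures.
From mathcomp Require Import all_boot all_order all_algebra.
From mathcomp Require Import all_classical all_reals all_analysis.
From mathcomp Require Import measurable_realfun ring lra.
Set Implicit Arguments.
Unset Strict Implicit.
Unset Printing Implicit Defensive.
Import Order.TTheory GRing.Theory Num.Theory.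
Import numFieldNormedType.Exports.
Local Open Scope classical_set_scope.
Local Open Scope ring_scope.

(* Energy method. Write phi for the perturbation and a = kappa L / 2. Testing the
   equation with phi gives, up to cubic terms,
     (1/2) d/dt |phi|^2 = - Q (phi),
     Q (psi) = |psi''|^2 + 4 a^2 |psi'|^2 + 6 a^2 <sech^2 psi, psi''>
               + 8 a^5 <sech^2, psi>^2,
   where the rank-one term is the contribution of the shift. Completing the square
   in psi'' bounds Q from below by
     4 a^2 |psi'|^2 - 9 a^4 |sech^2 psi|^2 + 8 a^5 <sech^2, psi>^2,
   which is coercive by the Poincare inequality
     |psi'|^2 >= 4 a^2 |sech^2 (psi - m)|^2,  m = (a / 2) <sech^2, psi>.
   The cubic terms are absorbed because |phi|_2 is small. As the derivatives of phi
   are only known to be bounded, the estimate is carried out for w phi with the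
   weight w = sech^2 (eps (x - x0)), which satisfies |w'| <= 2 eps w; the commutator
   errors are O(eps), and Fatou's lemma removes the weight and the restriction to a
   compact subinterval of times. *)

(** * Integration over the real line *)

(** Smallness is available in L2 only. In the cubic terms it is therefore not [phi] but the weighted
    slope [w phi_x] that is bounded uniformly, by the dissipation itself through the one-dimensional
    Sobolev inequality; what remains of [phi] supplies the small factor. The sup norm of [phi]
    depends on the solution, so it may enter only remainders that vanish with eps: the radius of
    smallness and the rate of dissipation are fixed before it. The weight also spoils the rank-one
    term. The speed of the shift is an integral of the unweighted [phi], so testing with w^2 phi
    yields <sech^2, phi> <sech^2, w^2 phi> in place of the square <sech^2, w phi>^2; the mismatch is
    controlled by <sech^2, 1 - w>, which tends to 0 with eps. In time, the derivatives are bounded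
    only away from 0, so the energy identity holds on compact subintervals; the start is recovered
    from continuity in L2, the end from lower semicontinuity of the energy. *)

Section real_line.
Context {R : realType}.
Implicit Types (f g F : R -> R) (x a b : R).
Local Notation mu := (@lebesgue_measure R).
Local Notation integrable f := (mu.-integrable setT (EFin \o f)).

Lemma is_derive_mul f g x a b : is_derive x 1 f a -> is_derive x 1 g b ->
  is_derive x 1 (fun y => f y * g y) (f x * b + g x * a).
Proof. by move=> df dg; exact: is_deriveM. Qed.

Lemma is_derive_add f g x a b : is_derive x 1 f a -> is_derive x 1 g b ->
  is_derive x 1 (fun y => f y + g y) (a + b).
Proof. by move=> df dg; exact: is_deriveD. Qed.

Lemma is_derive_opp f x a : is_derive x 1 f a ->
  is_derive x 1 (fun y => - f y) (- a).
Proof. by move=> df; exact: is_deriveN. Qed.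

Lemma derive_continuous f df : (forall x, is_derive x 1 f (df x)) ->
  continuous f.
Proof.
move=> fdf x; have [dfx _] := fdf x.
by apply/differentiable_continuous/derivable1_diffP.
Qed.

Lemma FTC_segment F f a b : a <= b ->
  (forall x, is_derive x 1 F (f x)) -> continuous f ->
  (\int[mu]_(x in `[a, b]) (f x)%:E = (F b - F a)%:E)%E.
Proof.
rewrite le_eqVlt => /predU1P[<- _ _|ab dF cf].
  by rewrite set_itv1 integral_set1 subrr.
rewrite (@continuous_FTC2 _ f F a b ab) ?EFinB//.
- exact: continuous_subspaceT.
- have cF := derive_continuous dF; split.
  + by move=> x _; have [] := dF x.
  + exact/cvg_at_right_filter/cF.
  + exact/cvg_at_left_filter/cF.
- by move=> x _; rewrite derive1E; have [_ ->] := dF x.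
Qed.

Lemma continuous_measurable f : continuous f -> measurable_fun setT f.
Proof. exact: continuous_measurable_fun. Qed.

Let indicator_cvg f (x : R) :
  ((EFin \o f) \_ `[- n%:R, n%:R]) x @[n --> \oo] --> (f x)%:E.
Proof.
apply: cvg_near_cst; near=> n.
rewrite /= patchE ifT// mem_set//= in_itv/= -ler_norml.
by near: n; exact: nbhs_infty_ger.
Unshelve. all: by end_near. Qed.

(** The integrals over [-n, n] are differences of values of [F], hence at most 2 K, and monotone
    convergence passes to the whole line. *)
Lemma integrable_bounded_primitive F f (K : R) :
  (forall x, is_derive x 1 F (f x)) -> continuous f ->
  (forall x, 0 <= f x) -> (forall x, `|F x| <= K) -> integrable f.
Proof.
move=> dF cf f0 FK.
have mf : measurable_fun setT (EFin \o f).
  by apply/measurable_EFinP; exact: continuous_measurable.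
apply/integrableP; split => //.
under eq_integral do rewrite /= ger0_norm//.
pose g n := (EFin \o f) \_ `[- n%:R, n%:R].
have gK n : (\int[mu]_x g n x <= (K + K)%:E)%E.
  rewrite -integral_mkcond (@FTC_segment F)//; last first.
    by rewrite (@le_trans _ _ 0)// oppr_le0.
  rewrite lee_fin (le_trans (ler_norm _))// (le_trans (ler_normB _ _))//.
  by rewrite lerD.
suff -> : (\int[mu]_x (f x)%:E = \int[mu]_x limn (g ^~ x))%E.
  rewrite monotone_convergence//=.
  - apply: (@le_lt_trans _ _ (K + K)%:E); last by rewrite ltry.
    apply: lime_le; last by apply: nearW => n; exact: gK.
    apply: ereal_nondecreasing_is_cvgn => m n mn.
    apply: ge0_le_integral => //.
    + by move=> x _; apply: erestrict_ge0 => ? _ /=; rewrite lee_fin.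
    + by apply/(measurable_restrictT _ _).1 => //; exact: measurable_funTS.
    + by apply/(measurable_restrictT _ _).1 => //; exact: measurable_funTS.
    + move=> x _; apply: restrict_lee => //; first by move=> ? _ /=; rewrite lee_fin.
      by apply: subset_itv; rewrite bnd_simp ?lerN2 ler_nat.
  - by move=> n; apply/(measurable_restrictT _ _).1 => //; exact: measurable_funTS.
  - by move=> n x _; apply: erestrict_ge0 => ? _ /=; rewrite lee_fin.
  - move=> x _ m n mn.
    apply: restrict_lee => //; first by move=> ? _ /=; rewrite lee_fin.
    by apply: subset_itv; rewrite bnd_simp ?lerN2 ler_nat.
apply: eq_integral => x _; apply/esym/cvg_lim => //.
exact: indicator_cvg.
Qed.

(** Dominated convergence along the segments [-n, n], with |f| as majorant; limits of [F] along the
    integers suffice. *)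
Lemma FTC_line F f (l k : R) :
  (forall x, is_derive x 1 F (f x)) -> continuous f -> integrable f ->
  F n%:R @[n --> \oo] --> l -> F (- n%:R) @[n --> \oo] --> k ->
  \int[mu]_x f x = l - k.
Proof.
move=> dF cf fi Fl Fk.
have mf : measurable_fun setT (EFin \o f).
  by apply/measurable_EFinP; exact: continuous_measurable.
pose g (n : nat) : R -> \bar R := (EFin \o f) \_ `[- n%:R, n%:R].
have fa : integrable (Num.norm \o f).
  have := integrable_abse fi.
  by congr (_.-integrable _ _); apply/funext => x.
have H : (\int[mu]_x g n x)%E @[n --> \oo] --> (\int[mu]_x (f x)%:E)%E.
  have := @dominated_convergence _ _ _ mu _ measurableT g (EFin \o f)
    (EFin \o (Num.norm \o f)).
  case=> //.
  - by move=> n; apply/(measurable_restrictT _ _).1 => //; exact: measurable_funTS.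
  - by apply: aeW => x _; exact: indicator_cvg.
  - apply: aeW => x n _; rewrite /g patchE; case: ifPn => //= _.
    by rewrite normr0 lee_fin.
have fin : (\int[mu]_x (f x)%:E)%E \is a fin_num by exact: integrable_fin_num.
have gE n : (\int[mu]_x g n x = (F n%:R - F (- n%:R))%:E)%E.
  rewrite -integral_mkcond (@FTC_segment F)//.
  by rewrite (@le_trans _ _ 0)// oppr_le0.
move: H; under eq_cvg do rewrite gE.
rewrite -(fineK fin) => /fine_cvgP[_ /= H].
by apply: (cvg_unique _ H) => //; exact: cvgB.
Qed.

End real_line.

Section is_derive_powers.
Context {R : realType}.
Implicit Types (f : R -> R) (x a : R).

Lemma is_derive_sqr f x a : is_derive x 1 f a ->
  is_derive x 1 (fun y => f y ^+ 2) (2 * f x * a).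
Proof.
by move=> df; apply: (is_derive_eq (is_derive_mul df df)); ring.
Qed.

Lemma is_derive_cube f x a : is_derive x 1 f a ->
  is_derive x 1 (fun y => f y ^+ 3) (3 * f x ^+ 2 * a).
Proof.
move=> df; apply: (is_derive_eq (is_derive_mul df (is_derive_mul df df))); ring.
Qed.

End is_derive_powers.

(** * Bounded continuous functions *)

Section bounded_continuous.
Context {R : realType}.
Implicit Types (f g : R -> R).
Local Notation mu := (@lebesgue_measure R).
Local Notation integrable f := (mu.-integrable setT (EFin \o f)).

(** The working class for [phi] and its space derivatives at a positive time. It is an algebra, and
    multiplication by its members preserves integrability, so a single factor sech^2 makes any such
    expression integrable. *)
Definition bounded_continuous f :=
  continuous f /\ exists K, forall x, `|f x| <= K.

Lemma bc_cst (c : R) : bounded_continuous (fun=> c).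
Proof. by split; [exact: cst_continuous|exists `|c|]. Qed.

Lemma bc_add f g : bounded_continuous f -> bounded_continuous g ->
  bounded_continuous (fun x => f x + g x).
Proof.
move=> [cf [K fK]] [cg [M gM]]; split.
  by move=> x; apply: cvgD; [exact: cf|exact: cg].
by exists (K + M) => x; rewrite (le_trans (ler_normD _ _))// lerD.
Qed.

Lemma bc_opp f : bounded_continuous f -> bounded_continuous (fun x => - f x).
Proof.
move=> [cf [K fK]]; split; first by move=> x; apply: cvgN; exact: cf.
by exists K => x; rewrite normrN.
Qed.

Lemma bc_mul f g : bounded_continuous f -> bounded_continuous g ->
  bounded_continuous (fun x => f x * g x).
Proof.
move=> [cf [K fK]] [cg [M gM]]; split.
  by move=> x; apply: cvgM; [exact: cf|exact: cg].
by exists (K * M) => x; rewrite normrM ler_pM.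
Qed.

Lemma bc_sqr f : bounded_continuous f -> bounded_continuous (fun x => f x ^+ 2).
Proof. by move=> bf; exact: bc_mul. Qed.

Lemma bc_cube f : bounded_continuous f -> bounded_continuous (fun x => f x ^+ 3).
Proof. by move=> bf; do 2 apply: bc_mul => //. Qed.

Lemma integrable_mul_bc f g h : integrable f -> bounded_continuous g ->
  (forall x, h x = f x * g x) -> integrable h.
Proof.
move=> fi [cg [K gK]] /funext ->.
have K0 : 0 <= K by rewrite (le_trans _ (gK 0)).
have /integrableP[mf _] := fi.
have iK : integrable (fun x => K * f x).
  have := integrableZl measurableT K fi.
  by congr (_.-integrable _ _).
apply: (le_integrable _ _ _ iK) => //.
  apply/measurable_EFinP; apply: measurable_funM; first exact/measurable_EFinP.
  exact: continuous_measurable.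
move=> x _ /=; rewrite lee_fin !normrM mulrC ler_pM//.
by rewrite (le_trans (gK x))// ler_norm.
Qed.

Lemma integral_linear2 (f g h : R -> R) (c d : R) : integrable f ->
  integrable g -> (forall x, h x = c * f x + d * g x) ->
  integrable h /\ \int[mu]_x h x = c * \int[mu]_x f x + d * \int[mu]_x g x.
Proof.
move=> fi gi /funext ->.
have cfi : integrable (fun x => c * f x).
  by have := integrableZl measurableT c fi; congr (_.-integrable _ _).
have dgi : integrable (fun x => d * g x).
  by have := integrableZl measurableT d gi; congr (_.-integrable _ _).
split; last by rewrite RintegralD// !RintegralZl.
by have := integrableD measurableT cfi dgi; congr (_.-integrable _ _).
Qed.

End bounded_continuous.

Ltac bc := repeat match goal with
  | |- bounded_continuous (fun=> ?c) => exact: (bc_cst c)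
  | |- bounded_continuous (fun x => @?f x + @?g x) => apply: (@bc_add _ f g)
  | |- bounded_continuous (fun x => - @?f x) => apply: (@bc_opp _ f)
  | |- bounded_continuous (fun x => @?f x * @?g x) => apply: (@bc_mul _ f g)
  | |- bounded_continuous (fun x => @?f x ^+ 2) => apply: (@bc_sqr _ f)
  | |- bounded_continuous (fun x => @?f x ^+ 3) => apply: (@bc_cube _ f)
  | H : bounded_continuous ?f |- bounded_continuous (fun x => ?f x) => exact: H
  | H : bounded_continuous ?f |- bounded_continuous ?f => exact: H
  end.

Ltac derive_step := match goal with
  | |- is_derive _ _ (fun=> ?c) _ => exact: (is_derive_cst c)
  | |- is_derive _ _ (fun x => @?f x + @?g x) _ =>
      notypeclasses refine (@is_derive_add _ f g _ _ _ _ _)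
  | |- is_derive _ _ (fun x => - @?f x) _ =>
      notypeclasses refine (@is_derive_opp _ f _ _ _)
  | |- is_derive _ _ (fun x => @?f x * @?g x) _ =>
      notypeclasses refine (@is_derive_mul _ f g _ _ _ _ _)
  | |- is_derive _ _ (fun x => @?f x ^+ 2) _ =>
      notypeclasses refine (@is_derive_sqr _ f _ _ _)
  | |- is_derive _ _ (fun x => @?f x ^+ 3) _ =>
      notypeclasses refine (@is_derive_cube _ f _ _ _)
  | H : forall x, is_derive x _ ?f _ |- is_derive _ _ (fun x => ?f x) _ => exact: H
  | H : forall x, is_derive x _ ?f _ |- is_derive _ _ ?f _ => exact: H
  end.
(** Leaves only the identity between the derivative read off from the shape of the function and the
    claimed one. *)
Ltac derive := notypeclasses refine (is_derive_eq _ _);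
  [repeat derive_step | cbv beta].

(** * The profile tanh (lam (x - x0)) *)

Section tanh.
Context {R : realType}.
Implicit Types (x y : R).

Let den_gt0 y : 0 < expR y + expR (- y).
Proof. by rewrite addr_gt0 ?expR_gt0. Qed.

Lemma sqr_tanh_lt1 y : tanh y ^+ 2 < 1.
Proof.
rewrite /tanh expr_div_n ltr_pdivrMr ?exprn_gt0// mul1r -subr_gt0.
rewrite (_ : _ - _ = 4 * (expR y * expR (- y))); last by ring.
by rewrite mulr_gt0// mulr_gt0 ?expR_gt0.
Qed.

Lemma is_derive_tanh y : is_derive y 1 tanh (1 - tanh y ^+ 2).
Proof.
rewrite /tanh; have d0 := den_gt0 y.
have de := is_derive_expR y.
have dn : is_derive y 1 (fun z => expR (- z)) (- expR (- y)).
  have := @is_derive1_comp R expR -%R y _ _ (is_derive_expR (- y)) _.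
  by move=> /(_ _ (is_deriveN (is_derive_id y 1))); rewrite mulrN1.
have dV : is_derive y 1 (fun z => (expR z + expR (- z))^-1)
    (- (expR y + expR (- y)) ^- 2 *: (expR y + - expR (- y))).
  exact: (@is_deriveV R (fun z => expR z + expR (- z)) y _ 1 (lt0r_neq0 d0)
    (is_derive_add de dn)).
have dnum := is_derive_add de (is_derive_opp dn).
apply: (is_derive_eq (is_derive_mul dnum dV)).
rewrite /GRing.scale/=; field; exact: lt0r_neq0.
Qed.

Lemma tanhN y : tanh (- y) = - tanh y.
Proof. by rewrite /tanh opprK -mulNr opprB (addrC (expR y)). Qed.

(** Equivalent to 1 + 2 y <= exp (2 y); this rational rate is enough for the limit at infinity. *)
Lemma onem_tanh_le y : 0 <= y -> 1 - tanh y <= (1 + y)^-1.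
Proof.
move=> y0; have d0 := den_gt0 y.
have e0 := expR_gt0 y; have f0 := expR_gt0 (- y).
have e1 : expR y * expR (- y) = 1 by rewrite -expRD subrr expR0.
have ey := expR_ge1Dx y.
have y1 : 0 < 1 + y by rewrite ltr_pwDl.
rewrite (_ : 1 - tanh y = (2 * expR (- y)) / (expR y + expR (- y))); last first.
  by rewrite /tanh; field; exact: lt0r_neq0.
rewrite ler_pdivrMr// ler_pdivlMl//.
have : (1 + 2 * y) * expR (- y) <= expR y; last by lra.
have : (1 + 2 * y) <= expR y * expR y.
  by rewrite -expRD (le_trans _ (expR_ge1Dx _)) // lerD2l mulr_natl mulr2n.
move=> H; have := ler_wpM2r (ltW f0) H; rewrite -mulrA e1; lra.
Qed.

Lemma norm_tanh_le1 y : `|tanh y| <= 1.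
Proof.
by rewrite -(@expr_le1 _ 2)// real_normK ?num_real// ltW// sqr_tanh_lt1.
Qed.

End tanh.

Section profile.
Context {R : realType}.
Variables (x0 lam : R) (lam0 : 0 < lam).
Implicit Types x : R.
Local Notation mu := (@lebesgue_measure R).
Local Notation integrable f := (mu.-integrable setT (EFin \o f)).

Definition profile x := tanh (lam * (x - x0)).
Local Notation th := profile.

Lemma is_derive_profile x : is_derive x 1 th (lam * (1 - th x ^+ 2)).
Proof.
have df : is_derive x 1 (fun z => lam * (z - x0)) lam.
  apply: (is_derive_eq (is_derive_mul (is_derive_cst lam x 1)
    (is_derive_add (is_derive_id x 1) (is_derive_cst (- x0) x 1)))).
  by rewrite addr0 mulr1 mulr0 addr0.
rewrite mulrC; exact: (@is_derive1_comp _ tanh _ x _ _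
  (is_derive_tanh (lam * (x - x0))) df).
Qed.

Lemma bc_profile : bounded_continuous th.
Proof.
split; first exact: (derive_continuous is_derive_profile).
by exists 1 => x; exact: norm_tanh_le1.
Qed.

Lemma onem_sqr_profile_ge0 x : 0 <= 1 - th x ^+ 2.
Proof. by rewrite subr_ge0 ltW// sqr_tanh_lt1. Qed.

Lemma profile_cvgy : th n%:R @[n --> \oo] --> (1 : R).
Proof.
apply/cvgrPdist_le => e e0; near=> n.
have nx : e^-1 / lam + x0 <= n%:R by near: n; exact: nbhs_infty_ger.
have yl : e^-1 <= lam * (n%:R - x0).
  by rewrite mulrC -ler_pdivrMr// lerBrDr.
have y0 : 0 <= lam * (n%:R - x0) by rewrite (le_trans _ yl)// invr_ge0 ltW.
rewrite ger0_norm; last first.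
  by rewrite subr_ge0 (le_trans (ler_norm _))// norm_tanh_le1.
rewrite (le_trans (onem_tanh_le y0))// -[leRHS]invrK lef_pV2 ?posrE ?invr_gt0//.
  by rewrite (le_trans yl)// lerDr.
by rewrite ltr_pwDl.
Unshelve. all: by end_near. Qed.

End profile.

Section profile_integrals.
Context {R : realType}.
Variables (x0 lam : R) (lam0 : 0 < lam).
Implicit Types x : R.
Local Notation mu := (@lebesgue_measure R).
Local Notation integrable f := (mu.-integrable setT (EFin \o f)).
Local Notation th := (profile x0 lam).

Lemma profile_cvgNy : th (- n%:R) @[n --> \oo] --> (-1 : R).
Proof.
have -> : (fun n : nat => th (- n%:R)) = (fun n => - profile (- x0) lam n%:R).
  apply/funext => n; rewrite /profile -tanhN; congr tanh; ring.
by apply: cvgN; exact: profile_cvgy.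
Qed.

Let lam_neq0 : lam != 0. Proof. exact: lt0r_neq0. Qed.

Let bth := bc_profile x0 lam.

Let dth := is_derive_profile x0 lam.

Let bc_sech2 : bounded_continuous (fun x => 1 - th x ^+ 2).
Proof. by bc. Qed.

Let dprim x : is_derive x 1 (fun x => lam^-1 * th x) (1 - th x ^+ 2).
Proof. by derive; rewrite mulr0 addr0 mulKf. Qed.

Lemma integrable_sech2 : integrable (fun x => 1 - th x ^+ 2).
Proof.
apply: (@integrable_bounded_primitive R (fun x => lam^-1 * th x)
  (fun x => 1 - th x ^+ 2) lam^-1 dprim bc_sech2.1).
- exact: onem_sqr_profile_ge0.
- move=> x; rewrite normrM ger0_norm ?invr_ge0 ?(ltW lam0)//.
  by rewrite ler_piMr ?invr_ge0 ?(ltW lam0)// norm_tanh_le1.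
Qed.

Lemma integrable_sech2_mul (h g : R -> R) : bounded_continuous g ->
  (forall x, h x = (1 - th x ^+ 2) * g x) -> integrable h.
Proof. exact: (integrable_mul_bc integrable_sech2). Qed.

Lemma integral_sech2 : \int[mu]_x (1 - th x ^+ 2) = 2 / lam.
Proof.
have primC (u : nat -> R) (l : R) : th (u n) @[n --> \oo] --> l ->
    lam^-1 * th (u n) @[n --> \oo] --> lam^-1 * l.
  by move=> ul; apply: cvgM => //; exact: cvg_cst.
rewrite (@FTC_line R (fun x => lam^-1 * th x) (fun x => 1 - th x ^+ 2)
  (lam^-1 * 1) (lam^-1 * -1) dprim bc_sech2.1 integrable_sech2
  (primC _ _ (profile_cvgy x0 lam0)) (primC _ _ profile_cvgNy)).
by field.
Qed.

Lemma integral_sech4 : \int[mu]_x (1 - th x ^+ 2) ^+ 2 = 4 / (3 * lam).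
Proof.
pose F x := lam^-1 * (th x + - (3^-1 * th x ^+ 3)).
have FC (u : nat -> R) (l : R) : th (u n) @[n --> \oo] --> l ->
    F (u n) @[n --> \oo] --> lam^-1 * (l + - (3^-1 * (l ^+ 3))).
  move=> ul; apply: cvgM; first exact: cvg_cst.
  apply: cvgD => //; apply: cvgN; apply: cvgM; first exact: cvg_cst.
  by do 2 apply: cvgM => //.
have dF x : is_derive x 1 F ((1 - th x ^+ 2) ^+ 2) by rewrite /F; derive; field.
have bf : bounded_continuous (fun x => (1 - th x ^+ 2) ^+ 2) by bc.
rewrite (@FTC_line R F (fun x => (1 - th x ^+ 2) ^+ 2) _ _ dF bf.1
  (@integrable_sech2_mul _ _ bc_sech2 _) (FC _ _ (profile_cvgy x0 lam0))
  (FC _ _ profile_cvgNy)) //.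
by field.
Qed.

Let sech2_mul_cvg (u : nat -> R) (l : R) (H g : R -> R) :
  l ^+ 2 = 1 -> th (u n) @[n --> \oo] --> l -> bounded_continuous g ->
  (forall x, H x = (1 - th x ^+ 2) * g x) -> H (u n) @[n --> \oo] --> (0 : R).
Proof.
move=> l1 thl [_ [K gK]] HE; apply: norm_cvg0.
apply: (@squeeze_cvgr _ _ _ _ (cst 0) (fun n => (1 - th (u n) ^+ 2) * K)).
- apply: nearW => n; rewrite normr_ge0 HE normrM.
  rewrite (ger0_norm (onem_sqr_profile_ge0 _ _ _)).
  by rewrite ler_wpM2l// onem_sqr_profile_ge0.
- exact: cvg_cst.
- rewrite (_ : 0 = (1 - l * l) * K); last by rewrite -expr2 l1 subrr mul0r.
  apply: cvgM; last exact: cvg_cst.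
  by apply: cvgB; [exact: cvg_cst|exact: cvgM].
Qed.

Lemma sech2_mul_cvgy (H g : R -> R) : bounded_continuous g ->
  (forall x, H x = (1 - th x ^+ 2) * g x) ->
  H n%:R @[n --> \oo] --> (0 : R).
Proof. by apply: sech2_mul_cvg (profile_cvgy x0 lam0); rewrite expr1n. Qed.

Lemma sech2_mul_cvgNy (H g : R -> R) : bounded_continuous g ->
  (forall x, H x = (1 - th x ^+ 2) * g x) ->
  H (- n%:R) @[n --> \oo] --> (0 : R).
Proof. by apply: sech2_mul_cvg profile_cvgNy; rewrite sqrrN expr1n. Qed.

(** Integration by parts on the line: the factor sech^2 kills the boundary values of [H]. *)
Lemma integral_derivative_eq0 (H h g : R -> R) : bounded_continuous g ->
  (forall x, H x = (1 - th x ^+ 2) * g x) ->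
  (forall x, is_derive x 1 H (h x)) -> continuous h -> integrable h ->
  \int[mu]_x h x = 0.
Proof.
move=> bg HE dH ch ih.
rewrite (FTC_line dH ch ih (sech2_mul_cvgy bg HE) (sech2_mul_cvgNy bg HE)).
by rewrite subrr.
Qed.

(** One-dimensional Sobolev inequality: [chi] vanishes at minus infinity thanks to its factor
    sech^2, and the derivative 2 chi chi1 of its square is at most chi^2 + chi1^2. *)
Lemma sqr_le_integral (chi chi1 g : R -> R) x : bounded_continuous g ->
  (forall x, chi x = (1 - th x ^+ 2) * g x) ->
  (forall x, is_derive x 1 chi (chi1 x)) -> continuous chi1 ->
  integrable (fun x => chi x ^+ 2 + chi1 x ^+ 2) ->
  chi x ^+ 2 <= \int[mu]_x (chi x ^+ 2 + chi1 x ^+ 2).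
Proof.
move=> bg chiE dchi cchi1 iA; set A := \int[mu]_x _.
have cchi := derive_continuous dchi.
have c2 : (fun n : nat => chi (- n%:R) ^+ 2 + A) @ \oo --> (0 : R) ^+ 2 + A.
  apply: cvgD; last exact: cvg_cst.
  by apply: cvgM; exact: sech2_mul_cvgNy bg chiE.
rewrite expr0n/= add0r in c2; apply: (cvgr_to_ge c2); near=> n.
have nx : - n%:R <= x by rewrite lerNl; near: n; exact: nbhs_infty_ger.
rewrite addrC -lerBlDr.
have dsq (y : R) : is_derive y 1 (fun z => chi z ^+ 2) (2 * chi y * chi1 y).
  by derive.
have csq : continuous (fun y => 2 * chi y * chi1 y).
  move=> y; apply: cvgM; last exact: cchi1.
  by apply: cvgM; [exact: cvg_cst|exact: cchi].
rewrite -lee_fin -(FTC_segment nx dsq csq).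
have AE : A%:E = (\int[mu]_x (chi x ^+ 2 + chi1 x ^+ 2)%:E)%E.
  by rewrite fineK//; exact: integrable_fin_num.
have mA : measurable_fun setT (fun x => (chi x ^+ 2 + chi1 x ^+ 2)%:E).
  by case/integrableP: iA.
rewrite AE; apply: (@le_trans _ _
    (\int[mu]_(y in `[(- n%:R)%R, x]) (chi y ^+ 2 + chi1 y ^+ 2)%:E)%E).
  apply: le_integral => //.
  - by apply: continuous_compact_integrable;
      [exact: segment_compact|exact: continuous_subspaceT].
  - exact: integrableS iA.
  - move=> y _; rewrite lee_fin -subr_ge0.
    have -> : chi y ^+ 2 + chi1 y ^+ 2 - 2 * chi y * chi1 y =
      (chi y - chi1 y) ^+ 2 by ring.
    exact: sqr_ge0.
apply: ge0_subset_integral => // y _.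
by rewrite lee_fin addr_ge0 ?sqr_ge0.
Unshelve. all: by end_near. Qed.

End profile_integrals.

Section primitive.
Context {R : realType}.
Implicit Types (x : R).
Local Notation mu := (@lebesgue_measure R).
Local Notation integrable f := (mu.-integrable setT (EFin \o f)).

Let cvg_integral_restrict (k : R -> R) (D : nat -> set R) (E : set R) :
  (forall n, measurable (D n)) -> measurable E -> integrable k ->
  (forall x, \forall n \near \oo, (x \in D n) = (x \in E)) ->
  \int[mu]_(x in D n) k x @[n --> \oo] --> \int[mu]_(x in E) k x.
Proof.
move=> mD mE ik DE; have /integrableP[mk _] := ik.
have fa : integrable (Num.norm \o k).
  have := integrable_abse ik.
  by congr (_.-integrable _ _); apply/funext => x.
pose g (n : nat) : R -> \bar R := (EFin \o k) \_ (D n).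
have H : (\int[mu]_x g n x)%E @[n --> \oo] -->
    (\int[mu]_x ((EFin \o k) \_ E) x)%E.
  have := @dominated_convergence _ _ _ mu _ measurableT g ((EFin \o k) \_ E)
    (EFin \o (Num.norm \o k)).
  case=> //.
  - move=> n; apply/(measurable_restrictT _ _).1; first exact: mD.
    exact: measurable_funTS.
  - by apply/(measurable_restrictT _ _).1 => //; exact: measurable_funTS.
  - apply: aeW => x _; apply: cvg_near_cst; near=> n.
    rewrite /g !patchE; have -> // : (x \in D n) = (x \in E) by near: n; exact: DE.
  - apply: aeW => x n _; rewrite /g patchE; case: ifPn => //= _.
    by rewrite normr0 lee_fin.
move: H; rewrite -integral_mkcond.
under eq_cvg do rewrite /g -integral_mkcond.
have fin : (\int[mu]_(x in E) (k x)%:E)%E \is a fin_num.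
  by apply: integrable_fin_num => //; exact: integrableS ik.
by rewrite -(fineK fin) => /fine_cvgP[].
Unshelve. all: by end_near. Qed.

Lemma primitive_line (k : R -> R) : continuous k -> integrable k ->
  exists G : R -> R, [/\ forall x, is_derive x 1 G (k x),
    exists K, forall x, `|G x| <= K,
    G n%:R @[n --> \oo] --> \int[mu]_x k x &
    G (- n%:R) @[n --> \oo] --> (0 : R)].
Proof.
move=> ck ik; exists (fun x => \int[mu]_(t in `]-oo, x]) k t).
have ikD (D : set R) : measurable D -> mu.-integrable D (EFin \o k).
  by move=> mD; exact: integrableS ik.
split.
- move=> x; have := @continuous_FTC1 _ k -oo%O x (x + 1).
  rewrite ltrDl ltr01 => /(_ isT (ikD _ (measurable_itv _))) /=.
  rewrite ltNyr => /(_ isT (ck x)) [dk kE].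
  by split; [exact: dk|rewrite -derive1E kE].
- exists (\int[mu]_x `|k x|) => x.
  rewrite (le_trans (le_normr_Rintegral _ _))//; first exact: ikD.
  rewrite Rintegral_mkcond; have ia : integrable (fun t => `|k t|).
    have := integrable_abse ik.
    by congr (_.-integrable _ _); apply/funext => ?.
  apply: le_Rintegral => //.
    rewrite -restrict_EFin; apply/integrable_restrict => //.
    by rewrite setTI; exact: integrableS ia.
  by move=> y _; rewrite patchE /=; case: ifPn => _; rewrite ?normr_ge0.
- rewrite /=; refine (@cvg_integral_restrict k (fun n => `]-oo, n%:R]%classic) setT
    (fun=> measurable_itv _) measurableT ik _).
  move=> x; near=> n; rewrite in_setT; apply/mem_set => /=; rewrite in_itv/=.
  by near: n; exact: nbhs_infty_ger.
- rewrite -(Rintegral_set0 mu k).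
  refine (@cvg_integral_restrict k (fun n => `]-oo, - n%:R]%classic) set0
    (fun=> measurable_itv _) measurable0 ik _).
  move=> x; near=> n; rewrite in_set0; apply/negbTE/negP => /set_mem /=.
  rewrite in_itv/= lerNr; apply/negP; rewrite -ltNge.
  by near: n; exact: nbhs_infty_gtr.
Unshelve. all: by end_near. Qed.

End primitive.

(** * Poincare inequality and coercivity *)

Section poincare.
Context {R : realType}.
Variables (x0 a : R) (a0 : 0 < a).
Implicit Types (x : R).
Local Notation mu := (@lebesgue_measure R).
Local Notation integrable f := (mu.-integrable setT (EFin \o f)).
Local Notation tau := (profile x0 a).
Local Notation s x := (1 - tau x ^+ 2).
Variables psi psi1 : R -> R.
Hypotheses (bpsi : bounded_continuous psi) (bpsi1 : bounded_continuous psi1).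
Hypothesis dpsi : forall x, is_derive x 1 psi (psi1 x).
Hypothesis ipsi1 : integrable (fun x => psi1 x ^+ 2).
Let btau := bc_profile x0 a.
Let m := a / 2 * \int[mu]_x (s x * psi x).

(* With G the primitive of [s * (psi - m)] vanishing at both ends, the integrand
   of the difference plus the derivative of
   [4 a^3 tau G^2 + 4 a^2 s G (psi - m)] is
   [(psi' + 2 a^2 s G)^2 + 4 a^4 (s - s^2) G^2 >= 0]. *)
Lemma weighted_poincare :
  4 * a ^+ 2 * \int[mu]_x (s x * (psi x - m)) ^+ 2 <= \int[mu]_x psi1 x ^+ 2.
Proof.
pose k x := s x * (psi x - m).
have bk : bounded_continuous k by rewrite /k; bc.
have ik : integrable k.
  by apply: (@integrable_sech2_mul _ x0 a a0 _ (fun x => psi x - m)); first by bc.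
have is1 := @integrable_sech2 _ x0 a a0.
have isp : integrable (fun x => s x * psi x).
  exact: (@integrable_sech2_mul _ x0 a a0 _ psi).
(* [m] is the mean of [psi] for the weight [s], of total mass 2 / a. Hence the primitive of [k] that
   vanishes at minus infinity vanishes at plus infinity too. *)
have k0 : \int[mu]_x k x = 0.
  have kE x : k x = 1 * (s x * psi x) + (- m) * s x by rewrite /k; ring.
  have [_ ->] := integral_linear2 isp is1 kE.
  by rewrite integral_sech2// /m; field; exact: lt0r_neq0.
have [ck _] := bk; have [G [dG [K GK] Gy GNy]] := primitive_line ck ik.
rewrite k0 in Gy.
have bG : bounded_continuous G.
  by split; [exact: derive_continuous dG|exists K].
pose F x := 4 * a ^+ 3 * (tau x * G x ^+ 2) + 4 * a ^+ 2 * (s x * (G x * (psi x - m))).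
pose f x := s x * (4 * a ^+ 4 * G x ^+ 2 + 4 * a ^+ 2 * (s x * (psi x - m) ^+ 2)
  + 4 * a ^+ 2 * (G x * psi1 x)).
(* [tau] does not decay, so the boundary values of [F] vanish because [G] factors out. *)
have FE x : F x = G x * (4 * a ^+ 3 * (tau x * G x) + 4 * a ^+ 2 * (s x * (psi x - m))).
  by rewrite /F; ring.
have [_ [M FM]] : bounded_continuous (fun x => 4 * a ^+ 3 * (tau x * G x) + 4 * a ^+ 2 * (s x * (psi x - m))) by bc.
have F0 (u : nat -> R) : G (u n) @[n --> \oo] --> 0 -> F (u n) @[n --> \oo] --> 0.
  move=> Gu; apply: norm_cvg0.
  apply: (@squeeze_cvgr _ _ _ _ (cst 0) (fun n => `|G (u n)| * M)).
  - by apply: nearW => n; rewrite normr_ge0 FE normrM ler_wpM2l.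
  - exact: cvg_cst.
  - rewrite -(mul0r M); apply: cvgM; last exact: cvg_cst.
    by rewrite -(normr0 R); exact: cvg_norm.
have bf : bounded_continuous f by rewrite /f; bc.
have fi : integrable f.
  by apply: (@integrable_sech2_mul _ x0 a a0); last by []; bc.
have dF x : is_derive x 1 F (f x).
  have dt := is_derive_profile x0 a.
  by rewrite /F; derive; rewrite /f /k; ring.
have f0 : \int[mu]_x f x = 0.
  by rewrite (FTC_line dF bf.1 fi (F0 _ Gy) (F0 _ GNy)) subrr.
have ig : integrable (fun x => k x ^+ 2).
  apply: (@integrable_sech2_mul _ x0 a a0 _ (fun x => s x * (psi x - m) ^+ 2)).
    by bc.
  by move=> x; rewrite /k; ring.
pose q x := psi1 x ^+ 2 + - (4 * a ^+ 2) * k x ^+ 2.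
have qlin x : q x = 1 * psi1 x ^+ 2 + - (4 * a ^+ 2) * k x ^+ 2.
  by rewrite mul1r.
have [iq qE] := integral_linear2 ipsi1 ig qlin.
have qflin x : q x + f x = 1 * q x + 1 * f x by rewrite !mul1r.
have [iqf qfE] := integral_linear2 iq fi qflin.
have : 0 <= \int[mu]_x (q x + f x).
  apply: Rintegral_ge0 => x _.
  have -> : q x + f x = (psi1 x + 2 * a ^+ 2 * s x * G x) ^+ 2 +
      s x * ((2 * a ^+ 2 * tau x * G x) ^+ 2).
    by rewrite /q /f /k; ring.
  by rewrite addr_ge0 ?sqr_ge0// mulr_ge0 ?sqr_ge0// onem_sqr_profile_ge0.
by rewrite qfE f0 mulr0 addr0 mul1r qE mul1r mulNr subr_ge0.
Qed.

End poincare.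

Section coercivity.
Context {R : realType}.
Variables (x0 a : R) (a0 : 0 < a).
Implicit Types (x : R).
Local Notation mu := (@lebesgue_measure R).
Local Notation integrable f := (mu.-integrable setT (EFin \o f)).
Local Notation tau := (profile x0 a).
Local Notation s x := (1 - tau x ^+ 2).
Variables psi psi1 psi2 : R -> R.
Hypotheses (bpsi : bounded_continuous psi) (bpsi1 : bounded_continuous psi1)
  (bpsi2 : bounded_continuous psi2).
Hypothesis dpsi : forall x, is_derive x 1 psi (psi1 x).
Hypothesis ipsi1 : integrable (fun x => psi1 x ^+ 2).
Hypothesis ipsi2 : integrable (fun x => psi2 x ^+ 2).
Let btau := bc_profile x0 a.
Let dtau := is_derive_profile x0 a.
Let J := \int[mu]_x (s x * psi x).
Let m := a / 2 * J.

Let sech2_mul h g : bounded_continuous g -> (forall x, h x = s x * g x) ->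
  integrable h.
Proof. exact: integrable_sech2_mul. Qed.

Let is4 : integrable (fun x => (s x * psi x) ^+ 2).
Proof.
apply: (@sech2_mul _ (fun x => s x * psi x ^+ 2)); first by bc.
by move=> x; ring.
Qed.

(** Split psi = (psi - m) + m with Young factors 1 + theta = 5/3 and 1 + 1/theta = 5/2, then apply
    the Poincare inequality to psi - m. In the coercivity estimate the loss 9 a^4 |s psi|^2 must
    cost less than 4 a^2 on the gradient and less than 8 a^5 on [J ^+ 2], which confines theta to
    (3/5, 7/9); theta = 2/3 also leaves room for a fraction of |psi''|^2. *)
Let sech4_psi_le :
  \int[mu]_x (s x * psi x) ^+ 2 <=
  5 / 12 / a ^+ 2 * \int[mu]_x psi1 x ^+ 2 + 5 / 6 * a * J ^+ 2.
Proof.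
have iG : integrable (fun x => (s x * (psi x - m)) ^+ 2).
  by apply: (@sech2_mul _ (fun x => s x * (psi x - m) ^+ 2)) => [|x];
    [bc|ring].
have i4 : integrable (fun x => s x ^+ 2).
  by apply: (@sech2_mul _ (fun x => s x)) => [|x]; [bc|ring].
have [ir rE] := @integral_linear2 _ _ _
  (fun x => 5 / 3 * (s x * (psi x - m)) ^+ 2 + 5 / 2 * m ^+ 2 * s x ^+ 2)
  (5 / 3) (5 / 2 * m ^+ 2) iG i4 (fun=> erefl).
have : \int[mu]_x (s x * psi x) ^+ 2 <= \int[mu]_x
    (5 / 3 * (s x * (psi x - m)) ^+ 2 + 5 / 2 * m ^+ 2 * s x ^+ 2).
  apply: le_Rintegral => // x _; rewrite -subr_ge0.
  have -> : 5 / 3 * (s x * (psi x - m)) ^+ 2 + 5 / 2 * m ^+ 2 * s x ^+ 2 -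
      (s x * psi x) ^+ 2 = 2 / 3 * (s x * (psi x - 5 / 2 * m)) ^+ 2 by field.
  by rewrite mulr_ge0 ?sqr_ge0.
rewrite rE integral_sech4// => H; apply: (le_trans H).
have := weighted_poincare x0 a0 bpsi bpsi1 dpsi ipsi1; rewrite -/J -/m.
set IG := \int[mu]_x _; set I1 := \int[mu]_x _ => HG.
have a20 : 0 < a ^+ 2 by rewrite exprn_gt0.
have {}HG : IG <= I1 / (4 * a ^+ 2) by rewrite ler_pdivlMr ?mulr_gt0// mulrC.
have -> : 5 / 12 / a ^+ 2 * I1 + 5 / 6 * a * J ^+ 2 =
   5 / 3 * (I1 / (4 * a ^+ 2)) + 5 / 2 * m ^+ 2 * (4 / (3 * a)).
  by rewrite /m; field; exact: lt0r_neq0.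
by rewrite lerD2r ler_wpM2l.
Qed.

(** Upgrades the weight s^2 of the previous estimate to s, as required by the term with the square
    root of the derivative of the front. Subtracting the derivative of tau s psi^2, divided by a,
    from 2 (s psi)^2 + psi1^2 / a^2 - s psi^2 leaves a sum of squares. The constants are 2 (5/12) +
    1 = 11/6 and 2 (5/6) = 5/3. *)
Lemma sech2_psi_le :
  \int[mu]_x (s x * psi x ^+ 2) <=
  11 / 6 / a ^+ 2 * \int[mu]_x psi1 x ^+ 2 + 5 / 3 * a * J ^+ 2.
Proof.
pose F x := tau x * (s x * psi x ^+ 2).
pose f x := a * (s x * s x - 2 * (tau x ^+ 2 * s x)) * psi x ^+ 2 +
  2 * (tau x * (s x * (psi x * psi1 x))).
have dF x : is_derive x 1 F (f x) by rewrite /F; derive; rewrite /f; ring.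
have bf : bounded_continuous f by rewrite /f; bc.
have fi : integrable f.
  apply: (@sech2_mul _ (fun x => a * (s x - 2 * tau x ^+ 2) * psi x ^+ 2 +
    2 * (tau x * (psi x * psi1 x)))) => [|x]; first by bc.
  by rewrite /f; ring.
have f0 : \int[mu]_x f x = 0.
  have bg : bounded_continuous (fun x => tau x * psi x ^+ 2) by bc.
  have FE x : F x = s x * (tau x * psi x ^+ 2) by rewrite /F; ring.
  exact: (integral_derivative_eq0 a0 bg FE dF bf.1 fi).
have is2 : integrable (fun x => s x * psi x ^+ 2).
  by apply: (@sech2_mul _ (fun x => psi x ^+ 2)) => [|//]; bc.
have [i1 E1] := @integral_linear2 _ _ _
  (fun x => 2 * (s x * psi x) ^+ 2 + a ^- 2 * psi1 x ^+ 2)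
  2 (a ^- 2) is4 ipsi1 (fun=> erefl).
have [i2 E2] := @integral_linear2 _ _ _
  (fun x => 1 * (2 * (s x * psi x) ^+ 2 + a ^- 2 * psi1 x ^+ 2) + - a^-1 * f x)
  1 (- a^-1) i1 fi (fun=> erefl).
have : \int[mu]_x (s x * psi x ^+ 2) <= \int[mu]_x
    (1 * (2 * (s x * psi x) ^+ 2 + a ^- 2 * psi1 x ^+ 2) + - a^-1 * f x).
  apply: le_Rintegral => // x _; rewrite -subr_ge0.
  have -> : 1 * (2 * (s x * psi x) ^+ 2 + a ^- 2 * psi1 x ^+ 2) + - a^-1 * f x -
      s x * psi x ^+ 2 =
      s x * (tau x * psi x - a^-1 * psi1 x) ^+ 2 + (a^-1 * tau x * psi1 x) ^+ 2.
    by rewrite /f; field; exact: lt0r_neq0.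
  by rewrite addr_ge0 ?sqr_ge0// mulr_ge0 ?sqr_ge0// onem_sqr_profile_ge0.
rewrite E2 f0 mulr0 addr0 mul1r E1 => H; apply: (le_trans H).
move: sech4_psi_le; set I1 := \int[mu]_x psi1 x ^+ 2.
set I4 := \int[mu]_x (_ ^+ 2) => H4.
have -> : 11 / 6 / a ^+ 2 * I1 + 5 / 3 * a * J ^+ 2 =
    2 * (5 / 12 / a ^+ 2 * I1 + 5 / 6 * a * J ^+ 2) + a ^- 2 * I1.
  by field; exact: lt0r_neq0.
by rewrite lerD2r ler_wpM2l.
Qed.

(* In the variable [z = tau x] the left-hand side is a quadratic form in
   [f (z) = psi x] on (-1, 1) which is negative somewhere on span (1, s) without
   the rank-one term; the coefficient [8 a^5] comes from [eta]. *)
Lemma coercivity :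
  25^-1 * \int[mu]_x psi2 x ^+ 2 + 3 / 32 * a ^+ 2 * \int[mu]_x psi1 x ^+ 2
    + 3 / 16 * a ^+ 5 * J ^+ 2 <=
  \int[mu]_x (psi2 x ^+ 2 + 4 * a ^+ 2 * psi1 x ^+ 2
    + 6 * a ^+ 2 * (s x * (psi x * psi2 x))) + 8 * a ^+ 5 * J ^+ 2.
Proof.
have iq : integrable (fun x => s x * (psi x * psi2 x)).
  by apply: (@sech2_mul _ (fun x => psi x * psi2 x)) => [|//]; bc.
have [i1 E1] := @integral_linear2 _ _ _
  (fun x => 1 * psi2 x ^+ 2 + 4 * a ^+ 2 * psi1 x ^+ 2)
  1 (4 * a ^+ 2) ipsi2 ipsi1 (fun=> erefl).
have lin2 x : psi2 x ^+ 2 + 4 * a ^+ 2 * psi1 x ^+ 2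
    + 6 * a ^+ 2 * (s x * (psi x * psi2 x)) =
    1 * (1 * psi2 x ^+ 2 + 4 * a ^+ 2 * psi1 x ^+ 2) +
    6 * a ^+ 2 * (s x * (psi x * psi2 x)).
  by rewrite !mul1r.
have [i2 ->] := integral_linear2 i1 iq lin2.
rewrite E1 !mul1r.
(* Only the fraction 24/25 of psi2^2 enters the square, which raises the loss from 9 a^4 to (6
   a^2)^2 / (96/25) = (75/8) a^4; the remaining 1/25 is the coefficient of |psi''|^2 in the
   conclusion. *)
have [i3 E3] := @integral_linear2 _ _ _
  (fun x => 24 / 25 * psi2 x ^+ 2 + 75 / 8 * a ^+ 4 * (s x * psi x) ^+ 2)
  (24 / 25) (75 / 8 * a ^+ 4) ipsi2 is4 (fun=> erefl).
have [i4 E4] := @integral_linear2 _ _ _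
  (fun x => 1 * (24 / 25 * psi2 x ^+ 2 + 75 / 8 * a ^+ 4 * (s x * psi x) ^+ 2) +
    6 * a ^+ 2 * (s x * (psi x * psi2 x))) 1 (6 * a ^+ 2) i3 iq (fun=> erefl).
have : 0 <= \int[mu]_x
    (1 * (24 / 25 * psi2 x ^+ 2 + 75 / 8 * a ^+ 4 * (s x * psi x) ^+ 2) +
    6 * a ^+ 2 * (s x * (psi x * psi2 x))).
  apply: Rintegral_ge0 => x _.
  have -> : 1 * (24 / 25 * psi2 x ^+ 2 + 75 / 8 * a ^+ 4 * (s x * psi x) ^+ 2) +
      6 * a ^+ 2 * (s x * (psi x * psi2 x)) =
      24 / 25 * (psi2 x + 25 / 8 * a ^+ 2 * (s x * psi x)) ^+ 2 by field.
  by rewrite mulr_ge0 ?sqr_ge0.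
rewrite E4 mul1r E3; move: sech4_psi_le.
set I1 := \int[mu]_x psi1 x ^+ 2; set I2 := \int[mu]_x psi2 x ^+ 2.
set I4 := \int[mu]_x (_ ^+ 2); set Iq := \int[mu]_x (_ * _) => H4 Hq.
have a40 : 0 <= 75 / 8 * a ^+ 4 by rewrite mulr_ge0// exprn_ge0// ltW.
have := ler_wpM2l a40 H4.
(* The margins of the conclusion are what is left of the budgets 4 a^2 and 8 a^5: 4 - 125/32 = 3/32
   and 8 - 125/16 = 3/16. *)
have -> : 75 / 8 * a ^+ 4 * (5 / 12 / a ^+ 2 * I1 + 5 / 6 * a * J ^+ 2) =
  125 / 32 * (a ^+ 2 * I1) + 125 / 16 * (a ^+ 5 * J ^+ 2).
  by field; exact: lt0r_neq0.
move=> H5; rewrite -!mulrA; rewrite -!mulrA in H5 Hq; lra.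
Qed.

End coercivity.

(** * Weighted energy estimate at a fixed time *)

Section pointwise_bounds.
Context {R : realType}.
Implicit Types a kappa eps e M : R.

(** To be applied with [X] and [Y] the commutators of the weight with the second derivative and [b]
    the derivative of [B] at the front. Every product contains [X] or [Y] and so gains a factor
    eps. *)
Lemma linear_error_le a eps (p0 p1 p2 X Y b : R) : 0 <= eps <= 1 ->
  `|X| <= 4 * eps * (`|p1| + `|p0|) -> `|Y| <= 4 * eps * (`|p1| + `|p0|) ->
  `|b| <= 4 * a ^+ 2 ->
  - (p2 * Y) - X * p2 - X * Y + b * (X * p0) <=
  eps * (40 + 32 * a ^+ 2) * (p0 ^+ 2 + p1 ^+ 2 + p2 ^+ 2).
Proof.
move=> /andP[eps0 eps1]; set t := `|p1| + `|p0| => HX HY Hb.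
have t0 : 0 <= t by rewrite addr_ge0.
have tp0 : `|p0| <= t by rewrite lerDr.
have t2 : t ^+ 2 <= 2 * (p0 ^+ 2 + p1 ^+ 2).
  rewrite -(real_normK (num_real p0)) -(real_normK (num_real p1)) /t.
  have := sqr_ge0 (`|p1| - `|p0|); lra.
have et0 : 0 <= 4 * eps * t by rewrite !mulr_ge0.
have H1 : - (p2 * Y) <= 4 * eps * t * `|p2|.
  by rewrite (le_trans (ler_norm _))// normrN normrM mulrC ler_pM.
have H2 : - (X * p2) <= 4 * eps * t * `|p2|.
  by rewrite (le_trans (ler_norm _))// normrN normrM ler_pM.
have H3 : - (X * Y) <= 4 * eps * t * (4 * eps * t).
  by rewrite (le_trans (ler_norm _))// normrN normrM ler_pM.
have H4 : b * (X * p0) <= 4 * a ^+ 2 * (4 * eps * t * t).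
  rewrite (le_trans (ler_norm _))// normrM ler_pM// normrM ler_pM//.
have H5 : t * `|p2| <= p0 ^+ 2 + p1 ^+ 2 + p2 ^+ 2.
  have := sqr_ge0 (t - `|p2|); rewrite sqrrB (real_normK (num_real p2)).
  have := sqr_ge0 p2; lra.
have H6 : t * t <= 2 * (p0 ^+ 2 + p1 ^+ 2 + p2 ^+ 2).
  by rewrite -expr2 (le_trans t2)// ler_wpM2l// lerDl sqr_ge0.
set P := p0 ^+ 2 + p1 ^+ 2 + p2 ^+ 2 in H5 H6 *.
have P0 : 0 <= P by rewrite !addr_ge0 ?sqr_ge0.
have H7 := ler_wpM2l eps0 H5.
have H8 := ler_wpM2l eps0 H6.
have H9 : eps * (eps * (t * t)) <= eps * (2 * P).
  rewrite ler_wpM2l// (le_trans _ H6)// ler_piMl// mulr_ge0//.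
have H10 : a ^+ 2 * (eps * (t * t)) <= a ^+ 2 * (eps * (2 * P)).
  by rewrite ler_wpM2l// sqr_ge0.
have -> : eps * (40 + 32 * a ^+ 2) * P = 40 * (eps * P) + 16 * (a ^+ 2 * (eps * (2 * P))).
  by ring.
have E3 : 4 * eps * t * (4 * eps * t) = 16 * (eps * (eps * (t * t))) by ring.
have E4 : 4 * a ^+ 2 * (4 * eps * t * t) = 16 * (a ^+ 2 * (eps * (t * t))) by ring.
have E1 : 4 * eps * t * `|p2| = 4 * (eps * (t * `|p2|)) by ring.
rewrite E1 in H1 H2; rewrite E3 in H3; rewrite E4 in H4.
have E5 : eps * (2 * P) = 2 * (eps * P) by ring.
rewrite E5 in H8 H9; lra.
Qed.

(** As [f0] is small in L2 only, [chi ^+ 2] is bounded by its supremum [A] and [f0] is kept squared.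
    Young's inequality with parameter [e] balances e chi^2 against f0^2 chi^2 / e <= A f0^2 / e;
    both have integral of order e A once that of f0^2 is at most e^2. The quartic term has a
    favourable sign and is dropped. *)
Lemma nonlinear_error_le a kappa e (f0 chi psi tau s A : R) :
  0 < a -> 0 < kappa -> 0 < e -> tau ^+ 2 <= 1 -> 0 <= s <= 1 -> chi ^+ 2 <= A ->
  - (12 * kappa * a * (tau * (f0 * chi ^+ 2))
     + 6 * kappa * a ^+ 2 * (s * (psi * (f0 * chi)))
     + 6 * kappa ^+ 2 * (f0 ^+ 2 * chi ^+ 2)) <=
  (6 * kappa * a + 3 * kappa * a ^+ 2) * A / e * f0 ^+ 2
  + 6 * kappa * a * e * chi ^+ 2 + 3 * kappa * a ^+ 2 * e * (s * psi ^+ 2).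
Proof.
move=> a0 k0 e0 tau1 /andP[s0 s1] chiA.
have fA : f0 ^+ 2 * chi ^+ 2 / e <= A / e * f0 ^+ 2.
  have -> : f0 ^+ 2 * chi ^+ 2 / e = f0 ^+ 2 / e * chi ^+ 2 by ring.
  have -> : A / e * f0 ^+ 2 = f0 ^+ 2 / e * A by ring.
  by rewrite ler_wpM2l// divr_ge0 ?sqr_ge0// ltW.
have T1 : - (tau * (f0 * chi ^+ 2)) <= 2^-1 * (e * chi ^+ 2 + f0 ^+ 2 * chi ^+ 2 / e).
  rewrite -subr_ge0.
  have -> : 2^-1 * (e * chi ^+ 2 + f0 ^+ 2 * chi ^+ 2 / e) - - (tau * (f0 * chi ^+ 2))
    = 2^-1 * (chi ^+ 2 * ((e + tau * f0) ^+ 2 + (1 - tau ^+ 2) * f0 ^+ 2) / e).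
    by field; exact: lt0r_neq0.
  rewrite mulr_ge0// divr_ge0 ?(ltW e0)// mulr_ge0 ?sqr_ge0//.
  by rewrite addr_ge0 ?sqr_ge0// mulr_ge0 ?sqr_ge0// subr_ge0.
have T2 : - (s * (psi * (f0 * chi))) <=
    2^-1 * (e * (s * psi ^+ 2) + s * (f0 ^+ 2 * chi ^+ 2 / e)).
  rewrite -subr_ge0.
  have -> : 2^-1 * (e * (s * psi ^+ 2) + s * (f0 ^+ 2 * chi ^+ 2 / e)) -
      - (s * (psi * (f0 * chi))) = 2^-1 * (s * (e * psi + f0 * chi) ^+ 2 / e).
    by field; exact: lt0r_neq0.
  by rewrite mulr_ge0// divr_ge0 ?(ltW e0)// mulr_ge0 ?sqr_ge0.
have T3 : s * (f0 ^+ 2 * chi ^+ 2 / e) <= A / e * f0 ^+ 2.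
  apply: le_trans fA; rewrite ler_piMl// divr_ge0 ?(ltW e0)//.
  by rewrite mulr_ge0 ?sqr_ge0.
have T4 : 0 <= kappa ^+ 2 * (f0 ^+ 2 * chi ^+ 2).
  by rewrite mulr_ge0 ?sqr_ge0// mulr_ge0 ?sqr_ge0.
have ka0 : 0 <= kappa * a by rewrite mulr_ge0 ?ltW.
have kaa0 : 0 <= kappa * a ^+ 2 by rewrite mulr_ge0 ?sqr_ge0// ltW.
have U1 : - (tau * (f0 * chi ^+ 2)) <= 2^-1 * (e * chi ^+ 2 + A / e * f0 ^+ 2).
  by apply: (le_trans T1); rewrite ler_wpM2l// lerD2l.
have U2 : - (s * (psi * (f0 * chi))) <=
    2^-1 * (e * (s * psi ^+ 2) + A / e * f0 ^+ 2).
  by apply: (le_trans T2); rewrite ler_wpM2l// lerD2l.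
have := ler_wpM2l ka0 U1; have := ler_wpM2l kaa0 U2.
set F := A / e * f0 ^+ 2.
have -> : (6 * kappa * a + 3 * kappa * a ^+ 2) * A / e * f0 ^+ 2 =
  6 * (kappa * a * F) + 3 * (kappa * a ^+ 2 * F) by rewrite /F; ring.
rewrite !mulrDr; lra.
Qed.

(** Bounds the nonlinear terms in which the derivative has fallen on the weight. They carry a factor
    eps, so a crude bound through the supremum [M] of [f0] is affordable. *)
Lemma weight_error_le a kappa M (f0 chi psi th tau s : R) :
  0 < a -> 0 < kappa -> `|th| <= 1 -> `|tau| <= 1 -> 0 <= s <= 1 -> `|f0| <= M ->
  th * (12 * kappa * a * (tau * (f0 * (psi * chi)))
     + 6 * kappa * a ^+ 2 * (s * (f0 * psi ^+ 2))
     + 6 * kappa ^+ 2 * (f0 ^+ 2 * (psi * chi))) <=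
  (12 * kappa * a * M + 6 * kappa * a ^+ 2 * M + 6 * kappa ^+ 2 * M ^+ 2) *
   (psi ^+ 2 + chi ^+ 2).
Proof.
move=> a0 k0 th1 tau1 /andP[s0 s1] fM.
have M0 : 0 <= M by rewrite (le_trans _ fM).
have pc : `|psi * chi| <= psi ^+ 2 + chi ^+ 2.
  rewrite normrM -(real_normK (num_real psi)) -(real_normK (num_real chi)).
  have := sqr_ge0 (`|psi| - `|chi|); rewrite sqrrB.
  have := sqr_ge0 `|psi|; have := sqr_ge0 `|chi|; lra.
have pp : `|psi ^+ 2| <= psi ^+ 2 + chi ^+ 2.
  by rewrite ger0_norm ?sqr_ge0// lerDl sqr_ge0.
rewrite (le_trans (ler_norm _))// normrM.
set Q := psi ^+ 2 + chi ^+ 2 in pc pp *.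
have Q0 : 0 <= Q by rewrite addr_ge0 ?sqr_ge0.
have s1' : `|s| <= 1 by rewrite ger0_norm.
have B1 : `|tau * (f0 * (psi * chi))| <= 1 * (M * Q).
  by rewrite normrM ler_pM// normrM ler_pM.
have B2 : `|s * (f0 * psi ^+ 2)| <= 1 * (M * Q).
  by rewrite normrM ler_pM// normrM ler_pM.
have B3 : `|f0 ^+ 2 * (psi * chi)| <= M ^+ 2 * Q.
  by rewrite normrM ler_pM// normrX lerXn2r ?nnegrE.
have ka0 : 0 <= 12 * kappa * a by rewrite !mulr_ge0 ?ltW.
have kaa0 : 0 <= 6 * kappa * a ^+ 2 by rewrite !mulr_ge0 ?exprn_ge0 ?ltW.
have kk0 : 0 <= 6 * kappa ^+ 2 by rewrite !mulr_ge0 ?exprn_ge0 ?ltW.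
rewrite -[leRHS]mul1r ler_pM//.
set k1 := 12 * kappa * a in ka0 *; set k2 := 6 * kappa * a ^+ 2 in kaa0 *.
set k3 := 6 * kappa ^+ 2 in kk0 *.
have -> : (k1 * M + k2 * M + k3 * M ^+ 2) * Q =
  k1 * (1 * (M * Q)) + k2 * (1 * (M * Q)) + k3 * (M ^+ 2 * Q) by ring.
rewrite (le_trans (ler_normD _ _))// lerD//; last first.
  by rewrite normrM (ger0_norm kk0) ler_wpM2l.
by rewrite (le_trans (ler_normD _ _))// lerD// normrM
  ?(ger0_norm ka0) ?(ger0_norm kaa0) ler_wpM2l.
Qed.

End pointwise_bounds.

Section energy.
Context {R : realType}.
Variables (x0 kappa a eps : R).
Implicit Types (x : R) (f : R -> R).
Local Notation mu := (@lebesgue_measure R).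
Local Notation integrable f := (mu.-integrable setT (EFin \o f)).
Local Notation th := (profile x0 eps).
Local Notation tau := (profile x0 a).
Local Notation w x := (1 - th x ^+ 2).
Local Notation s x := (1 - tau x ^+ 2).

(** Since w' = - 2 eps th w, the derivatives [wt1] and [wt2] of [wt] keep w as a factor; this makes
    their squares integrable although [f0], [f1] and [f2] are merely bounded. *)
Definition wt f0 x := w x * f0 x.
Definition wt1 f0 f1 x := w x * (f1 x - 2 * eps * (th x * f0 x)).
Definition wt2 f0 f1 f2 x :=
  w x * (f2 x - 4 * eps * (th x * f1 x) + eps ^+ 2 * ((6 * th x ^+ 2 - 2) * f0 x)).

(* [flux1] and [flux2] are the first two derivatives of
   [- f'' + B (front + f) - B front] for [kappa * L = 2 * a]. *)
Definition nonlin1 f0 f1 x :=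
  6 * kappa * a ^+ 2 * (s x * f0 x ^+ 2) + 12 * kappa * a * (tau x * (f0 x * f1 x))
  + 6 * kappa ^+ 2 * (f0 x ^+ 2 * f1 x).
Definition flux1 f0 f1 f3 x :=
  - f3 x + ((6 * a ^+ 2 * tau x ^+ 2 - 2 * a ^+ 2) * f1 x
    + 12 * a ^+ 3 * (tau x * (s x * f0 x))) + nonlin1 f0 f1 x.
Definition flux2 f0 f1 f2 f4 x :=
  - f4 x + ((6 * a ^+ 2 * tau x ^+ 2 - 2 * a ^+ 2) * f2 x
    + 24 * a ^+ 3 * (tau x * (s x * f1 x))
    + 12 * a ^+ 4 * (s x * ((1 - 3 * tau x ^+ 2) * f0 x)))
  + (- 12 * kappa * a ^+ 3 * (tau x * (s x * f0 x ^+ 2))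
    + 24 * kappa * a ^+ 2 * (s x * (f0 x * f1 x))
    + 12 * kappa * a * (tau x * (f1 x ^+ 2 + f0 x * f2 x))
    + 12 * kappa ^+ 2 * (f0 x * f1 x ^+ 2) + 6 * kappa ^+ 2 * (f0 x ^+ 2 * f2 x)).

Lemma is_derive_flux1 f0 f1 f2 f3 f4 x :
  (forall x, is_derive x 1 f0 (f1 x)) -> (forall x, is_derive x 1 f1 (f2 x)) ->
  (forall x, is_derive x 1 f3 (f4 x)) ->
  is_derive x 1 (flux1 f0 f1 f3) (flux2 f0 f1 f2 f4 x).
Proof.
move=> d0 d1 d3; have dt := is_derive_profile x0 a.
by rewrite /flux1 /nonlin1; derive; rewrite /flux2; ring.
Qed.

Hypotheses (kappa0 : 0 < kappa) (a0 : 0 < a) (eps0 : 0 < eps) (eps1 : eps <= 1).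
Variables f0 f1 f2 f3 f4 : R -> R.
Hypotheses (bf0 : bounded_continuous f0) (bf1 : bounded_continuous f1)
  (bf2 : bounded_continuous f2) (bf3 : bounded_continuous f3)
  (bf4 : bounded_continuous f4).
Hypotheses (df0 : forall x, is_derive x 1 f0 (f1 x))
  (df1 : forall x, is_derive x 1 f1 (f2 x))
  (df2 : forall x, is_derive x 1 f2 (f3 x))
  (df3 : forall x, is_derive x 1 f3 (f4 x)).
Local Notation psi := (wt f0).
Local Notation psi1 := (wt1 f0 f1).
Local Notation psi2 := (wt2 f0 f1 f2).
Let dth := is_derive_profile x0 eps.
Let dtau := is_derive_profile x0 a.
Let bth := bc_profile x0 eps.
Let btau := bc_profile x0 a.
(** The weighted slope, with derivative [chi1]. The cubic terms contain w^2 f0 f1^2 = f0 chi^2, and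
    [A] bounds the supremum of chi^2. *)
Let chi x := w x * f1 x.
Let chi1 x := w x * (f2 x - 2 * eps * (th x * f1 x)).
Let A := \int[mu]_x (chi x ^+ 2 + chi1 x ^+ 2).
Let I0 := \int[mu]_x psi x ^+ 2.
Let I1 := \int[mu]_x psi1 x ^+ 2.
Let I2 := \int[mu]_x psi2 x ^+ 2.
Let Is := \int[mu]_x (s x * psi x ^+ 2).

Let th2_le1 x : th x ^+ 2 <= 1. Proof. by rewrite ltW// sqr_tanh_lt1. Qed.
Let th_le1 x : `|th x| <= 1. Proof. exact: norm_tanh_le1. Qed.
Let w01 x : 0 <= w x <= 1.
Proof. by rewrite onem_sqr_profile_ge0 /= gerBl sqr_ge0. Qed.
Let s01 x : 0 <= s x <= 1.
Proof. by rewrite onem_sqr_profile_ge0 /= gerBl sqr_ge0. Qed.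

Lemma bc_wt : bounded_continuous psi. Proof. by rewrite /wt; bc. Qed.
Lemma bc_wt1 : bounded_continuous psi1. Proof. by rewrite /wt1; bc. Qed.
Lemma bc_wt2 : bounded_continuous psi2. Proof. by rewrite /wt2; bc. Qed.

Lemma is_derive_wt x : is_derive x 1 psi (psi1 x).
Proof. by rewrite /wt; derive; rewrite /wt1; ring. Qed.

Lemma is_derive_wt1 x : is_derive x 1 psi1 (psi2 x).
Proof. by rewrite /wt1; derive; rewrite /wt2; ring. Qed.

Let w_int h g : bounded_continuous g -> (forall x, h x = w x * g x) ->
  integrable h.
Proof. exact: integrable_sech2_mul. Qed.

Lemma integrable_wt_sqr : integrable (fun x => psi x ^+ 2).
Proof.
by apply: (@w_int _ (fun x => w x * f0 x ^+ 2)) => [|x]; [bc|rewrite /wt; ring].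
Qed.

Lemma integrable_wt1_sqr : integrable (fun x => psi1 x ^+ 2).
Proof.
apply: (@w_int _ (fun x => w x * (f1 x - 2 * eps * (th x * f0 x)) ^+ 2)) => [|x].
  by bc.
by rewrite /wt1; ring.
Qed.

Lemma integrable_wt2_sqr : integrable (fun x => psi2 x ^+ 2).
Proof.
apply: (@w_int _ (fun x => w x * (f2 x - 4 * eps * (th x * f1 x) +
  eps ^+ 2 * ((6 * th x ^+ 2 - 2) * f0 x)) ^+ 2)) => [|x]; first by bc.
by rewrite /wt2; ring.
Qed.

Let ichi : integrable (fun x => chi x ^+ 2).
Proof.
by apply: (@w_int _ (fun x => w x * f1 x ^+ 2)) => [|x]; [bc|rewrite /chi; ring].
Qed.

Let iA : integrable (fun x => chi x ^+ 2 + chi1 x ^+ 2).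
Proof.
apply: (@w_int _ (fun x => w x * (f1 x ^+ 2 +
  (f2 x - 2 * eps * (th x * f1 x)) ^+ 2))) => [|x]; first by bc.
by rewrite /chi /chi1; ring.
Qed.

Let chi_le x : chi x ^+ 2 <= A.
Proof.
apply: (@sqr_le_integral _ x0 eps eps0 chi chi1 f1).
- exact: bf1.
- by [].
- by move=> y; rewrite /chi; derive; rewrite /chi1; ring.
- by have [] : bounded_continuous chi1 by rewrite /chi1; bc.
- exact: iA.
Qed.

Let ichi_le : \int[mu]_x chi x ^+ 2 <= A.
Proof. by apply: le_Rintegral => // x _; rewrite lerDl sqr_ge0. Qed.

Let iP01 : [/\ integrable (fun x => 1 * psi x ^+ 2 + 1 * psi1 x ^+ 2),
  \int[mu]_x (1 * psi x ^+ 2 + 1 * psi1 x ^+ 2) = I0 + I1,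
  integrable (fun x => 1 * (1 * psi x ^+ 2 + 1 * psi1 x ^+ 2) + 1 * psi2 x ^+ 2) &
  \int[mu]_x (1 * (1 * psi x ^+ 2 + 1 * psi1 x ^+ 2) + 1 * psi2 x ^+ 2) =
    I0 + I1 + I2].
Proof.
have [i1 E1] := @integral_linear2 _ _ _
  (fun x => 1 * psi x ^+ 2 + 1 * psi1 x ^+ 2) 1 1
  integrable_wt_sqr integrable_wt1_sqr (fun=> erefl).
have [i2 E2] := @integral_linear2 _ _ _
  (fun x => 1 * (1 * psi x ^+ 2 + 1 * psi1 x ^+ 2) + 1 * psi2 x ^+ 2) 1 1
  i1 integrable_wt2_sqr (fun=> erefl).
by split=> //; rewrite ?E2 E1 !mul1r.
Qed.

(** [chi] and [chi1] differ from [psi1] and [psi2] by terms of order eps, so the supremum of chi^2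
    is controlled by dissipated quantities up to a small multiple of [I0 + I1]. *)
Let A_le : A <= 2 * (I1 + I2) + 24 * eps * (I0 + I1).
Proof.
have [i01 E01 _ _] := iP01.
have [i1 E1] := @integral_linear2 _ _ _
  (fun x => 2 * psi1 x ^+ 2 + 2 * psi2 x ^+ 2) 2 2
  integrable_wt1_sqr integrable_wt2_sqr (fun=> erefl).
have [i2 E2] := @integral_linear2 _ _ _
  (fun x => 1 * (2 * psi1 x ^+ 2 + 2 * psi2 x ^+ 2) +
    24 * eps * (1 * psi x ^+ 2 + 1 * psi1 x ^+ 2)) 1 (24 * eps) i1 i01 (fun=> erefl).
rewrite mulrDr -E01 -E1 -[X in _ <= X + _]mul1r -E2.
apply: le_Rintegral => // x _; rewrite !mul1r.
have -> : chi x = psi1 x + 2 * eps * th x * psi x.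
  by rewrite /chi /wt1 /wt; ring.
have -> : chi1 x = psi2 x + (2 * eps * th x * psi1 x + 2 * eps ^+ 2 * w x * psi x).
  by rewrite /chi1 /wt2 /wt1 /wt; ring.
move: (psi x) (psi1 x) (psi2 x) => p p1 p2.
have e2 : eps ^+ 2 <= eps by rewrite expr2 ler_piMr// ltW.
have t2 := th2_le1 x.
have eP q : 0 <= q -> eps ^+ 2 * (th x ^+ 2 * q) <= eps * q.
  move=> q0; apply: ler_pM => //; first exact: sqr_ge0.
    by apply: mulr_ge0 => //; exact: sqr_ge0.
  by rewrite ler_piMl.
have eW q : 0 <= q -> (eps ^+ 2 * w x) ^+ 2 * q <= eps * q.
  move=> q0; rewrite ler_wpM2r//.
  have /andP[w0 w1] := w01 x.
  have ew0 : 0 <= eps ^+ 2 * w x by rewrite mulr_ge0// sqr_ge0.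
  have ew : eps ^+ 2 * w x <= eps by rewrite (le_trans _ e2)// ler_piMr// sqr_ge0.
  rewrite expr2 -[leRHS]mulr1; apply: ler_pM => //.
  exact: (le_trans ew).
have H1 := eP _ (sqr_ge0 p); have H2 := eP _ (sqr_ge0 p1).
have H3 := eW _ (sqr_ge0 p).
have K1 : (p1 + 2 * eps * th x * p) ^+ 2 <=
    2 * p1 ^+ 2 + 8 * (eps ^+ 2 * (th x ^+ 2 * p ^+ 2)).
  rewrite -subr_ge0.
  have -> : 2 * p1 ^+ 2 + 8 * (eps ^+ 2 * (th x ^+ 2 * p ^+ 2)) -
    (p1 + 2 * eps * th x * p) ^+ 2 = (p1 - 2 * eps * th x * p) ^+ 2 by ring.
  exact: sqr_ge0.
have K2 : (p2 + (2 * eps * th x * p1 + 2 * eps ^+ 2 * w x * p)) ^+ 2 <=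
    2 * p2 ^+ 2 + 16 * (eps ^+ 2 * (th x ^+ 2 * p1 ^+ 2)) +
    16 * ((eps ^+ 2 * w x) ^+ 2 * p ^+ 2).
  rewrite -subr_ge0.
  have -> : 2 * p2 ^+ 2 + 16 * (eps ^+ 2 * (th x ^+ 2 * p1 ^+ 2)) +
    16 * ((eps ^+ 2 * w x) ^+ 2 * p ^+ 2) -
    (p2 + (2 * eps * th x * p1 + 2 * eps ^+ 2 * w x * p)) ^+ 2 =
    (p2 - (2 * eps * th x * p1 + 2 * eps ^+ 2 * w x * p)) ^+ 2 +
    2 * (2 * eps * th x * p1 - 2 * eps ^+ 2 * w x * p) ^+ 2 by ring.
  by apply: addr_ge0; [exact: sqr_ge0|apply: mulr_ge0 => //; exact: sqr_ge0].
have ep0 : 0 <= eps * p1 ^+ 2 by rewrite mulr_ge0 ?sqr_ge0// ltW.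
lra.
Qed.

Variables (M d D e : R).
Hypotheses (f0M : forall x, `|f0 x| <= M) (dD : `|d| <= D) (e0 : 0 < e).
Hypothesis if0 : integrable (fun x => f0 x ^+ 2).
Hypothesis f0e : \int[mu]_x f0 x ^+ 2 <= e ^+ 2.

Local Notation q x := (psi2 x ^+ 2 + 4 * a ^+ 2 * psi1 x ^+ 2
  + 6 * a ^+ 2 * (s x * (psi x * psi2 x))).
Local Notation lhs x :=
  (w x ^+ 2 * f0 x * (flux2 f0 f1 f2 f4 x + d * (a ^+ 2 / kappa * s x + f1 x))).
Let CM := 12 * kappa * a * M + 6 * kappa * a ^+ 2 * M + 6 * kappa ^+ 2 * M ^+ 2.
(** The two commutators: (w^2 f0)'' = w (psi2 + X1) and w f2 = psi2 + Y1. Their product with the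
    linear flux - f2 + b f0 gives the first group of terms in [err]. *)
Let X1 x := - 4 * eps * (th x * psi1 x) + eps ^+ 2 * ((6 * th x ^+ 2 - 2) * psi x).
Let Y1 x := 4 * eps * (th x * psi1 x) + eps ^+ 2 * ((2 + 2 * th x ^+ 2) * psi x).
Let b x := 6 * a ^+ 2 * tau x ^+ 2 - 2 * a ^+ 2.
Let err x := (- (psi2 x * Y1 x) - X1 x * psi2 x - X1 x * Y1 x + b x * (X1 x * psi x))
  - w x ^+ 2 * (f1 x - 4 * eps * (th x * f0 x)) * nonlin1 f0 f1 x
  + 2 * eps * (th x * (d * psi x ^+ 2)).
Let h x := lhs x + q x - d * (a ^+ 2 / kappa) * (s x * (w x ^+ 2 * f0 x)) - err x.

(** Boundary terms of two integrations by parts for the linear flux - f2 + b f0 and of one for the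
    nonlinear flux, with (w^2 f0)' = w^2 (f1 - 4 eps th f0). As b = 4 a^2 - 6 a^2 s, the term in psi
    psi1 converts 4 a^2 psi psi2 into - 4 a^2 psi1^2; the term in psi^2 removes the transport term d
    w^2 f0 f1 up to an error of order eps. *)
Let H x := w x * f0 x * (w x * flux1 f0 f1 f3 x)
  - w x ^+ 2 * (f1 x - 4 * eps * (th x * f0 x)) * (- f2 x + b x * f0 x)
  + 4 * a ^+ 2 * (psi x * psi1 x) + d / 2 * psi x ^+ 2.

Let dH x : is_derive x 1 H (h x).
Proof.
have dpsi := is_derive_wt; have dpsi1 := is_derive_wt1.
have dfl y := @is_derive_flux1 f0 f1 f2 f3 f4 y df0 df1 df3.
rewrite /H /b; derive.
rewrite /h /err /X1 /Y1 /b /wt /wt1 /wt2 /flux1 /nonlin1.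
by field; exact: lt0r_neq0.
Qed.

(** The factor 1 / e is harmless: [alpha] multiplies f0^2, whose integral is at most e^2. *)
Let alpha := (6 * kappa * a + 3 * kappa * a ^+ 2) * A / e.
Let beta := 6 * kappa * a * e + 4 * eps * CM.
Let gam := 3 * kappa * a ^+ 2 * e.
Let nu := eps * (40 + 32 * a ^+ 2 + 4 * CM + 2 * D).
Let g x := 1 * (1 * (alpha * f0 x ^+ 2 + beta * chi x ^+ 2) +
  gam * (s x * psi x ^+ 2)) +
  nu * (1 * (1 * psi x ^+ 2 + 1 * psi1 x ^+ 2) + 1 * psi2 x ^+ 2).

Let M0 : 0 <= M. Proof. by rewrite (le_trans _ (f0M 0)). Qed.
Let D0 : 0 <= D. Proof. by rewrite (le_trans _ dD). Qed.

Let CM0 : 0 <= CM.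
Proof.
have k0 := ltW kappa0; have a0' := ltW a0.
by rewrite /CM !addr_ge0// !mulr_ge0// exprn_ge0.
Qed.

Let errE x : err x =
  (- (psi2 x * Y1 x) - X1 x * psi2 x - X1 x * Y1 x + b x * (X1 x * psi x)) +
  - (12 * kappa * a * (tau x * (f0 x * chi x ^+ 2))
     + 6 * kappa * a ^+ 2 * (s x * (psi x * (f0 x * chi x)))
     + 6 * kappa ^+ 2 * (f0 x ^+ 2 * chi x ^+ 2)) +
  4 * eps * (th x * (12 * kappa * a * (tau x * (f0 x * (psi x * chi x)))
     + 6 * kappa * a ^+ 2 * (s x * (f0 x * psi x ^+ 2))
     + 6 * kappa ^+ 2 * (f0 x ^+ 2 * (psi x * chi x)))) +
  2 * eps * (th x * (d * psi x ^+ 2)).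
Proof. by rewrite /err /chi /wt /nonlin1; ring. Qed.

Let small_le (p1 p th1 r : R) : `|th1| <= 1 -> `|r| <= 4 ->
  `|4 * eps * (th1 * p1) + eps ^+ 2 * (r * p)| <= 4 * eps * (`|p1| + `|p|).
Proof.
move=> t1 r4; have ep0 := ltW eps0.
rewrite (le_trans (ler_normD _ _))// mulrDr lerD//.
  rewrite normrM ger0_norm ?mulr_ge0// ler_wpM2l ?mulr_ge0//.
  by rewrite normrM ler_piMl.
rewrite normrM ger0_norm ?exprn_ge0// normrM mulrA ler_wpM2r//.
by rewrite expr2 mulrAC ler_wpM2r// (@le_trans _ _ (1 * 4)) ?mul1r// -[leRHS]mul1r ler_pM.
Qed.

Let err_le x : err x <= g x.
Proof.
have ep0 := ltW eps0.
have t2 := th2_le1 x; have t1 := th_le1 x.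
have tau2 : tau x ^+ 2 <= 1 by rewrite ltW// sqr_tanh_lt1.
have tau20 := sqr_ge0 (tau x); have t20 := sqr_ge0 (th x).
have a20 : 0 <= a ^+ 2 by exact: sqr_ge0.
have HX : `|X1 x| <= 4 * eps * (`|psi1 x| + `|psi x|).
  have -> : X1 x = 4 * eps * (- th x * psi1 x) +
      eps ^+ 2 * ((6 * th x ^+ 2 - 2) * psi x) by rewrite /X1; ring.
  apply: small_le; first by rewrite normrN.
  by rewrite ler_norml; apply/andP; split; lra.
have HY : `|Y1 x| <= 4 * eps * (`|psi1 x| + `|psi x|).
  by apply: small_le => //; rewrite ler_norml; apply/andP; split; lra.
have Hb : `|b x| <= 4 * a ^+ 2.
  have B : a ^+ 2 * tau x ^+ 2 <= a ^+ 2 by rewrite ler_piMr.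
  have B0 : 0 <= a ^+ 2 * tau x ^+ 2 by rewrite mulr_ge0.
  by rewrite /b -mulrA ler_norml; apply/andP; split; lra.
have L1 := @linear_error_le _ a eps (psi x) (psi1 x) (psi2 x) (X1 x) (Y1 x)
  (b x) (introT andP (conj ep0 eps1)) HX HY Hb.
have L2 := @nonlinear_error_le _ a kappa e (f0 x) (chi x) (psi x) (tau x) (s x)
  A a0 kappa0 e0 tau2 (s01 x) (chi_le x).
have L3 := @weight_error_le _ a kappa M (f0 x) (chi x) (psi x) (th x) (tau x)
  (s x) a0 kappa0 t1 (norm_tanh_le1 _) (s01 x) (f0M x).
have e4 : 0 <= 4 * eps by rewrite mulr_ge0.
have {}L3 := ler_wpM2l e4 L3; rewrite -/CM in L3.
have L4 : 2 * eps * (th x * (d * psi x ^+ 2)) <= 2 * eps * (D * psi x ^+ 2).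
  rewrite ler_wpM2l ?mulr_ge0// (le_trans (ler_norm _))// normrM.
  rewrite -[leRHS]mul1r ler_pM// normrM.
  by rewrite (ger0_norm (sqr_ge0 (psi x))) ler_wpM2r// sqr_ge0.
have P1 : 0 <= eps * (4 * CM + 2 * D) * (psi1 x ^+ 2 + psi2 x ^+ 2).
  by rewrite !mulr_ge0// addr_ge0 ?sqr_ge0// mulr_ge0.
rewrite errE; move: L1 L2 L3 L4 P1; rewrite -/alpha.
move: (- (psi2 x * Y1 x) - _ - _ + _) (- (12 * kappa * a * (_ * (_ * chi x ^+ 2)) + _ + _)).
move: (th x * (_ + _ + _)) (2 * eps * (th x * _)) => T1 T2 T3 T4.
rewrite /g /nu /beta /gam !mul1r; move: (psi x ^+ 2) (psi1 x ^+ 2) (psi2 x ^+ 2).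
move: (chi x ^+ 2) (s x) => c2 S p0 p1 p2.
move=> L1 L2 L3 L4 P1.
have := lerD (lerD (lerD L1 L2) L3) L4; lra.
Qed.

Let q_int : integrable (fun x => q x).
Proof.
have [i1 _] := @integral_linear2 _ _ _
  (fun x => 1 * psi2 x ^+ 2 + 4 * a ^+ 2 * psi1 x ^+ 2)
  1 (4 * a ^+ 2) integrable_wt2_sqr integrable_wt1_sqr (fun=> erefl).
have bpsi := bc_wt; have bpsi2 := bc_wt2.
have iq : integrable (fun x => s x * (psi x * psi2 x)).
  apply: (@integrable_sech2_mul _ x0 a a0 _ (fun x => psi x * psi2 x)) => [|//].
  by bc.
have lin2 x : q x = 1 * (1 * psi2 x ^+ 2 + 4 * a ^+ 2 * psi1 x ^+ 2) +
    6 * a ^+ 2 * (s x * (psi x * psi2 x)).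
  by rewrite !mul1r.
by have [] := integral_linear2 i1 iq lin2.
Qed.

Let bh : bounded_continuous h.
Proof.
have bpsi := bc_wt; have bpsi1 := bc_wt1; have bpsi2 := bc_wt2.
by rewrite /h /err /X1 /Y1 /b /flux2 /nonlin1; bc.
Qed.

Let h_int : integrable h /\ \int[mu]_x h x = 0.
Proof.
have ih : integrable h.
  apply: (@w_int _ (fun x => w x * f0 x * (flux2 f0 f1 f2 f4 x + d * (a ^+ 2 / kappa * s x + f1 x))
   + (w x * (f2 x - 4 * eps * (th x * f1 x) + eps ^+ 2 * ((6 * th x ^+ 2 - 2) * f0 x)) ^+ 2
      + 4 * a ^+ 2 * (w x * (f1 x - 2 * eps * (th x * f0 x)) ^+ 2)
      + 6 * a ^+ 2 * (s x * (f0 x * psi2 x)))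
   - d * (a ^+ 2 / kappa) * (s x * (w x * f0 x))
   - ((- ((f2 x - 4 * eps * (th x * f1 x) + eps ^+ 2 * ((6 * th x ^+ 2 - 2) * f0 x)) * Y1 x)
      - X1 x * (f2 x - 4 * eps * (th x * f1 x) + eps ^+ 2 * ((6 * th x ^+ 2 - 2) * f0 x))
      - (- 4 * eps * (th x * (f1 x - 2 * eps * (th x * f0 x))) + eps ^+ 2 * ((6 * th x ^+ 2 - 2) * f0 x)) * Y1 x
      + b x * (X1 x * f0 x))
      - w x * (f1 x - 4 * eps * (th x * f0 x)) * nonlin1 f0 f1 x
      + 2 * eps * (th x * (d * (f0 x * psi x))))));
    last by move=> x; rewrite /h /err /X1 /Y1 /wt /wt1 /wt2; ring.
  have bpsi := bc_wt; have bpsi1 := bc_wt1; have bpsi2 := bc_wt2.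
  by rewrite /X1 /Y1 /b /flux2 /nonlin1; bc.
split=> //.
have bpsi := bc_wt; have bpsi1 := bc_wt1.
apply: (@integral_derivative_eq0 _ x0 eps eps0 H h
  (fun x => f0 x * (w x * flux1 f0 f1 f3 x)
  - w x * (f1 x - 4 * eps * (th x * f0 x)) * (- f2 x + b x * f0 x)
  + 4 * a ^+ 2 * (f0 x * psi1 x) + d / 2 * (f0 x * psi x)) _ _ dH bh.1 ih).
  by rewrite /b /flux1 /nonlin1; bc.
by move=> x; rewrite /H /wt; ring.
Qed.

Let energy_le0 :
  \int[mu]_x lhs x <= - (\int[mu]_x q x)
   + d * (a ^+ 2 / kappa) * \int[mu]_x (s x * (w x ^+ 2 * f0 x))
   + (6 * kappa * a + 3 * kappa * a ^+ 2) * A * e + beta * A + gam * Is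
   + nu * (I0 + I1 + I2).
Proof.
have [_ _ iP EP] := iP01; have [ih h0] := h_int.
have isw : integrable (fun x => s x * (w x ^+ 2 * f0 x)).
  apply: (@integrable_sech2_mul _ x0 a a0 _ (fun x => w x ^+ 2 * f0 x)) => [|//].
  by bc.
have bpsi := bc_wt.
have is2 : integrable (fun x => s x * psi x ^+ 2).
  apply: (@integrable_sech2_mul _ x0 a a0 _ (fun x => psi x ^+ 2)) => [|//].
  by bc.
have [i1 E1] := @integral_linear2 _ _ _ (fun x => 1 * h x + -1 * q x) 1 (-1)
  ih q_int (fun=> erefl).
have [i2 E2] := @integral_linear2 _ _ _ (fun x => 1 * (1 * h x + -1 * q x) +
  d * (a ^+ 2 / kappa) * (s x * (w x ^+ 2 * f0 x))) 1 (d * (a ^+ 2 / kappa))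
  i1 isw (fun=> erefl).
have [j1 F1] := @integral_linear2 _ _ _
  (fun x => alpha * f0 x ^+ 2 + beta * chi x ^+ 2) alpha beta if0 ichi (fun=> erefl).
have [j2 F2] := @integral_linear2 _ _ _
  (fun x => 1 * (alpha * f0 x ^+ 2 + beta * chi x ^+ 2) + gam * (s x * psi x ^+ 2))
  1 gam j1 is2 (fun=> erefl).
have [j3 F3] := @integral_linear2 _ _ _ g 1 nu j2 iP (fun=> erefl).
have [k1 G1] := @integral_linear2 _ _ _ (fun x => 1 * (1 * (1 * h x + -1 * q x) +
  d * (a ^+ 2 / kappa) * (s x * (w x ^+ 2 * f0 x))) + 1 * g x) 1 1 i2 j3 (fun=> erefl).
have ilhs : integrable (fun x => lhs x).
  apply: (@w_int _ (fun x => w x * f0 x * (flux2 f0 f1 f2 f4 x +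
    d * (a ^+ 2 / kappa * s x + f1 x)))) => [|x]; last by ring.
  by rewrite /flux2; bc.
have LE : \int[mu]_x lhs x <= \int[mu]_x (1 * (1 * (1 * h x + -1 * q x) +
  d * (a ^+ 2 / kappa) * (s x * (w x ^+ 2 * f0 x))) + 1 * g x).
  apply: le_Rintegral => // x _; rewrite !mul1r mulN1r.
  have -> : lhs x = h x - q x + d * (a ^+ 2 / kappa) * (s x * (w x ^+ 2 * f0 x)) + err x.
    by rewrite /h; ring.
  by rewrite lerD2l err_le.
apply: (le_trans LE); rewrite G1 E2 E1 h0 F3 F2 F1 EP !mul1r add0r mulN1r.
have A0 : 0 <= A by rewrite (le_trans _ (chi_le 0))// sqr_ge0.
have k0 := ltW kappa0; have a0' := ltW a0; have e0' := ltW e0.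
have al0 : 0 <= alpha.
  by rewrite /alpha !mulr_ge0 ?invr_ge0// addr_ge0 ?mulr_ge0 ?exprn_ge0.
have Hal : alpha * \int[mu]_x f0 x ^+ 2 <=
    (6 * kappa * a + 3 * kappa * a ^+ 2) * A * e.
  have -> : (6 * kappa * a + 3 * kappa * a ^+ 2) * A * e = alpha * e ^+ 2.
    by rewrite /alpha; field; exact: lt0r_neq0.
  by rewrite ler_wpM2l.
have Hbe : beta * \int[mu]_x chi x ^+ 2 <= beta * A.
  rewrite ler_wpM2l// /beta addr_ge0 ?mulr_ge0//; exact: ltW.
rewrite -/Is; move: Hal Hbe; set B1 := alpha * _; set B2 := beta * _.
by move=> Hal Hbe; rewrite !addrA !lerD2r -addrA -[leRHS]addrA lerD2l lerD.
Qed.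

(** With [A] eliminated, the cubic terms are [e] times quantities that the quadratic form controls.
    The mass [I0], which it does not control, occurs only with the factor eps, and so do the bounds
    [M] and [D]. *)
Lemma energy_le :
  \int[mu]_x lhs x <= - (\int[mu]_x q x)
   + d * (a ^+ 2 / kappa) * \int[mu]_x (s x * (w x ^+ 2 * f0 x))
   + e * (12 * kappa * a + 3 * kappa * a ^+ 2) * (2 * (I1 + I2) + Is)
   + eps * (24 * e * (12 * kappa * a + 3 * kappa * a ^+ 2) + 108 * CM
       + 40 + 32 * a ^+ 2 + 2 * D) * (I0 + I1 + I2).
Proof.
apply: (le_trans energy_le0); rewrite -!addrA lerD2l lerD2l.
have k0 := ltW kappa0; have a0' := ltW a0; have e0' := ltW e0.
have ep0 := ltW eps0.
have I00 : 0 <= I0 by apply: Rintegral_ge0 => x _; exact: sqr_ge0.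
have I10 : 0 <= I1 by apply: Rintegral_ge0 => x _; exact: sqr_ge0.
have I20 : 0 <= I2 by apply: Rintegral_ge0 => x _; exact: sqr_ge0.
have Is0 : 0 <= Is.
  apply: Rintegral_ge0 => x _; rewrite mulr_ge0 ?sqr_ge0//.
  exact: onem_sqr_profile_ge0.
have G0 : 0 <= e * (12 * kappa * a + 3 * kappa * a ^+ 2).
  by rewrite mulr_ge0// addr_ge0 ?mulr_ge0 ?exprn_ge0.
set G := 12 * kappa * a + 3 * kappa * a ^+ 2 in G0 *.
have H1 := ler_wpM2l G0 A_le.
have H2 : A <= 26 * (I0 + I1 + I2).
  have := ler_wpM2r (addr_ge0 I00 I10) eps1; have := A_le; lra.
have C0 : 0 <= 4 * eps * CM by rewrite !mulr_ge0.
have {}H2 := ler_wpM2l C0 H2.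
have H3 : gam * Is <= e * G * Is.
  rewrite ler_wpM2r// /gam /G mulrC ler_wpM2l//.
  by rewrite lerDr !mulr_ge0.
have H4 : 0 <= e * G * eps * I2 by rewrite mulr_ge0// mulr_ge0.
have -> : (6 * kappa * a + 3 * kappa * a ^+ 2) * A * e
   + (beta * A + (gam * Is + nu * (I0 + (I1 + I2)))) =
   e * G * A + 4 * eps * CM * A + gam * Is + nu * (I0 + I1 + I2).
  by rewrite /beta /G; ring.
apply: (@le_trans _ _ (e * G * (2 * (I1 + I2) + 24 * eps * (I0 + I1)) +
   4 * eps * CM * (26 * (I0 + I1 + I2)) + e * G * Is + nu * (I0 + I1 + I2))).
  by rewrite lerD2r !lerD.
rewrite -subr_ge0; apply: (@le_trans _ _ (24 * (e * G * eps * I2))).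
  by rewrite mulr_ge0.
rewrite le_eqVlt; apply/orP; left; apply/eqP.
by rewrite /nu; ring.
Qed.

End energy.

(** * Dissipation at a fixed time, with a rate uniform over the solutions *)

Section dissipation_inequality.
Context {R : realType}.
Implicit Types (x : R) (f : R -> R).
Local Notation mu := (@lebesgue_measure R).
Local Notation integrable f := (mu.-integrable setT (EFin \o f)).

(** Bookkeeping for the choice of [y]. The factor 4 counts the cubic terms (2 y), the terms of order
    eps (y) and the dissipation to be kept (y). [Is] occurs twice, in the cubic terms and in the
    dissipation, hence 2 k1 and 2 k2; [k3] pays for the square of the speed. *)
Let absorb (y k1 k2 k3 k4 c1 c2 c3 E eps C4 I0 I1 I2 Is J2 d2 r X : R) :
  0 <= y -> 0 <= k4 -> 0 <= c3 -> 0 <= E -> 0 <= C4 -> 0 <= eps -> 0 <= r ->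
  0 <= I1 -> 0 <= I2 -> 0 <= J2 -> eps * C4 <= y ->
  4 * y <= 25^-1 -> y * (4 + 2 * k1) <= c1 -> y * (2 * k2 + k3) <= c2 ->
  Is <= k1 * I1 + k2 * J2 -> d2 <= k3 * J2 + k4 * r -> I0 <= E ->
  X <= - (25^-1 * I2 + c1 * I1 + c2 * J2) + c3 * r + y * (2 * (I1 + I2) + Is)
    + eps * C4 * (I0 + I1 + I2) ->
  X <= - (y * (I1 + I2 + Is + d2)) + (C4 * E + c3 + y * k4) * (eps + r).
Proof.
move=> y0 k40 c30 E0 C40 ep0 r0 I10 I20 J20 eC H1 H2 H3 HIs Hd HI0 HX.
apply: (le_trans HX).
have K1 := ler_wpM2l y0 HIs; have K2 := ler_wpM2l y0 Hd.
have K3 := ler_wpM2r I20 H1; have K4 := ler_wpM2r I10 H2.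
have K5 := ler_wpM2r J20 H3.
have eC0 : 0 <= eps * C4 by rewrite mulr_ge0.
have K6 := ler_wpM2l eC0 HI0.
have K7 := ler_wpM2r I10 eC; have K8 := ler_wpM2r I20 eC.
have K9 : 0 <= (c3 + y * k4) * eps by rewrite mulr_ge0// addr_ge0// mulr_ge0.
have K10 : 0 <= C4 * E * r by rewrite !mulr_ge0.
clear - K1 K2 K3 K4 K5 K6 K7 K8 K9 K10; lra.
Qed.

Variables (x0 kappa a : R).
Hypotheses (kappa0 : 0 < kappa) (a0 : 0 < a).
Local Notation tau := (profile x0 a).
Local Notation s x := (1 - tau x ^+ 2).
Let btau := bc_profile x0 a.

Lemma norm_integral_sech2_le (g c : R -> R) (K : R) :
  bounded_continuous g -> bounded_continuous c ->
  (forall x, `|g x| <= K * c x) ->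
  `|\int[mu]_x (s x * g x)| <= K * \int[mu]_x (s x * c x).
Proof.
move=> bg bc' gc.
have ig : integrable (fun x => s x * g x).
  exact: (@integrable_sech2_mul _ x0 a a0 _ g bg (fun=> erefl)).
have ic : integrable (fun x => s x * c x).
  exact: (@integrable_sech2_mul _ x0 a a0 _ c bc' (fun=> erefl)).
rewrite -RintegralZl// (le_trans (le_normr_Rintegral _ _))//.
apply: le_Rintegral => //.
- by have := integrable_abse ig; congr (_.-integrable _ _); apply/funext.
- by have := integrableZl measurableT K ic; congr (_.-integrable _ _).
- move=> x _; rewrite normrM (ger0_norm (onem_sqr_profile_ge0 _ _ _)).
  by rewrite mulrCA ler_wpM2l// onem_sqr_profile_ge0.
Qed.

Section weight_defect.
Variables (eps M : R) (f : R -> R).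
Hypotheses (bf : bounded_continuous f) (fM : forall x, `|f x| <= M).
Local Notation th := (profile x0 eps).
Local Notation w x := (1 - th x ^+ 2).
Let J0 := \int[mu]_x (s x * f x).
Let J := \int[mu]_x (s x * wt x0 eps f x).
Let JW := \int[mu]_x (s x * (w x ^+ 2 * f x)).
Let r := \int[mu]_x (s x * th x ^+ 2).
Let bth := bc_profile x0 eps.

Let w0 x : 0 <= w x. Proof. exact: onem_sqr_profile_ge0. Qed.
Let w1 x : w x <= 1. Proof. by rewrite gerBl sqr_ge0. Qed.

Let bound g : bounded_continuous g -> (forall x, `|g x| <= M) ->
  `|\int[mu]_x (s x * g x)| <= M * (2 / a).
Proof.
move=> bg gM; rewrite -(integral_sech2 x0 a0).
have -> : \int[mu]_x s x = \int[mu]_x (s x * 1).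
  by apply: eq_Rintegral => x _; rewrite mulr1.
by apply: norm_integral_sech2_le => //; [bc|move=> x; rewrite mulr1].
Qed.

Let defect g g' : bounded_continuous g -> bounded_continuous g' ->
  (forall x, `|g x - g' x| <= M * th x ^+ 2) ->
  `|\int[mu]_x (s x * g x) - \int[mu]_x (s x * g' x)| <= M * r.
Proof.
move=> bg bg' gg'.
have ig : integrable (fun x => s x * g x).
  exact: (@integrable_sech2_mul _ x0 a a0 _ g bg (fun=> erefl)).
have ig' : integrable (fun x => s x * g' x).
  exact: (@integrable_sech2_mul _ x0 a a0 _ g' bg' (fun=> erefl)).
rewrite -RintegralB//.
have -> : \int[mu]_x (s x * g x - s x * g' x) = \int[mu]_x (s x * (g x - g' x)).
  by apply: eq_Rintegral => x _; rewrite mulrBr.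
by apply: norm_integral_sech2_le => //; bc.
Qed.

Let wf_le x (k : R) : 0 <= k <= 1 -> `|k * f x| <= M.
Proof.
by case/andP=> k0 k1; rewrite normrM ger0_norm// (le_trans _ (fM x))// ler_piMl.
Qed.

Let bwt : bounded_continuous (wt x0 eps f). Proof. by rewrite /wt; bc. Qed.

Lemma defect_ge0 : 0 <= r <= 2 / a.
Proof.
apply/andP; split.
  apply: Rintegral_ge0 => x _; rewrite mulr_ge0 ?sqr_ge0//.
  exact: onem_sqr_profile_ge0.
rewrite -(integral_sech2 x0 a0); apply: le_Rintegral => //.
- by apply: (@integrable_sech2_mul _ x0 a a0 _ (fun x => th x ^+ 2)) => [|//]; bc.
- exact: integrable_sech2.
- move=> x _; rewrite ler_piMr ?onem_sqr_profile_ge0//.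
  by rewrite ltW// sqr_tanh_lt1.
Qed.

Let J0_J : `|J0 - J| <= M * r.
Proof.
apply: defect => // x; rewrite /wt -[X in X - _]mul1r -mulrBl subKr.
by rewrite normrM ger0_norm ?sqr_ge0// mulrC ler_wpM2r ?sqr_ge0.
Qed.

Let J_JW : `|J - JW| <= M * r.
Proof.
apply: defect => [//||x]; first by bc.
have -> : wt x0 eps f x - w x ^+ 2 * f x = (w x * f x) * th x ^+ 2.
  by rewrite /wt; ring.
rewrite normrM (ger0_norm (sqr_ge0 (th x))) ler_wpM2r ?sqr_ge0// wf_le//.
by rewrite w0 w1.
Qed.

Let J_le : `|J| <= M * (2 / a).
Proof. by apply: bound => // x; rewrite wf_le// w0 w1. Qed.

Let JW_le : `|JW| <= M * (2 / a).
Proof.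
apply: bound => [|x]; first by bc.
by rewrite wf_le// exprn_ge0//= exprn_ile1.
Qed.

Lemma J0_le : `|J0| <= M * (2 / a).
Proof. exact: bound. Qed.

Let M0 : 0 <= M. Proof. by rewrite (le_trans _ (fM 0)). Qed.

(** Exchanges the product [J0 * JW] produced by the shift for the square [J ^+ 2] that coercivity
    requires. The difference is J (J - JW) + (J - J0) JW; the factors are at most 2 M / a, and the
    differences at most M r because 1 - w = th^2. *)
Lemma sqr_wt_integral_le : J ^+ 2 - J0 * JW <= 4 * M ^+ 2 / a * r.
Proof.
have -> : J ^+ 2 - J0 * JW = J * (J - JW) + (J - J0) * JW by ring.
have -> : 4 * M ^+ 2 / a * r = M * (2 / a) * (M * r) + M * r * (M * (2 / a)).
  by field; exact: lt0r_neq0.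
rewrite lerD// (le_trans (ler_norm _))// normrM ler_pM//.
by rewrite distrC.
Qed.

(** The speed of the shift is a multiple of [J0], whereas coercivity provides [J ^+ 2]; this
    transfers control from the one to the other. *)
Lemma sqr_integral_le : J0 ^+ 2 <= 2 * J ^+ 2 + 4 * M ^+ 2 / a * r.
Proof.
have /andP[r0 ra] := defect_ge0.
have D2 : (J0 - J) ^+ 2 <= M * r * (M * (2 / a)).
  rewrite -(real_normK (num_real (J0 - J))) expr2 ler_pM//.
  by rewrite (le_trans J0_J)// ler_wpM2l.
have -> : 4 * M ^+ 2 / a * r = 2 * (M * r * (M * (2 / a))).
  by field; exact: lt0r_neq0.
have := sqr_ge0 (J0 - 2 * J); move: D2; rewrite !sqrrB; lra.
Qed.

End weight_defect.

Let small_exists (k1 k2 c1 c2 : R) : 0 < k1 -> 0 < k2 -> 0 < c1 -> 0 < c2 ->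
  exists y : R, [/\ 0 < y, 4 * y <= 25^-1, y * k1 <= c1 & y * k2 <= c2].
Proof.
move=> k10 k20 c10 c20.
exists (Num.min 100^-1 (Num.min (c1 / k1) (c2 / k2))); split.
- by rewrite !lt_min !divr_gt0// invr_gt0 ltr0n.
- have : Num.min 100^-1 (Num.min (c1 / k1) (c2 / k2)) <= 100^-1.
    by rewrite ge_min lexx.
  lra.
- by rewrite -ler_pdivlMr// !ge_min lexx orbT.
- by rewrite -ler_pdivlMr// !ge_min lexx !orbT.
Qed.

(** The order of quantifiers is the point: [e] and [y] precede the sup bound [M], which depends on
    the solution and influences only [eps1] and the constant [C] of a remainder that vanishes with
    eps. The term in [d] is the speed of the shift times the derivative of the shifted solution. *)
Definition dissipates (e y : R) := forall M : R, 0 <= M ->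
  exists eps1 C : R, [/\ 0 < eps1, 0 <= C &
  forall (eps : R) (f0 f1 f2 f3 f4 : R -> R), 0 < eps <= eps1 ->
  bounded_continuous f0 -> bounded_continuous f1 -> bounded_continuous f2 ->
  bounded_continuous f3 -> bounded_continuous f4 ->
  (forall x, is_derive x 1 f0 (f1 x)) -> (forall x, is_derive x 1 f1 (f2 x)) ->
  (forall x, is_derive x 1 f2 (f3 x)) -> (forall x, is_derive x 1 f3 (f4 x)) ->
  (forall x, `|f0 x| <= M) -> integrable (fun x => f0 x ^+ 2) ->
  \int[mu]_x f0 x ^+ 2 <= e ^+ 2 ->
  forall d, d = - (8 * kappa * a ^+ 3) * \int[mu]_x (s x * f0 x) ->
  \int[mu]_x ((1 - profile x0 eps x ^+ 2) ^+ 2 * f0 x *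
    (flux2 x0 kappa a f0 f1 f2 f4 x + d * (a ^+ 2 / kappa * s x + f1 x))) <=
  - (y * (\int[mu]_x wt1 x0 eps f0 f1 x ^+ 2 + \int[mu]_x wt2 x0 eps f0 f1 f2 x ^+ 2
     + \int[mu]_x (s x * wt x0 eps f0 x ^+ 2) + d ^+ 2))
  + C * (eps + \int[mu]_x (s x * profile x0 eps x ^+ 2))].

Lemma weighted_dissipation : exists e y : R, [/\ 0 < e, 0 < y & dissipates e y].
Proof.
have k0 := ltW kappa0; have a0' := ltW a0.
set G := 12 * kappa * a + 3 * kappa * a ^+ 2.
have G0 : 0 < G.
  by rewrite addr_gt0 ?mulr_gt0 ?exprn_gt0.
(* The last two arguments are the margins of [coercivity]. The constants 11/6 and 5/3 come from
   [sech2_psi_le], and 128 kappa^2 a^6 is twice (8 kappa a^3)^2, from d = - 8 kappa a^3 J0 and J0^2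
   <= 2 J^2 up to the defect. *)
have [|||| y [y0 y1 y2 y3]] := @small_exists (4 + 2 * (11 / 6 / a ^+ 2))
  (2 * (5 / 3 * a) + 128 * kappa ^+ 2 * a ^+ 6) (3 / 32 * a ^+ 2) (3 / 16 * a ^+ 5).
- by rewrite addr_gt0// mulr_gt0// divr_gt0 ?exprn_gt0// divr_gt0.
- by rewrite addr_gt0 ?mulr_gt0 ?exprn_gt0// divr_gt0.
- by rewrite mulr_gt0 ?exprn_gt0// divr_gt0.
- by rewrite mulr_gt0 ?exprn_gt0// divr_gt0.
(* With e = y / G the factor e G of the cubic terms is exactly [y]. *)
exists (y / G), y; split => //; first by rewrite divr_gt0.
have : 0 < y / G by rewrite divr_gt0.
have : y / G * G = y by rewrite divfK// lt0r_neq0.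
move: (y / G) => e eG e0 M M0; have e0' := ltW e0.
pose CM := 12 * kappa * a * M + 6 * kappa * a ^+ 2 * M + 6 * kappa ^+ 2 * M ^+ 2.
pose D := 16 * kappa * a ^+ 2 * M.
have CM0 : 0 <= CM by rewrite /CM !(addr_ge0, mulr_ge0, exprn_ge0).
have D0 : 0 <= D by rewrite /D !(addr_ge0, mulr_ge0, exprn_ge0).
pose C4 := 24 * e * G + 108 * CM + 40 + 32 * a ^+ 2 + 2 * D.
have C40 : 0 < C4.
  have : 0 <= 24 * e * G + 108 * CM.
    by rewrite addr_ge0// mulr_ge0//; [rewrite mulr_ge0|exact: ltW].
  have : 0 <= 32 * a ^+ 2 + 2 * D.
    by rewrite addr_ge0// mulr_ge0// exprn_ge0.
  rewrite /C4; lra.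
pose c3 := 32 * a ^+ 4 * M ^+ 2.
pose k4 := 16 * (16 * (kappa ^+ 2 * a ^+ 5 * M ^+ 2)).
have c30 : 0 <= c3 by rewrite /c3 !(addr_ge0, mulr_ge0, exprn_ge0).
have k40 : 0 <= k4.
  do 2 (apply: mulr_ge0; first by []).
  by rewrite mulr_ge0 ?exprn_ge0// mulr_ge0 ?exprn_ge0.
(* The bound 1 is the restriction on eps in [energy_le]; y / C4 makes the terms of order eps at most
   [y] times the dissipated quantities. *)
exists (Num.min 1 (y / C4)), (C4 * e ^+ 2 + c3 + y * k4); split.
- by rewrite lt_min ltr01 divr_gt0.
- have y0' := ltW y0; have C40' := ltW C40.
  apply: addr_ge0; last exact: mulr_ge0.
  by apply: addr_ge0 => //; apply: mulr_ge0 => //; exact: exprn_ge0.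
move=> eps f0 f1 f2 f3 f4 /andP[ep0]; rewrite le_min => /andP[ep1 epC].
move=> bf0 bf1 bf2 bf3 bf4 df0 df1 df2 df3 fM if0 fe d dE.
set r := \int[mu]_x (s x * profile x0 eps x ^+ 2).
set J := \int[mu]_x (s x * wt x0 eps f0 x).
have dD : `|d| <= D.
  have K0 : 0 <= 8 * kappa * a ^+ 3 by rewrite !mulr_ge0// exprn_ge0.
  rewrite dE normrM normrN (ger0_norm K0).
  have -> : D = 8 * kappa * a ^+ 3 * (M * (2 / a)).
    by rewrite /D; field; exact: lt0r_neq0.
  by rewrite ler_wpM2l// (J0_le bf0 fM).
have /andP[r0 ra] := defect_ge0 eps; rewrite -/r in r0 ra.
have bpsi := bc_wt x0 eps bf0; have bpsi1 := bc_wt1 x0 eps bf0 bf1.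
have bpsi2 := bc_wt2 x0 eps bf0 bf1 bf2.
have dpsi := @is_derive_wt _ x0 eps f0 f1 df0.
have ip1 := integrable_wt1_sqr x0 ep0 bf0 bf1.
have ip2 := integrable_wt2_sqr x0 ep0 bf0 bf1 bf2.
have HC := coercivity x0 a0 bpsi bpsi1 bpsi2 dpsi ip1 ip2.
have HS := sech2_psi_le x0 a0 bpsi bpsi1 dpsi ip1.
have HE := @energy_le _ x0 kappa a eps kappa0 a0 ep0 ep1 f0 f1 f2 f3 f4
  bf0 bf1 bf2 bf3 bf4 df0 df1 df2 df3 M d D e fM dD e0 if0 fe.
rewrite -/J in HC HS.
apply: (@absorb y (11 / 6 / a ^+ 2) (5 / 3 * a) (128 * kappa ^+ 2 * a ^+ 6) k4
  (3 / 32 * a ^+ 2) (3 / 16 * a ^+ 5) c3 (e ^+ 2) eps C4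
  (\int[mu]_x wt x0 eps f0 x ^+ 2) _ _ _ (J ^+ 2) (d ^+ 2) r) => //.
- exact: ltW.
- exact: sqr_ge0.
- exact: ltW.
- exact: ltW.
- by apply: Rintegral_ge0 => x _; exact: sqr_ge0.
- by apply: Rintegral_ge0 => x _; exact: sqr_ge0.
- exact: sqr_ge0.
- by rewrite -ler_pdivlMr.
- have := sqr_integral_le eps bf0 fM; rewrite -/J -/r => H.
  have k64 : 0 <= 64 * kappa ^+ 2 * a ^+ 6 by rewrite !(mulr_ge0, exprn_ge0).
  have := ler_wpM2l k64 H.
  set J0 := \int[mu]_x (s x * f0 x) => {}H.
  have -> : d ^+ 2 = 64 * kappa ^+ 2 * a ^+ 6 * J0 ^+ 2 by rewrite dE -/J0; ring.
  apply: (le_trans H); rewrite le_eqVlt; apply/orP; left; apply/eqP.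
  by rewrite /k4; field; exact: lt0r_neq0.
- apply: le_trans fe; apply: le_Rintegral => //.
    exact: integrable_wt_sqr.
  move=> x _; rewrite /wt exprMn ler_piMl ?sqr_ge0//.
  by rewrite exprn_ile1 ?onem_sqr_profile_ge0// gerBl sqr_ge0.
apply: (le_trans HE); rewrite -/G eG -/CM -/C4.
rewrite lerD2r lerD2r.
have := sqr_wt_integral_le eps bf0 fM; rewrite -/J -/r.
set J0 := \int[mu]_x (s x * f0 x).
set JW := \int[mu]_x (s x * (_ ^+ 2 * f0 x)) => H.
have -> : d * (a ^+ 2 / kappa) * JW = - (8 * a ^+ 5 * (J0 * JW)).
  by rewrite dE -/J0; field; exact: lt0r_neq0.
have a5 : 0 <= 8 * a ^+ 5 by rewrite !(mulr_ge0, exprn_ge0).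
have := ler_wpM2l a5 H.
have -> : 8 * a ^+ 5 * (4 * M ^+ 2 / a * r) = c3 * r.
  by rewrite /c3; field; exact: lt0r_neq0.
rewrite mulrBr; move: HC.
move: (8 * a ^+ 5 * _) (8 * a ^+ 5 * _) (\int[mu]_x (_ + _)) => T1 T2 T3.
move: (_ + _ + 3 / 16 * a ^+ 5 * _) => T4; lra.
Qed.

End dissipation_inequality.

(** * Regularity in time *)

Section derivatives.
Context {R : realType}.
Implicit Types (g : R -> R) (t s l x y z : R).

Lemma is_derive_of_error g t l :
  (forall e, 0 < e -> \forall s \near t, `|g s - g t - l * (s - t)| <= e * `|s - t|) ->
  is_derive t 1 g l.
Proof.
move=> H.
have C : h^-1 *: (g (h *: 1 + t) - g t) @[h --> 0^'] --> l.
  apply/cvgrPdist_le => e e0; have /nbhs_ballP[r /= r0 Hr] := H e e0.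
  apply/nbhs_ballP; exists r => //= h; rewrite /ball/= sub0r normrN => hr h0.
  have h0' : 0 < `|h| by rewrite normr_gt0.
  have /Hr : ball t r (h + t) by rewrite /ball/= opprD addrCA subrr addr0 normrN.
  rewrite addrK => K; rewrite /GRing.scale/= mulr1.
  have -> : l - h^-1 * (g (h + t) - g t) = - h^-1 * (g (h + t) - g t - l * h).
    by field.
  by rewrite mulNr normrN normrM normfV ler_pdivrMl// [leRHS]mulrC.
split; first by apply/cvg_ex; exists l.
exact/cvg_lim.
Qed.

Lemma is_derive_interior (J : set R) g t : (\forall s \near t, J s) ->
  derivable_within J g t -> is_derive t 1 g (deriv_within J g t).
Proof.
move=> Jt dg; apply: is_derive_of_error => e e0.
have /cvgrPdist_le/(_ e e0) : diff_quot g t s @[s --> within J t^'] -->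
  deriv_within J g t by [].
rewrite /deriv_within; move: (lim _) => l.
rewrite near_withinE => H.
have : \forall s \near t, s != t -> J s -> `|l - diff_quot g t s| <= e.
  exact: H.
apply: filterS2 Jt => s Js K.
have [->|st] := eqVneq s t; first by rewrite !subrr mulr0 subrr normr0 mulr0.
have st0 : s - t != 0 by rewrite subr_eq0.
have -> : g s - g t - l * (s - t) = - (l - diff_quot g t s) * (s - t).
  by rewrite /diff_quot; field.
by rewrite mulNr normrN normrM ler_wpM2r//; exact: K.
Qed.

Lemma mean_value_le (f f1 : R -> R) (K : R) (x y : R) :
  (forall z, is_derive z 1 f (f1 z)) -> (forall z, `|f1 z| <= K) ->
  `|f x - f y| <= K * `|x - y|.
Proof.
move=> df fK; wlog xy : x y / x <= y => [H|].
  by have [/H//|/ltW/H] := leP x y; rewrite distrC (distrC x).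
have cf := derive_continuous df.
have [z _ E] := @MVT_segment R f f1 x y xy (fun z _ => df z)
  (continuous_subspaceT cf).
by rewrite distrC E normrM distrC ler_wpM2r// distrC.
Qed.

(** Landau's interpolation: some point of [x, x + h] has slope at most 2 A / h by the mean value
    theorem, and moving from there to [x] costs at most K h. *)
Lemma derivative_interpolation (f f1 f2 : R -> R) (A K h x : R) : 0 < h ->
  (forall z, is_derive z 1 f (f1 z)) -> (forall z, is_derive z 1 f1 (f2 z)) ->
  (forall z, `|f z| <= A) -> (forall z, `|f2 z| <= K) ->
  `|f1 x| <= 2 * A / h + K * h.
Proof.
move=> h0 df df1 fA f2K.
have cf := derive_continuous df.
have xh : x <= x + h by rewrite lerDl ltW.
have [z zx E] := @MVT_segment R f f1 x (x + h) xh (fun z _ => df z)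
  (continuous_subspaceT cf).
move: zx; rewrite in_itv/= => /andP[xz zxh].
have H1 : `|f1 z| <= 2 * A / h.
  rewrite ler_pdivlMr// -[X in _ * X](gtr0_norm h0) -normrM.
  have -> : f1 z * h = f (x + h) - f x by rewrite E; ring.
  by rewrite (le_trans (ler_normB _ _))// mulr_natl mulr2n lerD.
have H2 := mean_value_le x z df1 f2K.
have K0 : 0 <= K by rewrite (le_trans _ (f2K 0)).
have H3 : `|x - z| <= h.
  by rewrite ler_norml; apply/andP; split; lra.
rewrite -[f1 x](subrK (f1 z)) addrC (le_trans (ler_normD _ _))// lerD//.
by rewrite (le_trans H2)// ler_wpM2l.
Qed.

(** The increment is split into a move in space at the fixed time [t], where the chain rule applies,
    and a move in time at the fixed place x + delta s, where the mean value theorem and the joint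
    continuity of [utt] leave an error o(s - t). *)
Lemma is_derive_moving (u : R -> R -> R) (delta : R -> R) (u1 d t x : R)
    (utt : R -> R -> R) :
  is_derive t 1 delta d ->
  is_derive (x + delta t) 1 (u ^~ t) u1 ->
  (exists2 r : R, 0 < r & forall s y, `|s - t| < r -> is_derive s 1 (u y) (utt y s)) ->
  (forall e : R, 0 < e -> exists2 r : R, 0 < r & forall y s,
     `|y - (x + delta t)| < r -> `|s - t| < r ->
     `|utt y s - utt (x + delta t) t| <= e) ->
  is_derive t 1 (fun s => u (x + delta s) s) (utt (x + delta t) t + d * u1).
Proof.
move=> dd du [r2 r20 Hr2] ct.
have dx : is_derive t 1 (fun s => x + delta s) d.
  apply: (is_derive_eq (is_derive_add (is_derive_cst x t 1) dd)).
  by rewrite add0r.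
have d1 : is_derive t 1 (fun s => u (x + delta s) t) (d * u1).
  rewrite mulrC; exact: (@is_derive1_comp _ (u ^~ t) (fun s => x + delta s) t _ _ du dx).
pose r s := u (x + delta s) s - u (x + delta s) t.
have d2 : is_derive t 1 r (utt (x + delta t) t).
  apply: is_derive_of_error => e e0.
  have [rho rho0 Hrho] := ct e e0.
  have [ddt _] := dx.
  have cdel : {for t, continuous (fun s => x + delta s)}.
    exact/differentiable_continuous/derivable1_diffP.
  have near1 : \forall s \near t, `|x + delta s - (x + delta t)| < rho.
    move/cvgrPdist_lt : cdel => /(_ _ rho0); apply: filterS => s.
    by rewrite distrC.
  have near2 : \forall s \near t, `|s - t| < Num.min rho r2.
    apply/nbhs_ballP; exists (Num.min rho r2) => /=; first by rewrite lt_min rho0.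
    by move=> s; rewrite /ball/= distrC.
  apply: filterS2 near1 near2 => s sd; rewrite lt_min => /andP[sr s2].
  rewrite /r subrr subr0.
  have [c [cst cE]] : exists c, `|c - t| <= `|s - t| /\
      u (x + delta s) s - u (x + delta s) t = utt (x + delta s) c * (s - t).
    have D z : `|z - t| <= `|s - t| -> is_derive z 1 (u (x + delta s)) (utt (x + delta s) z).
      by move=> zt; apply: Hr2; exact: le_lt_trans zt _.
    have cont a b : (forall z, z \in `[a, b] -> `|z - t| <= `|s - t|) ->
        {within `[a, b], continuous (u (x + delta s))}.
      move=> H; apply: derivable_within_continuous => z /H/D[]//.
    have [ts|st] := leP t s.
      have H z : z \in `[t, s] -> `|z - t| <= `|s - t|.
        by rewrite in_itv/= => /andP[? ?]; rewrite !ger0_norm ?subr_ge0// lerD2r.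
      have [] := @MVT_segment R (u (x + delta s)) (utt (x + delta s)) t s ts _ (cont _ _ H).
        by move=> z zz; apply/D/H; apply: subset_itv_oo_cc zz.
      by move=> c /H ct' E; exists c; split.
    have H z : z \in `[s, t] -> `|z - t| <= `|s - t|.
      rewrite in_itv/= => /andP[? ?]; rewrite !ler0_norm ?subr_le0// ?(ltW st)//.
      by rewrite lerN2 lerD2r.
    have [] := @MVT_segment R (u (x + delta s)) (utt (x + delta s)) s t (ltW st) _ (cont _ _ H).
      by move=> z zz; apply/D/H; apply: subset_itv_oo_cc zz.
    move=> c /H ct' E; exists c; split => //.
    by rewrite -opprB E; ring.
  rewrite cE -mulrBl normrM ler_wpM2r//.
  by apply: Hrho => //; rewrite (le_lt_trans cst).
have := is_derive_add d2 d1.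
by congr is_derive; apply/funext => s; rewrite /r subrK.
Qed.

End derivatives.

(** * Pointwise bounds from finite Hoelder norms *)

Section hoelder_bounds.
Context {R : realType}.
Implicit Types (J : set R) (f : R -> R -> R) (x y t s K : R).

Let adde3_lty (b c d : \bar R) : (0 <= b)%E -> (0 <= c)%E -> (0 <= d)%E ->
  (b + c + d < +oo)%E -> [/\ (b < +oo)%E, (c < +oo)%E & (d < +oo)%E].
Proof.
by case: b c d => [b| |] [c| |] [d| |] // *; split; rewrite ?ltry.
Qed.

Let nneg_sup_ge0 (A : set R) : (0 <= nneg_sup A)%E.
Proof. by rewrite /nneg_sup le_max lexx. Qed.

Let nneg_sup_bound (A : set R) : (nneg_sup A < +oo)%E ->
  exists2 K : R, 0 <= K & forall r, A r -> r <= K.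
Proof.
move=> Aoo; have A0 := nneg_sup_ge0 A.
have fA : nneg_sup A \is a fin_num by rewrite ge0_fin_numE.
exists (fine (nneg_sup A)); first by rewrite fine_ge0.
move=> r Ar; rewrite -lee_fin fineK// /nneg_sup le_max.
by apply/orP; right; apply: ereal_sup_ubound; exists r.
Qed.

Let sup_ge0 J f : (0 <= strip_sup_norm J f)%E. Proof. exact: nneg_sup_ge0. Qed.

Let hoelder_norm_ge0 alpha J f : (0 <= hoelder_norm alpha J f)%E.
Proof. by rewrite /hoelder_norm !adde_ge0 ?nneg_sup_ge0. Qed.

Let sup_bound J f : (strip_sup_norm J f < +oo)%E ->
  exists2 K : R, 0 <= K & forall x t, J t -> `|f x t| <= K.
Proof.
move=> /nneg_sup_bound[K K0 H]; exists K => // x t Jt.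
by apply: H; exists x, t.
Qed.

Lemma hoelder_space_bound alpha J f : 0 < alpha -> hoelder_space alpha J f ->
  exists K : R, [/\ 0 <= K, forall x t, J t -> `|f x t| <= K,
    forall x y t, J t -> `|f x t - f y t| <= K * `|x - y| `^ alpha &
    forall x t s, J t -> J s -> `|f x t - f x s| <= K * `|t - s| `^ (alpha / 4)].
Proof.
move=> al0; rewrite /hoelder_space /hoelder_norm => H.
have S0 := sup_ge0 J f.
have X0 : (0 <= hoelder_x alpha J f)%E by exact: nneg_sup_ge0.
have T0 : (0 <= hoelder_t (alpha / 4) J f)%E by exact: nneg_sup_ge0.
have [Soo Xoo Too] := adde3_lty S0 X0 T0 H.
have [K1 K10 H1] := sup_bound Soo; have [K2 K20 H2] := nneg_sup_bound Xoo.
have [K3 K30 H3] := nneg_sup_bound Too.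
exists (K1 + K2 + K3); split.
- by rewrite !addr_ge0.
- by move=> x t Jt; rewrite (le_trans (H1 x t Jt))// -addrA lerDl addr_ge0.
- move=> x y t Jt; have [->|xy] := eqVneq x y.
    by rewrite !subrr normr0 mulr_ge0 ?powR_ge0// !addr_ge0.
  have xy0 : 0 < `|x - y| `^ alpha by rewrite powR_gt0// normr_gt0 subr_eq0.
  rewrite -ler_pdivrMr// (@le_trans _ _ K2)//; last by rewrite addrAC lerDr addr_ge0.
  by apply: H2; exists x, y, t.
- move=> x t s Jt Js; have [->|ts] := eqVneq t s.
    by rewrite !subrr normr0 mulr_ge0 ?powR_ge0// !addr_ge0.
  have ts0 : 0 < `|t - s| `^ (alpha / 4) by rewrite powR_gt0// normr_gt0 subr_eq0.
  rewrite -ler_pdivrMr// (@le_trans _ _ K3)//; last by rewrite lerDr addr_ge0.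
  by apply: H3; exists x, t, s.
Qed.

Lemma hoelder_space4_bound alpha J f : 0 < alpha -> hoelder_space4 alpha J f ->
  exists K : R, [/\ 0 <= K,
    forall (j : nat) x t, (j < 4)%N -> J t -> `|dx j f x t| <= K,
    hoelder_space alpha J (dx 4 f) & hoelder_space alpha J (dt J f)].
Proof.
move=> al0 [_ _]; rewrite /hoelder_norm4.
set S := (\sum_(j < 4) _)%E; set N1 := hoelder_norm _ _ (dx 4 f).
set N2 := hoelder_norm _ _ _ => H.
have S0 : (0 <= S)%E by apply: sume_ge0 => j _; exact: sup_ge0.
have N10 : (0 <= N1)%E by exact: hoelder_norm_ge0.
have N20 : (0 <= N2)%E by exact: hoelder_norm_ge0.
have [Soo N1oo N2oo] := adde3_lty S0 N10 N20 H.
have SE : exists2 K : R, 0 <= K & S = K%:E.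
  exists (fine S); first by rewrite fine_ge0.
  by rewrite fineK// ge0_fin_numE.
have [K K0 SK] := SE; exists K; split; [exact: K0| |exact: N1oo|exact: N2oo].
move=> j x t j4 Jt; rewrite -lee_fin -SK /S (bigD1 (Ordinal j4))//=.
apply: (@le_trans _ _ (strip_sup_norm J (dx j f))).
  rewrite /strip_sup_norm /nneg_sup le_max; apply/orP; right.
  by apply: ereal_sup_ubound; exists `|dx j f x t| => //; exists x, t.
by rewrite leeDl// sume_ge0// => i _; exact: sup_ge0.
Qed.

End hoelder_bounds.

(** * The front and the equation linearized around it *)

Section front.
Context {R : realType}.
Variables (um up kappa x0 : R).
Hypotheses (hu : um < up) (kappa0 : 0 < kappa).
Local Notation a := (kappa * (up - um) / 2).
Local Notation tau := (profile x0 a).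
Local Notation s x := (1 - tau x ^+ 2).
Implicit Types x : R.

Lemma front_rate_gt0 : 0 < a.
Proof. by rewrite divr_gt0// mulr_gt0// subr_gt0. Qed.

Definition front1 x := a ^+ 2 / kappa * s x.
Definition front2 x := - (2 * a ^+ 3 / kappa) * (tau x * s x).
Definition front3 x := - (2 * a ^+ 4 / kappa) * (s x * (1 - 3 * tau x ^+ 2)).
Definition front4 x := 8 * a ^+ 5 / kappa * (tau x * (s x * (2 - 3 * tau x ^+ 2))).

Lemma frontE : front um up kappa x0 = fun x => (um + up) / 2 + (up - um) / 2 * tau x.
Proof. by []. Qed.

Let dtau := is_derive_profile x0 a.
Let kneq0 := lt0r_neq0 kappa0.

Lemma is_derive_front x : is_derive x 1 (front um up kappa x0) (front1 x).
Proof. by rewrite frontE; derive; rewrite /front1; field. Qed.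

Lemma is_derive_front1 x : is_derive x 1 front1 (front2 x).
Proof. by rewrite /front1; derive; rewrite /front2; field. Qed.

Lemma is_derive_front2 x : is_derive x 1 front2 (front3 x).
Proof. by rewrite /front2; derive; rewrite /front3; field. Qed.

Lemma is_derive_front3 x : is_derive x 1 front3 (front4 x).
Proof. by rewrite /front3; derive; rewrite /front4; field. Qed.

Lemma derive1_is_derive (f df : R -> R) : (forall x, is_derive x 1 f (df x)) ->
  derive1 f = df.
Proof. by move=> fdf; apply/funext => x; rewrite derive1E; have [_] := fdf x. Qed.

(* The front is a stationary solution, so only the terms of [flux2] in the
   perturbation [v_j - front_j] remain. *)
Lemma cahn_hilliard_flux (v v1 v2 v3 v4 : R -> R) (z : R) :
  (forall x, is_derive x 1 v (v1 x)) -> (forall x, is_derive x 1 v1 (v2 x)) ->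
  (forall x, is_derive x 1 v2 (v3 x)) -> (forall x, is_derive x 1 v3 (v4 x)) ->
  forall x, derive1n 2 (fun y => - v2 y + B um up kappa (v y)) (x + z) =
  flux2 x0 kappa a (fun x => v (x + z) - front um up kappa x0 x)
    (fun x => v1 (x + z) - front1 x) (fun x => v2 (x + z) - front2 x)
    (fun x => v4 (x + z) - front4 x) x.
Proof.
move=> dv dv1 dv2 dv3 x.
pose g1 y := - v3 y + kappa ^+ 2 * (- 2 * ((v y - um) * (up - v y))
  + (um + up - 2 * v y) * (up - v y) - (um + up - 2 * v y) * (v y - um)) * v1 y.
pose g2 y := - v4 y + kappa ^+ 2 * (- 2 * ((v y - um) * (up - v y))
  + (um + up - 2 * v y) * (up - v y) - (um + up - 2 * v y) * (v y - um)) * v2 y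
  - 6 * kappa ^+ 2 * (um + up - 2 * v y) * v1 y ^+ 2.
have d1 (y : R) : is_derive y 1 (fun y => - v2 y + B um up kappa (v y)) (g1 y).
  by rewrite /B; derive; rewrite /g1; ring.
have d2 (y : R) : is_derive y 1 g1 (g2 y).
  by rewrite /g1; derive; rewrite /g2; ring.
rewrite /= (derive1_is_derive d1) (derive1_is_derive d2).
rewrite /flux2 frontE /g2 /front1 /front2 /front4; field.
exact: kneq0.
Qed.

End front.

Section time_regularity.
Context {R : realType}.
Implicit Types (x y t s r e l : R) (J : set R) (g : R -> R).

Lemma powR_small (alpha e : R) : 0 < alpha -> 0 < e ->
  exists2 r : R, 0 < r & forall z : R, 0 <= z -> z < r -> z `^ alpha <= e.
Proof.
move=> al0 e0; exists (e `^ alpha^-1); first by rewrite powR_gt0.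
move=> z z0 zr; have -> : e = (e `^ alpha^-1) `^ alpha.
  by rewrite -powRrM mulVf ?lt0r_neq0// powRr1// ltW.
by rewrite ge0_ler_powR ?nnegrE ?powR_ge0// ltW.
Qed.

Lemma within_dnbhs_interior J t : (\forall s \near t, J s) ->
  within J t^' = t^'.
Proof.
move=> Jt; rewrite eqEsubset; split => P /=.
  rewrite /within/= => H.
  have Jt' : \forall s \near t^', J s by exact: nbhs_dnbhs.
  by apply: filterS2 Jt' H => s Js; exact.
by rewrite /within/=; apply: filterS => s Ps _.
Qed.

Lemma deriv_within_interior J J' g t : (\forall s \near t, J s) ->
  (\forall s \near t, J' s) -> deriv_within J g t = deriv_within J' g t.
Proof. by move=> Jt J't; rewrite /deriv_within !within_dnbhs_interior. Qed.

Lemma derivable_within_continuity J g t e : derivable_within J g t -> 0 < e ->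
  exists2 r : R, 0 < r & forall s, J s -> `|s - t| < r -> `|g s - g t| <= e.
Proof.
move=> dg e0.
have /cvgrPdist_le/(_ 1 ltr01) : diff_quot g t s @[s --> within J t^'] -->
  deriv_within J g t by [].
rewrite /deriv_within; move: (lim _) => l.
rewrite near_withinE => H.
have /nbhs_ballP[r /= r0 Hr] : \forall s \near t,
  s != t -> J s -> `|l - diff_quot g t s| <= 1 by exact: H.
have l1 : 0 < `|l| + 1 by rewrite ltr_wpDl.
exists (Num.min r (e / (`|l| + 1))); first by rewrite lt_min r0 divr_gt0.
move=> s Js; rewrite lt_min => /andP[sr se].
have [->|st] := eqVneq s t; first by rewrite subrr normr0 ltW.
have st0 : s - t != 0 by rewrite subr_eq0.
have K : `|l - diff_quot g t s| <= 1 by apply: Hr => //; rewrite /ball/= distrC.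
have -> : g s - g t = diff_quot g t s * (s - t) by rewrite /diff_quot; field.
rewrite normrM (@le_trans _ _ ((`|l| + 1) * `|s - t|))//; last first.
  by rewrite mulrC -ler_pdivlMr// ltW.
rewrite ler_wpM2r//.
have -> : diff_quot g t s = l - (l - diff_quot g t s) by ring.
by rewrite (le_trans (ler_normB _ _))// lerD2l.
Qed.

Lemma itv_interior (p q t : R) : p < t -> t < q -> \forall s \near t, `[p, q]%classic s.
Proof.
move=> pt tq; have /near_in_itvoo : t \in `]p, q[ by rewrite in_itv/= pt tq.
by apply: filterS => s; exact: subset_itv_oo_cc.
Qed.

(** Time derivatives are treated at interior times only: there the derivatives relative to
    [sigma, T0] and to [0, T0] are both the two-sided one. The joint continuity in the last item
    comes from the Hoelder bounds in x and in t, each used for half of [e]. *)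
Lemma regularity_after (alpha sigma T0 : R) (u : R -> R -> R) :
  0 < alpha -> 0 < sigma < T0 -> hoelder_space4 alpha `[sigma, T0] u ->
  exists K : R, [/\ 0 <= K,
    forall (j : nat) x t, (j <= 4)%N -> sigma <= t <= T0 -> `|dx j u x t| <= K,
    forall (j : nat) x t, (j < 4)%N -> sigma <= t <= T0 ->
      is_derive x 1 (dx j u ^~ t) (dx j.+1 u x t),
    forall t, sigma <= t <= T0 -> continuous (dx 4 u ^~ t) &
    forall t, sigma < t < T0 ->
    [/\ forall x, is_derive t 1 (u x) (dt `[0, T0] u x t),
        forall x, `|dt `[0, T0] u x t| <= K &
        forall x e, 0 < e -> exists2 r : R, 0 < r & forall y s,
          `|y - x| < r -> `|s - t| < r ->
          `|dt `[0, T0] u y s - dt `[0, T0] u x t| <= e]].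
Proof.
move=> al0 /andP[s0 sT] H; have [dxu dtu _] := H.
have [K1 [K10 dxK h4 ht]] := hoelder_space4_bound al0 H.
have [K2 [K20 d4K d4x _]] := hoelder_space_bound al0 h4.
have [K3 [K30 dtK dtx dtt]] := hoelder_space_bound al0 ht.
have al40 : 0 < alpha / 4 by rewrite divr_gt0.
have inJ t : sigma <= t <= T0 -> `[sigma, T0]%classic t by rewrite /= in_itv.
have dtE x t : sigma < t < T0 -> dt `[0, T0] u x t = dt `[sigma, T0] u x t.
  move=> /andP[st tT]; apply: deriv_within_interior; apply: itv_interior => //.
  exact: lt_trans st.
exists (K1 + K2 + K3); split.
- by rewrite !addr_ge0.
- move=> j x t; rewrite leq_eqVlt => /predU1P[->|j4] /inJ Jt.
    by rewrite (le_trans (d4K x t Jt))// addrAC lerDr addr_ge0.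
  by rewrite (le_trans (dxK j x t j4 Jt))// -addrA lerDl addr_ge0.
- move=> j x t j4 /inJ Jt.
  have D := dxu j x t j4 Jt; split; first exact: D.
  by rewrite /dx/= derive1E.
- move=> t /inJ Jt x; apply/cvgrPdist_le => e e0.
  have K20' : 0 < K2 + 1 by rewrite ltr_wpDl.
  have [|r r0 Hr] := @powR_small alpha (e / (K2 + 1)) al0; first by rewrite divr_gt0.
  apply/nbhs_ballP; exists r => //= y xy.
  rewrite (le_trans (d4x x y t Jt))//.
  rewrite (@le_trans _ _ ((K2 + 1) * `|x - y| `^ alpha))//.
    by rewrite ler_wpM2r ?powR_ge0// lerDl.
  by rewrite mulrC -ler_pdivlMr// Hr.
- move=> t sTt; have /andP[st tT] := sTt.
  have sTt' : sigma <= t <= T0 by rewrite !ltW.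
  split.
  + move=> x; rewrite dtE//; apply: is_derive_interior; first exact: itv_interior.
    exact: dtu (inJ _ sTt').
  + move=> x; rewrite dtE// (le_trans (dtK x t (inJ _ sTt')))// lerDr addr_ge0//.
  + move=> x e e0.
    have K30' : 0 < 2 * (K3 + 1) by rewrite mulr_gt0// ltr_wpDl.
    have e1 : 0 < e / (2 * (K3 + 1)) by rewrite divr_gt0.
    have [r1 r10 Hr1] := powR_small al0 e1.
    have [r2 r20 Hr2] := powR_small al40 e1.
    exists (Num.min (Num.min r1 r2) (Num.min (t - sigma) (T0 - t))).
      by rewrite !lt_min r10 r20 !subr_gt0 st tT.
    move=> y s; rewrite !lt_min => /andP[/andP[yr1 _] _].
    move=> /andP[/andP[_ sr2] /andP[ss sT']].
    have sTs : sigma < s < T0.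
      by move: ss sT'; rewrite !ltr_norml => /andP[? ?] /andP[? ?]; lra.
    have sTs' : sigma <= s <= T0 by case/andP: sTs => ? ?; rewrite !ltW.
    rewrite !dtE//; set D := dt _ u.
    have -> : D y s - D x t = (D y s - D x s) + (D x s - D x t) by ring.
    have B1 : `|D y s - D x s| <= e / 2.
      rewrite (le_trans (dtx y x s (inJ _ sTs')))//.
      rewrite (@le_trans _ _ ((K3 + 1) * (e / (2 * (K3 + 1)))))//.
        by rewrite ler_pM ?powR_ge0// ?lerDl// Hr1.
      by rewrite le_eqVlt; apply/orP; left; apply/eqP; field; rewrite lt0r_neq0// ltr_wpDl.
    have B2 : `|D x s - D x t| <= e / 2.
      rewrite (le_trans (dtt x s t (inJ _ sTs') (inJ _ sTt')))//.
      rewrite (@le_trans _ _ ((K3 + 1) * (e / (2 * (K3 + 1)))))//.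
        by rewrite ler_pM ?powR_ge0// ?lerDl// Hr2.
      by rewrite le_eqVlt; apply/orP; left; apply/eqP; field; rewrite lt0r_neq0// ltr_wpDl.
    by rewrite (le_trans (ler_normD _ _))// (@le_trans _ _ (e / 2 + e / 2)) ?lerD// -splitr.
Qed.

End time_regularity.

(** * The equation for the perturbation in the moving frame *)

Section evolution.
Context {R : realType}.
Variables (um up kappa alpha x0 T0 : R) (u : R -> R -> R) (delta : R -> R).
Hypotheses (hu : um < up) (kappa0 : 0 < kappa) (al0 : 0 < alpha) (T00 : 0 < T0).
Hypothesis hshift : is_shift um up kappa x0 T0 u delta.
Hypothesis hadm : admissible um up kappa x0 alpha T0 u delta.
Implicit Types (x y t s e r p q eps : R).
Local Notation mu := (@lebesgue_measure R).
Local Notation integrable f := (mu.-integrable setT (EFin \o f)).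
Local Notation a := (kappa * (up - um) / 2).
Local Notation tau := (profile x0 a).
Local Notation phi := (perturbation um up kappa x0 u delta).
Local Notation ut := (dt `[0, T0] u).

Definition pert1 x t := dx 1 u (x + delta t) t - front1 um up kappa x0 x.
Definition pert2 x t := dx 2 u (x + delta t) t - front2 um up kappa x0 x.
Definition pert3 x t := dx 3 u (x + delta t) t - front3 um up kappa x0 x.
Definition pert4 x t := dx 4 u (x + delta t) t - front4 um up kappa x0 x.
Definition shift_speed t := deriv_within `[0, T0] delta t.
(** The right-hand side of the equation in the frame moving with the shift. The bracket multiplying
    the speed is the derivative of the front plus that of [phi], that is, u_x at the shifted
    point. *)
Definition pert_t x t :=
  flux2 x0 kappa a (phi ^~ t) (pert1 ^~ t) (pert2 ^~ t) (pert4 ^~ t) x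
  + shift_speed t * (a ^+ 2 / kappa * (1 - tau x ^+ 2) + pert1 x t).

Let a0 : 0 < a. Proof. exact: front_rate_gt0. Qed.
Let btau := bc_profile x0 a.

Let bfront : bounded_continuous (front um up kappa x0).
Proof. by rewrite frontE; bc. Qed.
Let bfront1 : bounded_continuous (front1 um up kappa x0).
Proof. by rewrite /front1; bc. Qed.
Let bfront2 : bounded_continuous (front2 um up kappa x0).
Proof. by rewrite /front2; bc. Qed.
Let bfront3 : bounded_continuous (front3 um up kappa x0).
Proof. by rewrite /front3; bc. Qed.
Let bfront4 : bounded_continuous (front4 um up kappa x0).
Proof. by rewrite /front4; bc. Qed.

Let pert_bc (v f : R -> R) (z K : R) : continuous v -> (forall x, `|v x| <= K) ->
  bounded_continuous f -> bounded_continuous (fun x => v (x + z) - f x).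
Proof.
move=> cv vK bf; apply: (@bc_add _ (fun x => v (x + z)) (fun x => - f x));
  last exact: bc_opp.
split; last by exists K => x.
move=> x; apply: continuous_comp; last exact: cv.
by apply: cvgD; [exact: cvg_id|exact: cvg_cst].
Qed.

Lemma perturbation_bound : exists2 M : R, 0 <= M &
  (forall x t, 0 <= t <= T0 -> `|phi x t| <= M) /\
  (forall t, 0 <= t <= T0 -> bounded_continuous (phi ^~ t)).
Proof.
have [_ _ hs _ _] := hadm.
have [K [K0 uK ux _]] := hoelder_space_bound al0 hs.
have [_ [N fN]] := bfront.
have N0 : 0 <= N by rewrite (le_trans _ (fN 0)).
have inJ r : 0 <= r <= T0 -> `[0, T0]%classic r by rewrite /= in_itv.
exists (K + N); first by rewrite addr_ge0.
split=> [x t /inJ Jt|t /inJ Jt].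
  rewrite /perturbation (le_trans (ler_normB _ _))// lerD//.
  exact: uK.
apply: (@pert_bc (u ^~ t) _ (delta t) K) => //; last by move=> x; exact: uK.
move=> x; apply/cvgrPdist_le => e e0.
have K1 : 0 < K + 1 by rewrite ltr_wpDl.
have [|r r0 Hr] := @powR_small _ alpha (e / (K + 1)) al0; first by rewrite divr_gt0.
apply/nbhs_ballP; exists r => //= y xy.
rewrite (le_trans (ux x y t Jt))// (@le_trans _ _ ((K + 1) * `|x - y| `^ alpha))//.
  by rewrite ler_wpM2r ?powR_ge0// lerDl.
by rewrite mulrC -ler_pdivlMr// Hr.
Qed.

(** Valid up to the endpoints of [0, T0], since it rests on the Hoelder norm of [u] over the whole
    interval; the limit of the energies at the final time uses it there. *)
Lemma perturbation_continuity x t e : 0 <= t <= T0 -> 0 < e ->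
  exists2 r : R, 0 < r & forall s, 0 <= s <= T0 -> `|s - t| < r ->
    `|phi x s - phi x t| <= e.
Proof.
move=> tT e0; have [_ _ hs _ _] := hadm.
have [K [K0 _ ux utm]] := hoelder_space_bound al0 hs.
have inJ r : 0 <= r <= T0 -> `[0, T0]%classic r by rewrite /= in_itv.
have K1 : 0 < 2 * (K + 1) by rewrite mulr_gt0// ltr_wpDl.
have e1 : 0 < e / (2 * (K + 1)) by rewrite divr_gt0.
have al40 : 0 < alpha / 4 by rewrite divr_gt0.
have [r1 r10 Hr1] := powR_small al0 e1.
have [r2 r20 Hr2] := powR_small al40 e1.
have [_ /(_ t tT) [ddelta _]] := hshift.
have r120 : 0 < r1 / 2 by rewrite divr_gt0.
have [r3 r30 Hr3] := derivable_within_continuity ddelta r120.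
exists (Num.min r2 r3); first by rewrite lt_min r20.
move=> s sT; rewrite lt_min => /andP[s2 s3]; rewrite /perturbation.
have -> : u (x + delta s) s - front um up kappa x0 x -
    (u (x + delta t) t - front um up kappa x0 x) =
    (u (x + delta s) s - u (x + delta t) s) + (u (x + delta t) s - u (x + delta t) t).
  by ring.
have E2 : (K + 1) * (e / (2 * (K + 1))) = e / 2.
  by field; rewrite lt0r_neq0// ltr_wpDl.
have B1 : `|u (x + delta s) s - u (x + delta t) s| <= e / 2.
  rewrite (le_trans (ux _ _ s (inJ _ sT)))// -E2 ler_pM ?powR_ge0// ?lerDl//.
  rewrite Hr1// opprD addrACA subrr add0r.
  by rewrite (le_lt_trans (Hr3 s (inJ _ sT) s3))// ltr_pdivrMr// ltr_pMr// ltr1n.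
have B2 : `|u (x + delta t) s - u (x + delta t) t| <= e / 2.
  rewrite (le_trans (utm _ _ _ (inJ _ sT) (inJ _ tT)))// -E2.
  by rewrite ler_pM ?powR_ge0// ?lerDl// Hr2.
by rewrite (le_trans (ler_normD _ _))// [leRHS]splitr lerD.
Qed.

(** As kappa L = 2 a, [eta] equals 8 kappa^2 a, and the derivative of the front is a^2 / kappa times
    sech^2; the product is 8 kappa a^3. *)
Lemma shift_speedE t : 0 <= t <= T0 -> shift_speed t =
  - (8 * kappa * a ^+ 3) * \int[mu]_x ((1 - tau x ^+ 2) * phi x t).
Proof.
move=> tT; have [_ /(_ t tT)[_]] := hshift; rewrite -/(shift_speed t) => ->.
have [M M0 [_ /(_ t tT) bphi]] := perturbation_bound.
rewrite (derive1_is_derive (is_derive_front um up x0 kappa0)).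
have -> : \int[mu]_x (front1 um up kappa x0 x * phi x t) =
    a ^+ 2 / kappa * \int[mu]_x ((1 - tau x ^+ 2) * phi x t).
  rewrite -RintegralZl//; last first.
    exact: (@integrable_sech2_mul _ x0 a a0 _ (phi ^~ t) bphi (fun=> erefl)).
  by apply: eq_Rintegral => x _; rewrite /front1 mulrA.
by rewrite mulrA; congr (_ * _); rewrite /Defs.eta; field; exact: lt0r_neq0.
Qed.

Lemma shift_speed_bound : exists D : R, forall t, 0 <= t <= T0 -> `|shift_speed t| <= D.
Proof.
have [M M0 [phiM bphi]] := perturbation_bound.
exists (8 * kappa * a ^+ 3 * (M * (2 / a))) => t tT.
have K0 : 0 <= 8 * kappa * a ^+ 3.
  have k0 := ltW kappa0; have a0' := ltW a0.
  by apply: mulr_ge0; [exact: mulr_ge0|exact: exprn_ge0].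
rewrite shift_speedE// normrM normrN (ger0_norm K0) ler_wpM2l//.
by apply: (J0_le x0 a0 (bphi t tT)) => x; exact: phiM.
Qed.

Section after_sigma.
Variable sigma : R.
Hypothesis sT : 0 < sigma < T0.

Let itv0 t : sigma < t < T0 -> 0 <= t <= T0.
Proof. by move: sT => /andP[? ?] /andP[? ?]; apply/andP; split; lra. Qed.

Let itvs t : sigma < t < T0 -> sigma <= t <= T0.
Proof. by move=> /andP[? ?]; rewrite !ltW. Qed.

Lemma pert_regularity t : sigma < t < T0 ->
  [/\ bounded_continuous (phi ^~ t), bounded_continuous (pert1 ^~ t),
    bounded_continuous (pert2 ^~ t), bounded_continuous (pert3 ^~ t) &
    bounded_continuous (pert4 ^~ t)] /\
  [/\ forall x, is_derive x 1 (phi ^~ t) (pert1 x t),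
    forall x, is_derive x 1 (pert1 ^~ t) (pert2 x t),
    forall x, is_derive x 1 (pert2 ^~ t) (pert3 x t) &
    forall x, is_derive x 1 (pert3 ^~ t) (pert4 x t)].
Proof.
move=> stT; have [_ _ _ h4 _] := hadm.
have [K [K0 dxK ddx c4 _]] := regularity_after al0 sT (h4 _ sT).
have stT' := itvs stT.
have cdx j : (j < 4)%N -> continuous (dx j u ^~ t).
  by move=> j4; apply: derive_continuous => x; exact: (ddx j x t j4 stT').
have dshift (v f : R -> R) dv df x : is_derive (x + delta t) 1 v dv ->
    is_derive x 1 f df -> is_derive x 1 (fun y => v (y + delta t) - f y) (dv - df).
  move=> dv' df'.
  have dd : is_derive x 1 (fun y => y + delta t) 1.
    apply: (is_derive_eq (is_derive_add (is_derive_id x 1) (is_derive_cst (delta t) x 1))).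
    by rewrite addr0.
  have dv2 := @is_derive1_comp _ v (fun y => y + delta t) x _ _ dv' dd.
  rewrite mulr1 in dv2.
  exact: (is_derive_add dv2 (is_derive_opp df')).
split; split.
- by have [M _ [_]] := perturbation_bound; apply; exact: itv0.
- by apply: (@pert_bc (dx 1 u ^~ t) _ (delta t) K) => //; [exact: cdx|move=> x; exact: dxK].
- by apply: (@pert_bc (dx 2 u ^~ t) _ (delta t) K) => //; [exact: cdx|move=> x; exact: dxK].
- by apply: (@pert_bc (dx 3 u ^~ t) _ (delta t) K) => //; [exact: cdx|move=> x; exact: dxK].
- by apply: (@pert_bc (dx 4 u ^~ t) _ (delta t) K) => //; [exact: c4|move=> x; exact: dxK].
- move=> x; apply: (dshift (u ^~ t)); last exact: is_derive_front.
  exact: (ddx 0%N _ _ isT stT').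
- move=> x; apply: (dshift (dx 1 u ^~ t)); last exact: is_derive_front1.
  exact: (ddx 1%N _ _ isT stT').
- move=> x; apply: (dshift (dx 2 u ^~ t)); last exact: is_derive_front2.
  exact: (ddx 2%N _ _ isT stT').
- move=> x; apply: (dshift (dx 3 u ^~ t)); last exact: is_derive_front3.
  exact: (ddx 3%N _ _ isT stT').
Qed.

Lemma pert_tE x t : sigma < t < T0 ->
  pert_t x t = ut (x + delta t) t + shift_speed t * dx 1 u (x + delta t) t.
Proof.
move=> stT; have [_ _ _ h4 ch] := hadm.
have [K [K0 dxK ddx c4 _]] := regularity_after al0 sT (h4 _ sT).
have stT' := itvs stT.
have tT : 0 < t <= T0.
  by move: sT stT => /andP[? ?] /andP[? ?]; apply/andP; split; lra.
rewrite (ch (x + delta t) t tT) /dx.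
have D j : (j < 4)%N -> forall x, is_derive x 1 (dx j u ^~ t) (dx j.+1 u x t).
  by move=> j4 y; exact: ddx.
have := @cahn_hilliard_flux _ um up kappa x0 kappa0 (u ^~ t) (dx 1 u ^~ t)
  (dx 2 u ^~ t) (dx 3 u ^~ t) (dx 4 u ^~ t) (delta t) (D 0%N isT) (D 1%N isT)
  (D 2%N isT) (D 3%N isT) x.
rewrite /pert_t => <-; congr (_ + _ * _).
by rewrite /pert1 /front1 addrC subrK.
Qed.

Lemma is_derive_pert x t : sigma < t < T0 -> is_derive t 1 (phi x) (pert_t x t).
Proof.
move=> stT; have [_ _ _ h4 _] := hadm.
have [K [K0 dxK ddx c4 reg]] := regularity_after al0 sT (h4 _ sT).
have stT' := itvs stT; have /andP[st tT] := stT.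
have [_ _ jc] := reg t stT.
rewrite pert_tE//.
have ddelta : is_derive t 1 delta (shift_speed t).
  apply: is_derive_interior.
    by apply: itv_interior => //; move: sT => /andP[? ?]; lra.
  by have [_ /(_ t (itv0 stT))[]] := hshift.
have near_t : exists2 r : R, 0 < r & forall s y, `|s - t| < r ->
    is_derive s 1 (u y) (ut y s).
  exists (Num.min (t - sigma) (T0 - t)); first by rewrite lt_min !subr_gt0 st.
  move=> s y; rewrite lt_min !ltr_norml => /andP[/andP[? ?] /andP[? ?]].
  have sTs : sigma < s < T0 by apply/andP; split; lra.
  by have [] := reg s sTs.
have H := is_derive_moving ddelta (ddx 0%N (x + delta t) t isT stT') near_t (jc _).
apply: (is_derive_eq (is_derive_add H (is_derive_opp (is_derive_cst (front um up kappa x0 x) t 1)))).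
by rewrite subr0.
Qed.

Lemma pert_t_bound : exists K : R, forall x t, sigma < t < T0 -> `|pert_t x t| <= K.
Proof.
have [_ _ _ h4 _] := hadm.
have [K [K0 dxK _ _ reg]] := regularity_after al0 sT (h4 _ sT).
have [D HD] := shift_speed_bound.
exists (K + D * K) => x t stT; rewrite pert_tE//.
have [_ utK _] := reg t stT.
rewrite (le_trans (ler_normD _ _))// lerD// normrM ler_pM//.
  by rewrite HD// itv0.
exact: (dxK 1%N _ _ isT (itvs stT)).
Qed.

(** Continuity of u_x in time by interpolation between the Hoelder continuity of [u] in time and the
    bound on u_xx. With h = e / (4 (K + 1)) the second-derivative term is at most e / 2, and the
    increment of [u] in time is then made at most e h / 4. *)
Let dx1_continuity y t e : sigma < t < T0 -> 0 < e -> exists2 r : R, 0 < r &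
  forall s, `|s - t| < r -> `|dx 1 u y s - dx 1 u y t| <= e.
Proof.
move=> stT e0; have [_ _ _ h4 _] := hadm.
have [K [K0 dxK ddx _ _]] := regularity_after al0 sT (h4 _ sT).
have [_ _ hs _ _] := hadm.
have [M [M0 _ _ utm]] := hoelder_space_bound al0 hs.
have /andP[st tT] := stT.
pose h := e / (4 * (K + 1)).
have K1 : 0 < K + 1 by rewrite ltr_wpDl.
have M1 : 0 < M + 1 by rewrite ltr_wpDl.
have h0 : 0 < h by rewrite divr_gt0// mulr_gt0.
have e1 : 0 < e * h / 4 / (M + 1) by rewrite !divr_gt0// mulr_gt0.
have al40 : 0 < alpha / 4 by rewrite divr_gt0.
have [r1 r10 Hr1] := powR_small al40 e1.
exists (Num.min r1 (Num.min (t - sigma) (T0 - t))).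
  by rewrite !lt_min r10 !subr_gt0 st.
move=> s; rewrite !lt_min => /andP[sr1 /andP[]]; rewrite !ltr_norml.
move=> /andP[? ?] /andP[? ?].
have stTs : sigma < s < T0 by apply/andP; split; lra.
have D (j : nat) : (j < 4)%N -> forall z : R, is_derive z 1
    (fun z : R => dx j u z s - dx j u z t) (dx j.+1 u z s - dx j.+1 u z t).
  move=> j4 z; exact: (is_derive_add (ddx j z s j4 (itvs stTs))
    (is_derive_opp (ddx j z t j4 (itvs stT)))).
have A z : `|dx 0 u z s - dx 0 u z t| <= e * h / 4.
  have inJ r : sigma < r < T0 -> `[0, T0]%classic r.
    by move=> /itv0; rewrite /= in_itv.
  rewrite (le_trans (utm z s t (inJ _ stTs) (inJ _ stT)))//.
  rewrite (@le_trans _ _ ((M + 1) * (e * h / 4 / (M + 1))))//; last first.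
    by rewrite mulrC divfK// lt0r_neq0.
  by rewrite ler_pM ?powR_ge0// ?lerDl// Hr1.
have B2 z : `|dx 2 u z s - dx 2 u z t| <= 2 * K.
  rewrite (le_trans (ler_normB _ _))// mulr_natl mulr2n.
  by rewrite lerD//; apply: (dxK 2%N _ _ isT); exact: itvs.
have := @derivative_interpolation _ _ _ _ _ _ h y h0 (D 0%N isT) (D 1%N isT) A B2.
move=> /le_trans; apply.
have -> : 2 * (e * h / 4) / h = e / 2 by field; exact: lt0r_neq0.
have : 2 * K * h <= e / 2.
  rewrite /h -subr_ge0.
  have -> : e / 2 - 2 * K * (e / (4 * (K + 1))) = e / (2 * (K + 1)).
    by field; exact: lt0r_neq0.
  by rewrite divr_ge0 ?mulr_ge0// ltW.
lra.
Qed.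

(** Uses the form u_t + delta' u_x of [pert_t] instead of its definition, so that no higher space
    derivative has to be followed in time. *)
Lemma pert_t_continuous x t : sigma < t < T0 -> {for t, continuous (pert_t x)}.
Proof.
move=> stT; have [_ C1d _ h4 _] := hadm.
have [K [K0 dxK ddx _ reg]] := regularity_after al0 sT (h4 _ sT).
have /andP[st tT] := stT; have [_ _ jc] := reg t stT.
have near_itv : \forall s \near t, sigma < s < T0.
  have /near_in_itvoo : t \in `]sigma, T0[ by rewrite in_itv/= st.
  by apply: filterS => s; rewrite in_itv.
have cd : {for t, continuous delta}.
  have [_ /(_ t (itv0 stT))[dd _]] := hshift.
  have [ddt _] : is_derive t 1 delta (shift_speed t).
    apply: is_derive_interior => //.
    by apply: itv_interior => //; move: sT => /andP[? ?]; lra.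
  exact/differentiable_continuous/derivable1_diffP.
have cut : {for t, continuous (fun s => ut (x + delta s) s)}.
  apply/cvgrPdist_le => e e0; have [r r0 Hr] := jc (x + delta t) e e0.
  near=> s; rewrite distrC; apply: Hr.
    rewrite opprD addrACA subrr add0r distrC; near: s.
    by move/cvgrPdist_lt : cd; exact.
  rewrite distrC; near: s.
  by apply/nbhs_ballP; exists r.
have cux : {for t, continuous (fun s => dx 1 u (x + delta s) s)}.
  apply/cvgrPdist_le => e e0; have e2 : 0 < e / 2 by rewrite divr_gt0.
  have [r r0 Hr] := dx1_continuity (x + delta t) stT e2.
  have K1 : 0 < K + 1 by rewrite ltr_wpDl.
  have eK : 0 < e / 2 / (K + 1) by rewrite divr_gt0.
  near=> s.
  have stTs : sigma < s < T0 by near: s.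
  rewrite distrC.
  have -> : dx 1 u (x + delta s) s - dx 1 u (x + delta t) t =
    (dx 1 u (x + delta s) s - dx 1 u (x + delta t) s) +
    (dx 1 u (x + delta t) s - dx 1 u (x + delta t) t) by ring.
  rewrite (le_trans (ler_normD _ _))// [leRHS]splitr lerD//.
    have H := @mean_value_le _ (dx 1 u ^~ s) (dx 2 u ^~ s) K (x + delta s)
      (x + delta t) (fun z => ddx 1%N z s isT (itvs stTs))
      (fun z => dxK 2%N z s isT (itvs stTs)).
    rewrite (le_trans H)// opprD addrACA subrr add0r.
    rewrite (@le_trans _ _ ((K + 1) * `|delta s - delta t|))//.
      by rewrite ler_wpM2r// lerDl.
    rewrite mulrC -ler_pdivlMr// distrC; near: s.
    by move/cvgrPdist_le : cd; exact.
  apply: Hr; rewrite distrC; near: s.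
  by apply/nbhs_ballP; exists r.
have csp : {for t, continuous shift_speed}.
  have [_ cs] := C1d.
  have t0T : t \in `]0, T0[%R.
    by rewrite in_itv/= tT andbT; move: sT => /andP[? ?]; lra.
  by have /(continuous_within_itvP _ T00)[H _ _] := cs; exact: (H t t0T).
have H : {for t, continuous (fun s => ut (x + delta s) s +
    shift_speed s * dx 1 u (x + delta s) s)}.
  by apply: cvgD; [exact: cut|apply: cvgM; [exact: csp|exact: cux]].
rewrite /prop_for/= /continuous_at pert_tE//.
apply: cvg_trans H; apply: near_eq_cvg; near=> s.
by rewrite pert_tE//; near: s.
Unshelve. all: by end_near. Qed.

End after_sigma.
End evolution.

(** * Evolution of the weighted energy *)

Section weighted_energy.
Context {R : realType}.
Variables (um up kappa alpha x0 T0 : R) (u : R -> R -> R) (delta : R -> R).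
Hypotheses (hu : um < up) (kappa0 : 0 < kappa) (al0 : 0 < alpha) (T00 : 0 < T0).
Hypothesis hshift : is_shift um up kappa x0 T0 u delta.
Hypothesis hadm : admissible um up kappa x0 alpha T0 u delta.
Implicit Types (x y t s e r p q : R).
Local Notation mu := (@lebesgue_measure R).
Local Notation integrable f := (mu.-integrable setT (EFin \o f)).
Local Notation phi := (perturbation um up kappa x0 u delta).
Local Notation phit := (pert_t um up kappa x0 T0 u delta).
Variables (eps sigma : R).
Hypotheses (eps0 : 0 < eps) (sT : 0 < sigma < T0).
Local Notation w x := (1 - profile x0 eps x ^+ 2).

Definition weighted_energy t := \int[mu]_x (w x ^+ 2 * phi x t ^+ 2).
Definition weighted_power t := \int[mu]_x (w x ^+ 2 * phi x t * phit x t).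

Let itv0 t : sigma < t < T0 -> 0 <= t <= T0.
Proof. by move: sT => /andP[? ?] /andP[? ?]; apply/andP; split; lra. Qed.

Let bw := bc_profile x0 eps.

Let w01 x : 0 <= w x <= 1.
Proof. by rewrite onem_sqr_profile_ge0 /= gerBl sqr_ge0. Qed.

Let bphi t : sigma < t < T0 -> bounded_continuous (phi ^~ t).
Proof.
by move=> /(pert_regularity kappa0 al0 hadm sT)[[]].
Qed.

Let bphit t : sigma < t < T0 -> bounded_continuous (phit ^~ t).
Proof.
move=> /(pert_regularity kappa0 al0 hadm sT)[[b0 b1 b2 b3 b4] _].
have btau := bc_profile x0 (kappa * (up - um) / 2).
by rewrite /pert_t /flux2; bc.
Qed.

Let power_integrable t : sigma < t < T0 ->
  integrable (fun x => w x ^+ 2 * phi x t * phit x t).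
Proof.
move=> stT; have b1 := bphi stT; have b2 := bphit stT.
apply: (@integrable_sech2_mul _ x0 eps eps0 _
  (fun x => w x * phi x t * phit x t)) => [|x]; first by bc.
by ring.
Qed.

(** The role of the weight in time differentiation: since w^2 <= w, the bounded factors admit an
    integrable majorant independent of [t]. *)
Let bound : exists2 G : R, 0 <= G & forall t x, sigma < t < T0 ->
  `|w x ^+ 2 * phi x t * phit x t| <= G * w x.
Proof.
have [M M0 [phiM _]] := perturbation_bound al0 hadm.
have [K phitK] := pert_t_bound hu kappa0 al0 hshift hadm sT.
have K0 : 0 <= K.
  have tT : sigma < (sigma + T0) / 2 < T0.
    by move: sT => /andP[? ?]; apply/andP; split; lra.
  by rewrite (le_trans _ (phitK x0 _ tT)).
exists (M * K); first by rewrite mulr_ge0.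
move=> t x stT; have /andP[w0 w1] := w01 x.
have B : `|phi x t * phit x t| <= M * K.
  by rewrite normrM ler_pM//; [apply/phiM/itv0|exact: phitK].
have W : w x ^+ 2 <= w x by rewrite expr2 ler_piMl.
rewrite -mulrA normrM (ger0_norm (sqr_ge0 (w x))) mulrC.
by apply: ler_pM => //; exact: sqr_ge0.
Qed.

Let dintegrand t x : sigma < t < T0 ->
  is_derive t 1 (fun t => w x ^+ 2 * phi x t ^+ 2) (2 * (w x ^+ 2 * phi x t * phit x t)).
Proof.
move=> stT; have H := is_derive_pert kappa0 al0 hshift hadm sT x stT.
apply: (is_derive_eq (is_derive_mul (is_derive_cst (w x ^+ 2) t 1) (is_derive_sqr H))).
by rewrite /cst; ring.
Qed.

Lemma is_derive_weighted_energy t : sigma < t < T0 ->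
  is_derive t 1 weighted_energy (2 * weighted_power t).
Proof.
move=> stT; have [G G0 HG] := bound.
have iI r : `]sigma, T0[%classic r -> sigma < r < T0 by rewrite /= in_itv.
have It : `]sigma, T0[%classic t by rewrite /= in_itv.
pose f r x := w x ^+ 2 * phi x r ^+ 2.
have intf r : `]sigma, T0[%classic r -> integrable (f r).
  move=> /iI srT; have b1 := bphi srT.
  apply: (@integrable_sech2_mul _ x0 eps eps0 _ (fun x => w x * phi x r ^+ 2)).
    by bc.
  by move=> x; rewrite /f; ring.
have derf1 r x : `]sigma, T0[%classic r -> setT x -> derivable (f ^~ x) r 1.
  by move=> /iI srT _; have [] := dintegrand x srT.
have f1E r x : sigma < r < T0 ->
    derive1 (f ^~ x) r = 2 * (w x ^+ 2 * phi x r * phit x r).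
  by move=> srT; rewrite derive1E; have [_ ->] := dintegrand x srT.
have GG0 x : 0 <= 2 * G * w x.
  by rewrite mulr_ge0//; [rewrite mulr_ge0|case/andP: (w01 x)].
have iG : integrable (fun x => 2 * G * w x).
  apply: (@integrable_sech2_mul _ x0 eps eps0 _ (fun=> 2 * G)); first by bc.
  by move=> x; ring.
have Gub r x : `]sigma, T0[%classic r -> setT x -> `|partial1of2 f r x| <= 2 * G * w x.
  move=> /iI srT _; rewrite /partial1of2 f1E// normrM ger0_norm//.
  rewrite -[leRHS]mulrA ler_wpM2l//.
  exact: HG.
have D := @derivable_under_integral R _ _ mu f setT measurableT t sigma T0 It
  intf derf1 _ GG0 iG Gub.
have E := @differentiation_under_integral R _ _ mu f setT measurableT t sigma T0 It
  intf derf1 _ GG0 iG Gub.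
split; first exact: D.
rewrite -derive1E; move: E => /= ->.
rewrite -RintegralZl//; last exact: power_integrable.
by apply: eq_Rintegral => x _; exact: f1E.
Qed.

Lemma weighted_power_continuous t : sigma < t < T0 ->
  {for t, continuous weighted_power}.
Proof.
move=> stT; have [G G0 HG] := bound.
have iI r : `]sigma, T0[%classic r -> sigma < r < T0 by rewrite /= in_itv.
pose f r x := w x ^+ 2 * phi x r * phit x r.
have intf r : `]sigma, T0[%classic r -> integrable (f r).
  by move=> /iI; exact: power_integrable.
have iG : integrable (fun x => G * w x).
  apply: (@integrable_sech2_mul _ x0 eps eps0 _ (fun=> G)); first by bc.
  by move=> x; ring.
have cf : {ae mu, forall x, setT x -> {in `]sigma, T0[%classic, continuous (f ^~ x)}}.
  apply: aeW => x _ r /set_mem/iI srT; apply: cvgM.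
    apply: cvgM; first exact: cvg_cst.
    have [dphi _] := is_derive_pert kappa0 al0 hshift hadm sT x srT.
    exact/differentiable_continuous/derivable1_diffP.
  exact: (pert_t_continuous kappa0 al0 T00 hshift hadm sT srT).
have gub r : `]sigma, T0[%classic r -> {ae mu, forall x, setT x -> `|f r x| <= G * w x}.
  by move=> /iI srT; apply: aeW => x _; exact: HG.
have H := @continuity_under_integral R _ _ mu f setT measurableT sigma T0 intf cf
  _ iG gub.
by apply: H; apply/mem_set; rewrite /= in_itv.
Qed.

(** The integrand is the form taken by the upper bound for the dissipation, with [c] the remainder
    due to the weight. *)
Lemma weighted_energy_FTC p q (c k : R) : sigma < p -> p < q -> q < T0 ->
  measurable_fun `[p, q] (fun t => (c - k * weighted_power t)%:E) /\
  (\int[mu]_(t in `[p, q]) (c - k * weighted_power t)%:E =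
  (c * (q - p) - k / 2 * (weighted_energy q - weighted_energy p))%:E)%E.
Proof.
move=> sp pq qT.
have stT t : t \in `[p, q] -> sigma < t < T0.
  by rewrite in_itv/= => /andP[? ?]; apply/andP; split; lra.
have cpow t : t \in `[p, q] -> {for t, continuous (fun t => c - k * weighted_power t)}.
  move=> /stT tT; apply: cvgB; first exact: cvg_cst.
  by apply: cvgM; [exact: cvg_cst|exact: weighted_power_continuous].
have cw : {within `[p, q], continuous (fun t => c - k * weighted_power t)}.
  by apply: continuous_in_subspaceT => t /set_mem; exact: cpow.
pose F t := c * t - k / 2 * weighted_energy t.
have dF t : t \in `[p, q] -> is_derive t 1 F (c - k * weighted_power t).
  move=> /stT tT.
  apply: (is_derive_eq (is_derive_add (is_derive_mul (is_derive_cst c t 1) (is_derive_id t 1))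
    (is_derive_opp (is_derive_mul (is_derive_cst (k / 2) t 1) (is_derive_weighted_energy tT))))).
  by rewrite /cst; field.
have cF t : t \in `[p, q] -> {for t, continuous F}.
  move=> /dF[D _]; exact/differentiable_continuous/derivable1_diffP.
split.
  apply/measurable_EFinP; apply: subspace_continuous_measurable_fun => //.
rewrite (@continuous_FTC2 _ (fun t => c - k * weighted_power t) F p q pq cw).
- by rewrite -EFinB; congr EFin; rewrite /F; ring.
- split.
  + by move=> t /subset_itv_oo_cc/dF[].
  + by apply/cvg_at_right_filter/cF; rewrite in_itv/= lexx ltW.
  + by apply/cvg_at_left_filter/cF; rewrite in_itv/= lexx ltW.
- by move=> t /subset_itv_oo_cc/dF[_ D]; rewrite derive1E.
Qed.

End weighted_energy.

(** * Removal of the weight *)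

Section lower_integral.
Context {R : realType}.
Local Notation mu := (@lebesgue_measure R).
Implicit Types (f g : R -> \bar R) (u v : (\bar R)^nat).

(* No measurability is needed: the integral of a nonnegative function is a
   supremum over the simple functions below it. *)
Lemma ge0_integral_mono (D : set R) f g : (forall x, D x -> (0 <= f x)%E) ->
  (forall x, D x -> (f x <= g x)%E) ->
  (\int[mu]_(x in D) f x <= \int[mu]_(x in D) g x)%E.
Proof.
move=> f0 fg; rewrite integral_mkcond [leRHS]integral_mkcond.
have fD0 x : (0 <= (f \_ D) x)%E by apply: erestrict_ge0.
have fgD x : ((f \_ D) x <= (g \_ D) x)%E.
  by rewrite !patchE; case: ifPn => // /set_mem; exact: fg.
rewrite !ge0_integralTE//; last by move=> x; exact: le_trans (fgD x).
apply: ereal_sup_le => _ [h /= hf <-]; exists h => // x.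
exact: le_trans (hf x) (fgD x).
Qed.

(** The majorant is set to infinity at the two endpoints, a null set, so nothing has to be known
    about [f] there; for the dissipation these are the times 0 and t. *)
Lemma ge0_integral_itvcc_le (p q : R) f g :
  (forall x, `[p, q]%classic x -> (0 <= f x)%E) ->
  measurable_fun `]p, q[ g -> (forall x, `]p, q[%classic x -> (f x <= g x)%E) ->
  (\int[mu]_(x in `[p, q]) f x <= \int[mu]_(x in `]p, q[) g x)%E.
Proof.
move=> f0 mg fg.
pose G x := if x \in `]p, q[%classic then g x else +oo%E.
have GE : {in `]p, q[%classic, G =1 g} by move=> x xpq; rewrite /G xpq.
have mG : measurable_fun `]p, q[ G.
  by apply: eq_measurable_fun mg => x xpq; rewrite GE.
have -> : (\int[mu]_(x in `]p, q[) g x = \int[mu]_(x in `]p, q[) G x)%E.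
  by apply: eq_integral => x xpq; rewrite GE.
rewrite -(@integral_itv_bndoo _ p q G true false mG).
apply: ge0_integral_mono => // x _; rewrite /G.
by case: ifPn => [/set_mem/fg//|_]; rewrite leey.
Qed.

Lemma limn_einf_near_le u v : (\forall n \near \oo, (u n <= v n)%E) ->
  (limn_einf u <= limn_einf v)%E.
Proof.
move=> [N _ uv]; rewrite !limn_einf_lim; apply: lee_lim.
- exact: is_cvg_einfs.
- exact: is_cvg_einfs.
- exists N => // n /= Nn; apply: le_ereal_inf_tmp => _ [m /= nm <-].
  apply: (@le_trans _ _ (u m)); first by apply: ereal_inf_lbound; exists m.
  by apply: uv => /=; exact: leq_trans nm.
Qed.

Lemma limn_einf_le_cst u (c : \bar R) : (\forall n \near \oo, (u n <= c)%E) ->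
  (limn_einf u <= c)%E.
Proof.
move=> uc; have := @limn_einf_near_le u (fun=> c) uc.
have ccst : c @[_ --> \oo] --> c by exact: cvg_cst.
by rewrite (cvg_limn_einf_sup ccst).1.
Qed.

Lemma limn_einf_gt u (c : \bar R) : (c < limn_einf u)%E ->
  \forall n \near \oo, (c < u n)%E.
Proof.
rewrite limn_einf_lim.
have -> : limn (einfs u) = ereal_sup (range (einfs u)).
  by apply/cvg_lim => //; exact: cvg_einfs_sup.
move=> /ereal_sup_gt[_ [N _ <-]] cN.
exists N => // n /= Nn; apply: (lt_le_trans cN).
by apply: ereal_inf_lbound; exists n.
Qed.

Lemma measurable_fun_limn_einf (D : set R) (h : (R -> \bar R)^nat) :
  (forall n, measurable_fun D (h n)) ->
  measurable_fun D (fun x => limn_einf (h ^~ x)).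
Proof.
move=> mh; rewrite /limn_einf; apply: measurableT_comp => //.
by apply: measurable_fun_limn_esup => n; exact: measurableT_comp.
Qed.

(** Includes the case where both sides are infinite, which is not excluded beforehand for the
    derivatives of the perturbation. *)
Lemma sqr_L2norm (f : R -> R) :
  (L2norm f ^+ 2 = \int[mu]_x (f x ^+ 2)%:E)%E.
Proof.
have := @powR_Lnorm _ _ _ mu (EFin \o f) 2 (lt0r_neq0 (ltr0Sn R 1)).
have -> : (\int[mu]_x (`|(EFin \o f) x| `^ 2) = \int[mu]_x (f x ^+ 2)%:E)%E.
  apply: eq_integral => x _ /=.
  by rewrite -[2]/(2%:R) powR_mulrn// real_normK ?num_real.
move=> <-; rewrite -/(L2norm f).
have : (0 <= L2norm f)%E by exact: Lnorm_ge0.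
case: (L2norm f) => [r| |]//=.
- by rewrite lee_fin => r0; rewrite -[2]/(2%:R) powR_mulrn.
- by move=> _; rewrite ?expe2 ?mulyy gt_eqF.
Qed.

End lower_integral.

Section limits.
Context {R : realType}.
Implicit Types (x t s e p q : R).
Local Notation mu := (@lebesgue_measure R).
Local Notation integrable f := (mu.-integrable setT (EFin \o f)).

Lemma profile_cvg0 (x0 x : R) (eps : nat -> R) : eps n @[n --> \oo] --> 0 ->
  profile x0 (eps n) x @[n --> \oo] --> (0 : R).
Proof.
move=> e0; have t0 : tanh (0 : R) = 0 by rewrite /tanh oppr0 subrr mul0r.
rewrite -[X in _ --> X]t0 -[X in tanh X](mul0r (x - x0)).
apply: continuous_cvg; first exact: (derive_continuous (@is_derive_tanh R)).
by apply: cvgM; [exact: e0|exact: cvg_cst].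
Qed.

Lemma defect_cvg0 (x0 a : R) (eps : nat -> R) : 0 < a ->
  eps n @[n --> \oo] --> 0 ->
  \int[mu]_x ((1 - profile x0 a x ^+ 2) * profile x0 (eps n) x ^+ 2)
    @[n --> \oo] --> (0 : R).
Proof.
move=> a0 e0.
pose f (n : nat) x := (1 - profile x0 a x ^+ 2) * profile x0 (eps n) x ^+ 2.
have bcf n : bounded_continuous (f n).
  have b1 := bc_profile x0 a; have b2 := bc_profile x0 (eps n).
  by rewrite /f; bc.
have H := @dominated_cvg _ _ _ mu setT measurableT (fun n => EFin \o f n)
  (fun=> 0%E) (fun x => (1 - profile x0 a x ^+ 2)%:E).
have : (\int[mu]_x (f n x)%:E)%E @[n --> \oo] --> (\int[mu]_x 0)%E.
  apply: H => //.
  - by move=> n; apply/measurable_EFinP; apply: continuous_measurable; exact: (bcf n).1.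
  - move=> x _; apply: cvg_EFin; first exact: nearW.
    rewrite -[X in _ --> X](mulr0 (1 - profile x0 a x ^+ 2)).
    apply: cvgM; first exact: cvg_cst.
    rewrite -[X in _ --> X](mulr0 (0 : R)).
    by apply: cvgM; exact: profile_cvg0.
  - exact: integrable_sech2.
  - move=> n x _; rewrite lee_fin /f ger0_norm.
      rewrite ler_piMr ?onem_sqr_profile_ge0//.
      by rewrite ltW// sqr_tanh_lt1.
    by rewrite mulr_ge0 ?sqr_ge0// onem_sqr_profile_ge0.
by rewrite integral0 => /fine_cvgP[].
Qed.

Lemma integral_le_limn_einf (f : nat -> R -> R) (g : R -> R) :
  (forall n, continuous (f n)) -> (forall n x, 0 <= f n x) ->
  (forall x, f n x @[n --> \oo] --> g x) ->
  (\int[mu]_x (g x)%:E <= limn_einf (fun n => \int[mu]_x (f n x)%:E))%E.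
Proof.
move=> cf f0 fg.
have gE x : (g x)%:E = limn_einf (fun n => (f n x)%:E).
  have H : (f n x)%:E @[n --> \oo] --> (g x)%:E.
    by apply: cvg_EFin; [exact: nearW|exact: fg].
  by rewrite (cvg_limn_einf_sup H).1.
under eq_integral do rewrite gE.
apply: fatou => //.
- by move=> n; apply/measurable_EFinP; exact: continuous_measurable.
- by move=> n x _; rewrite lee_fin.
Qed.

End limits.

(** * Unweighted energy and dissipation *)

Section energy_inequality.
Context {R : realType}.
Variables (um up kappa alpha x0 T0 : R) (u : R -> R -> R) (delta : R -> R).
Hypotheses (hu : um < up) (kappa0 : 0 < kappa) (al0 : 0 < alpha) (T00 : 0 < T0).
Hypothesis hshift : is_shift um up kappa x0 T0 u delta.
Hypothesis hadm : admissible um up kappa x0 alpha T0 u delta.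
Implicit Types (x t s r p q : R).
Local Notation mu := (@lebesgue_measure R).
Local Notation integrable f := (mu.-integrable setT (EFin \o f)).
Local Notation a := (kappa * (up - um) / 2).
Local Notation tau := (profile x0 a).
Local Notation phi := (perturbation um up kappa x0 u delta).
Local Notation phi1 := (pert1 um up kappa x0 u delta).
Local Notation phi2 := (pert2 um up kappa x0 u delta).
Local Notation speed := (shift_speed T0 delta).
Local Notation power := (weighted_power um up kappa x0 T0 u delta).
Local Notation wenergy := (weighted_energy um up kappa x0 u delta).
Local Notation diss := (dissipation um up kappa x0 T0 u delta).
Let a0 : 0 < a. Proof. exact: front_rate_gt0. Qed.
Local Notation N t := (\int[mu]_x phi x t ^+ 2).

Lemma sqr_pert_integrable t : 0 <= t <= T0 -> integrable (fun x => phi x t ^+ 2).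
Proof.
move=> tT; have [[L2 _] _ _ _ _] := hadm.
by apply: Lfun2_integrable_sqr; apply: L2; rewrite /= in_itv.
Qed.

Lemma sqr_L2norm_pert t : 0 <= t <= T0 -> (L2norm (phi ^~ t) ^+ 2 = (N t)%:E)%E.
Proof.
move=> tT; rewrite sqr_L2norm /Rintegral fineK//.
by apply: integrable_fin_num => //; exact: sqr_pert_integrable.
Qed.

(** Stated in the extended reals because [phi1] and [phi2] are so far only known to be bounded. The
    sum of norms becomes one integral, ready for Fatou's lemma in x. *)
Lemma dissipation_integral s : 0 < s < T0 -> (diss s =
  \int[mu]_x (phi1 x s ^+ 2 + phi2 x s ^+ 2 + front1 um up kappa x0 x * phi x s ^+ 2)%:E
  + (speed s ^+ 2)%:E)%E.
Proof.
move=> /andP[s0 sT].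
have sgT : 0 < s / 2 < T0 by apply/andP; split; lra.
have sT' : s / 2 < s < T0 by apply/andP; split; lra.
have [[b0 b1 b2 _ _] [d0 d1 _ _]] := pert_regularity kappa0 al0 hadm sgT sT'.
have f10 x : 0 <= front1 um up kappa x0 x.
  rewrite /front1 mulr_ge0 ?onem_sqr_profile_ge0// divr_ge0 ?sqr_ge0//.
  exact: ltW.
have mE (f : R -> R) : bounded_continuous f -> measurable_fun setT (fun x => (f x)%:E).
  by move=> bf; apply/measurable_EFinP; exact: (continuous_measurable bf.1).
have btau := bc_profile x0 a.
have bf1 : bounded_continuous (front1 um up kappa x0) by rewrite /front1; bc.
rewrite /dissipation /H1norm_sq.
have -> : dx 1 phi ^~ s = phi1 ^~ s.
  by rewrite /dx /= (derive1_is_derive d0).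
rewrite (derive1_is_derive d1) !sqr_L2norm.
rewrite (derive1_is_derive (is_derive_front um up x0 kappa0)).
have -> : (\int[mu]_x ((Num.sqrt (front1 um up kappa x0 x) * phi x s) ^+ 2)%:E =
  \int[mu]_x (front1 um up kappa x0 x * phi x s ^+ 2)%:E)%E.
  by apply: eq_integral => x _; rewrite exprMn sqr_sqrtr.
rewrite -/(speed s) real_normK ?num_real//; congr (_ + _)%E.
under [RHS]eq_integral do rewrite !EFinD.
rewrite ge0_integralD//=.
- rewrite ge0_integralD//=.
  + by move=> x _; rewrite lee_fin sqr_ge0.
  + by apply: mE; bc.
  + by move=> x _; rewrite lee_fin sqr_ge0.
  + by apply: mE; bc.
- by move=> x _; rewrite -EFinD lee_fin addr_ge0 ?sqr_ge0.
- by apply: emeasurable_funD; apply: mE; bc.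
- by move=> x _; rewrite lee_fin mulr_ge0 ?sqr_ge0.
- by apply: mE; bc.
Qed.

Lemma weighted_energy_le eps t : 0 < eps -> 0 <= t <= T0 -> wenergy eps t <= N t.
Proof.
move=> ep0 tT; have [M M0 [_ /(_ t tT) bphi]] := perturbation_bound al0 hadm.
have bw := bc_profile x0 eps.
apply: le_Rintegral => //; last 2 first.
- exact: sqr_pert_integrable.
- move=> x _; rewrite ler_piMl ?sqr_ge0// exprn_ile1 ?onem_sqr_profile_ge0//.
  by rewrite gerBl sqr_ge0.
apply: (@integrable_sech2_mul _ x0 eps ep0 _
  (fun x => (1 - profile x0 eps x ^+ 2) * phi x t ^+ 2)) => [|x]; first by bc.
by ring.
Qed.

Lemma sqr_pert_near0 e : 0 < e -> exists2 r : R, 0 < r &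
  forall s, 0 <= s <= T0 -> s < r -> N s <= N 0 + e.
Proof.
move=> e0; have [[L2 cL2] _ _ _ _] := hadm.
have J0 : `[0, T0]%classic 0 by rewrite /= in_itv/= lexx ltW.
have T0' : 0 <= (0 : R) <= T0 by apply/andP; split => //; exact: ltW.
have HN t : 0 <= t <= T0 -> exists2 A : R, 0 <= A & L2norm (phi ^~ t) = A%:E /\ A ^+ 2 = N t.
  move=> tT; have := sqr_L2norm_pert tT.
  have : (0 <= L2norm (phi ^~ t))%E by exact: Lnorm_ge0.
  case: (L2norm _) => [A| |]//=.
  rewrite lee_fin => A0 AE; exists A => //; split => //.
  exact: (@EFin_inj _ (A ^+ 2) (N t) AE).
have [A A0 [AE A2]] := HN 0 T0'.
(* As eta <= 1, the square of A + eta exceeds that of A by at most eta (2 A + 1) <= e. *)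
pose eta := Num.min 1 (e / (2 * A + 1)).
have A1 : 0 < 2 * A + 1 by rewrite ltr_wpDl// mulr_ge0.
have eta0 : 0 < eta by rewrite lt_min ltr01 divr_gt0.
have H := cL2 0 J0.
have nb : nbhs (0%E : \bar R) [set z : \bar R | (z < eta%:E)%E].
  have : \forall z \near (0 : R), z < eta by exact: lt_nbhsl.
  by apply: filterS => z /=; rewrite lte_fin.
have := H _ nb; rewrite /= => /nbhs_ballP[r /= r0 Hr].
exists r => // s sT sr.
have Js : `[0, T0]%classic s by rewrite /= in_itv.
have Ls : (L2norm (fun x => phi x s - phi x 0)%R < eta%:E)%E.
  apply: Hr => //; rewrite /ball/= sub0r normrN ger0_norm//.
  by case/andP: sT.
have [B B0 [BE B2]] := HN s sT.
have mphi t : 0 <= t <= T0 -> measurable_fun setT (phi ^~ t).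
  by move=> tT; have [M M0 [_ /(_ t tT)[cphi _]]] := perturbation_bound al0 hadm;
    exact: continuous_measurable.
have mink := @minkowski_EFin _ _ _ mu (fun x => phi x s - phi x 0) (phi ^~ 0) 2
  (measurable_funB (mphi s sT) (mphi 0 T0')) (mphi 0 T0') (ler1n R 2).
have sE : (fun x => phi x s - phi x 0) \+ phi ^~ 0 = phi ^~ s.
  by apply/funext => x /=; rewrite subrK.
rewrite sE -/(L2norm (phi ^~ s)) -/(L2norm (phi ^~ 0)) BE AE in mink.
have BA : B <= eta + A.
  rewrite -lee_fin; apply: (le_trans mink); rewrite (EFinD eta A).
  by apply: leeD => //; exact: ltW Ls.
rewrite -B2 -A2 (@le_trans _ _ ((eta + A) ^+ 2))//.
  by rewrite lerXn2r ?nnegrE// addr_ge0// ltW.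
have e1 : eta <= 1 by rewrite ge_min lexx.
have e2 : eta * (2 * A + 1) <= e by rewrite -ler_pdivlMr// ge_min lexx orbT.
have : eta * eta <= eta by rewrite ler_piMl// ltW.
rewrite sqrrD; lra.
Qed.

End energy_inequality.

(** * The dissipation integrated in time *)

Section dissipation_bound.
Context {R : realType}.
Variables (um up kappa alpha x0 T0 : R) (u : R -> R -> R) (delta : R -> R).
Hypotheses (hu : um < up) (kappa0 : 0 < kappa) (al0 : 0 < alpha) (T00 : 0 < T0).
Hypothesis hshift : is_shift um up kappa x0 T0 u delta.
Hypothesis hadm : admissible um up kappa x0 alpha T0 u delta.
Implicit Types (x s r : R).
Local Notation mu := (@lebesgue_measure R).
Local Notation integrable f := (mu.-integrable setT (EFin \o f)).
Local Notation a := (kappa * (up - um) / 2).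
Local Notation tau := (profile x0 a).
Local Notation phi := (perturbation um up kappa x0 u delta).
Local Notation phi1 := (pert1 um up kappa x0 u delta).
Local Notation phi2 := (pert2 um up kappa x0 u delta).
Local Notation speed := (shift_speed T0 delta).
Local Notation power := (weighted_power um up kappa x0 T0 u delta).
Local Notation wenergy := (weighted_energy um up kappa x0 u delta).
Local Notation diss := (dissipation um up kappa x0 T0 u delta).
Local Notation N t := (\int[mu]_x phi x t ^+ 2).
Variables (e y : R).
Hypotheses (y0 : 0 < y) (Hdis : dissipates x0 kappa a e y).
Hypothesis small : forall t, 0 <= t <= T0 -> N t <= e ^+ 2.
Variable t : R.
Hypotheses (t0 : 0 < t) (tT : t <= T0).
Let a0 : 0 < a. Proof. exact: front_rate_gt0. Qed.
Let btau := bc_profile x0 a.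
(** The derivative of the front is a^2 / kappa times sech^2, so 1 + a^2 / kappa dominates every
    coefficient of the dissipation; division by [y] undoes the rate of [dissipates]. *)
Let K := (1 + a ^+ 2 / kappa) / y.
(** The denominator starts at 3 so that 2 p n < t, hence p n < q n, already for n = 0. *)
Let p (n : nat) := t / n.+3%:R.
Let q n := t - p n.

Let K0 : 0 < K.
Proof. by rewrite divr_gt0// ltr_pwDl// divr_ge0 ?sqr_ge0// ltW. Qed.

Let p_gt0 n : 0 < p n. Proof. by rewrite divr_gt0. Qed.

Let pq n : p n < q n.
Proof.
rewrite ltrBrDr -mulr2n -mulr_natl /p mulrA ltr_pdivrMr// mulrC.
by rewrite ltr_pM2l// ltr_nat.
Qed.

Let qt n : q n < t. Proof. by rewrite /q ltrBlDr ltrDl. Qed.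

Let p_cvg : p n @[n --> \oo] --> 0.
Proof.
have -> : p = fun n => t * [sequence harmonic (n + 2)%N]_n n.
  by apply/funext => n; rewrite /p /= addn2.
rewrite -(mulr0 t); apply: cvgM; first exact: cvg_cst.
by rewrite cvg_shiftn; exact: cvg_harmonic.
Qed.

Let sig n : 0 < p n / 2 < T0.
Proof.
have := p_gt0 n; have := pq n; have := qt n; have := tT.
by move=> ? ? ? ?; apply/andP; split; lra.
Qed.

Let in_sig n s : `[p n, q n]%classic s -> p n / 2 < s < T0.
Proof.
rewrite /= in_itv/= => /andP[? ?]; have := p_gt0 n; have := qt n; have := tT.
by move=> ? ? ?; apply/andP; split; lra.
Qed.

Let in0 s : 0 < s < t -> 0 <= s <= T0.
Proof. by move=> /andP[? ?]; have := tT => ?; apply/andP; split; lra. Qed.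

Let in_pq s : 0 < s < t -> \forall n \near \oo, `[p n, q n]%classic s.
Proof.
move=> /andP[s0 st]; have m0 : 0 < Num.min s (t - s) by rewrite lt_min s0 subr_gt0.
have /cvgrPdist_lt/(_ _ m0) := p_cvg; apply: filterS => n.
rewrite sub0r normrN gtr0_norm// lt_min => /andP[ps pt].
by rewrite /= in_itv/= /q; apply/andP; split; lra.
Qed.

Lemma dissipation_integral_le :
  (\int[mu]_(s in `[0%R, t]) diss s <= (K / 2 * (N 0 - N t))%:E)%E.
Proof.
have t0' := t0; have tT' := tT; have y0' := y0.
have [M M0 [phiM bphi]] := perturbation_bound al0 hadm.
have [eps1 [C [eps10 C0 HS]]] := Hdis M0.
pose ep (n : nat) := eps1 / n.+1%:R.
have ep0 n : 0 < ep n by rewrite divr_gt0.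
have ep1 n : ep n <= eps1 by rewrite ler_pdivrMr// ler_peMr ?ler1n// ltW.
have ep_cvg : ep n @[n --> \oo] --> 0.
  by rewrite -(mulr0 eps1); apply: cvgM; [exact: cvg_cst|exact: cvg_harmonic].
pose r n := \int[mu]_x ((1 - tau x ^+ 2) * profile x0 (ep n) x ^+ 2).
pose eta n := ep n + r n.
have eta_cvg : eta n @[n --> \oo] --> 0.
  by rewrite -(addr0 (0 : R)); apply: cvgD => //; exact: defect_cvg0.
pose w0 n s := wt x0 (ep n) (phi ^~ s).
pose w1 n s := wt1 x0 (ep n) (phi ^~ s) (phi1 ^~ s).
pose w2 n s := wt2 x0 (ep n) (phi ^~ s) (phi1 ^~ s) (phi2 ^~ s).
pose Dn n s x := w1 n s x ^+ 2 + w2 n s x ^+ 2 +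
  front1 um up kappa x0 x * w0 n s x ^+ 2.
have f10 x : 0 <= front1 um up kappa x0 x.
  rewrite /front1 mulr_ge0 ?onem_sqr_profile_ge0// divr_ge0 ?sqr_ge0//.
  exact: ltW.
have Dn0 n s x : 0 <= Dn n s x.
  by rewrite !addr_ge0 ?sqr_ge0// mulr_ge0 ?sqr_ge0.
have bDn n s : 0 < s < t -> continuous (Dn n s).
  move=> /andP[s0 st]; have sgT : 0 < s / 2 < T0 by apply/andP; split; lra.
  have sT' : s / 2 < s < T0 by apply/andP; split; lra.
  have [[b0 b1 b2 _ _] _] := pert_regularity kappa0 al0 hadm sgT sT'.
  have bw0 := bc_wt x0 (ep n) b0; have bw1 := bc_wt1 x0 (ep n) b0 b1.
  have bw2 := bc_wt2 x0 (ep n) b0 b1 b2.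
  have bf1 : bounded_continuous (front1 um up kappa x0) by rewrite /front1; bc.
  suff [] : bounded_continuous (Dn n s) by [].
  by rewrite /Dn; bc.
(* The remainder K C eta n does not depend on [s] and tends to 0. *)
have static n s : `[p n, q n]%classic s ->
    (\int[mu]_x (Dn n s x)%:E + (speed s ^+ 2)%:E <=
     (K * C * eta n - K * power (ep n) s)%:E)%E.
  move=> spq; have sT' := in_sig spq; have sT := sig n.
  have sT0 : 0 <= s <= T0.
    by move: sT sT' => /andP[? ?] /andP[? ?]; apply/andP; split; lra.
  have [[b0 b1 b2 b3 b4] [d0 d1 d2 d3]] := pert_regularity kappa0 al0 hadm sT sT'.
  have ep01 : 0 < ep n <= eps1 by rewrite ep0 ep1.
  have H := HS (ep n) (phi ^~ s) (phi1 ^~ s) (phi2 ^~ s)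
    (pert3 um up kappa x0 u delta ^~ s) (pert4 um up kappa x0 u delta ^~ s)
    ep01 b0 b1 b2 b3 b4 d0 d1 d2 d3 (phiM^~ s ^~ sT0) (sqr_pert_integrable hadm sT0)
    (small sT0) (speed s) (shift_speedE hu kappa0 al0 hshift hadm sT0).
  have i1 := integrable_wt1_sqr x0 (ep0 n) b0 b1.
  have i2 := integrable_wt2_sqr x0 (ep0 n) b0 b1 b2.
  have bw0 := bc_wt x0 (ep n) b0.
  have i0 : integrable (fun x => (1 - tau x ^+ 2) * w0 n s x ^+ 2).
    apply: (@integrable_sech2_mul _ x0 a a0 _ (fun x => w0 n s x ^+ 2)) => [|//].
    by bc.
  have [i12 E12] := @integral_linear2 _ _ _
    (fun x => 1 * w1 n s x ^+ 2 + 1 * w2 n s x ^+ 2) 1 1 i1 i2 (fun=> erefl).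
  have DE x : Dn n s x = 1 * (1 * w1 n s x ^+ 2 + 1 * w2 n s x ^+ 2) +
      a ^+ 2 / kappa * ((1 - tau x ^+ 2) * w0 n s x ^+ 2).
    by rewrite /Dn /front1; ring.
  have [iD ED] := integral_linear2 i12 i0 DE.
  have -> : (\int[mu]_x (Dn n s x)%:E = (\int[mu]_x Dn n s x)%:E)%E.
    by rewrite fineK//; exact: integrable_fin_num.
  rewrite -EFinD lee_fin ED E12 !mul1r.
  have I10 : 0 <= \int[mu]_x w1 n s x ^+ 2.
    by apply: Rintegral_ge0 => x _; exact: sqr_ge0.
  have I20 : 0 <= \int[mu]_x w2 n s x ^+ 2.
    by apply: Rintegral_ge0 => x _; exact: sqr_ge0.
  have I00 : 0 <= \int[mu]_x ((1 - tau x ^+ 2) * w0 n s x ^+ 2).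
    by apply: Rintegral_ge0 => x _; rewrite mulr_ge0 ?sqr_ge0// onem_sqr_profile_ge0.
  move: H; rewrite -/(power (ep n) s) -/(r n) -/(eta n) -/(w1 n s) -/(w2 n s) -/(w0 n s).
  move: I10 I20 I00 (sqr_ge0 (speed s)).
  move: (\int[mu]_x w1 n s x ^+ 2) (\int[mu]_x w2 n s x ^+ 2).
  move: (\int[mu]_x (_ * w0 n s x ^+ 2)) (speed s ^+ 2) (power (ep n) s) (eta n).
  move=> Is dd W et I1 I2 I10 I20 Is0 d20 H.
  have k0 : 0 <= a ^+ 2 / kappa by rewrite divr_ge0 ?sqr_ge0// ltW.
  have H1 : I1 + I2 + Is + dd <= (C * et - W) / y.
    by rewrite ler_pdivlMr//; lra.
  have -> : K * C * et - K * W = (1 + a ^+ 2 / kappa) * ((C * et - W) / y).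
    by rewrite /K; ring.
  have k1 : 0 <= 1 + a ^+ 2 / kappa by rewrite addr_ge0.
  apply: le_trans (ler_wpM2l k1 H1).
  have := mulr_ge0 k0 I10; have := mulr_ge0 k0 I20; have := mulr_ge0 k0 d20.
  rewrite mulrDl mul1r !mulrDr; lra.
(* Each time in (0, t) lies in all but finitely many segments [p n, q n], so the extension by zero
   is invisible to the lower limit. *)
pose g n : R -> \bar R :=
  (fun s => (K * C * eta n - K * power (ep n) s)%:E) \_ `[p n, q n].
(* Fatou's lemma in x at a fixed time: the weighted integrands converge pointwise to those of the
   dissipation as eps tends to 0. *)
have diss_le s : `]0, t[%classic s -> (diss s <= limn_einf (g ^~ s))%E.
  rewrite /= in_itv/= => st; have sT := in0 st; have /andP[s0 st'] := st.
  have sT2 : 0 < s < T0 by rewrite s0 (lt_le_trans st').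
  rewrite (dissipation_integral kappa0 al0 hadm sT2) addeC.
  have cvgD x : Dn n s x @[n --> \oo] -->
      phi1 x s ^+ 2 + phi2 x s ^+ 2 + front1 um up kappa x0 x * phi x s ^+ 2.
    have th0 := profile_cvg0 x0 x ep_cvg.
    have c (z : R) : (fun=> z) @ \oo --> z by exact: cvg_cst.
    have w_ : 1 - profile x0 (ep n) x ^+ 2 @[n --> \oo] --> 1 - 0 * (0 : R).
      by apply: cvgB => //; exact: cvgM.
    have c0 : w0 n s x @[n --> \oo] --> (1 - 0 * 0) * phi x s by apply: cvgM.
    have c1 : w1 n s x @[n --> \oo] -->
        (1 - 0 * 0) * (phi1 x s - 2 * 0 * (0 * phi x s)).
      apply: cvgM => //; apply: cvgB => //; apply: cvgM; last exact: cvgM.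
      exact: cvgM.
    have c2 : w2 n s x @[n --> \oo] --> (1 - 0 * 0) * (phi2 x s
        - 4 * 0 * (0 * phi1 x s) + 0 * 0 * ((6 * (0 * 0) - 2) * phi x s)).
      apply: cvgM => //; apply: cvgD.
        by apply: cvgB => //; apply: cvgM; exact: cvgM.
      apply: cvgM; first exact: cvgM.
      by apply: cvgM => //; apply: cvgB => //; apply: cvgM => //; exact: cvgM.
    move: c0 c1 c2; rewrite !(mul0r, mulr0, subr0, addr0, mul1r) => c0 c1 c2.
    by apply: cvgD; [apply: cvgD; exact: cvgM|apply: cvgM => //; exact: cvgM].
  have F := integral_le_limn_einf (bDn^~ s ^~ st) (Dn0^~ s) cvgD.
  apply: (@le_trans _ _ (limn_einf
    (fun n => ((speed s ^+ 2)%:E + \int[mu]_x (Dn n s x)%:E)%E))).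
    by rewrite limn_einf_shift// leeD2l.
  apply: limn_einf_near_le; apply: filterS (in_pq st) => n spq.
  by rewrite /g patchE mem_set// addeC; exact: static.
have g0 n s : (0 <= g n s)%E.
  rewrite /g; apply: erestrict_ge0 => {}s spq.
  apply: le_trans (static n s spq); rewrite adde_ge0 ?lee_fin ?sqr_ge0//.
  by apply: integral_ge0 => x _; rewrite lee_fin.
have FTC n := @weighted_energy_FTC R um up kappa alpha x0 T0 u delta hu kappa0
  al0 T00 hshift hadm (ep n) (p n / 2) (ep0 n) (sig n) (p n) (q n) (K * C * eta n) K.
have pn2 n : p n / 2 < p n by have := p_gt0 n; lra.
have qT n : q n < T0 by rewrite (lt_le_trans (qt n)).
have mg n : measurable_fun `]0, t[ (g n).
  apply: measurable_funTS; apply/(measurable_restrictT _ _).1 => //.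
  by have [] := FTC n (pn2 n) (pq n) (qT n).
have ig n : (\int[mu]_(s in `]0%R, t[) g n s = (K * C * eta n * (q n - p n) -
    K / 2 * (wenergy (ep n) (q n) - wenergy (ep n) (p n)))%:E)%E.
  have [_ <-] := FTC n (pn2 n) (pq n) (qT n).
  rewrite /g -integral_mkcondr; congr (integral _ _ _).
  apply/seteqP; split => s /=; first by case.
  rewrite !in_itv/= => /andP[ps sq]; split; apply/andP; split => //.
  - exact: lt_le_trans ps.
  - exact: le_lt_trans (qt n).
have diss0 s : (0 <= diss s)%E.
  have L0 (f : R -> R) : (0 <= L2norm f ^+ 2)%E by rewrite expe_ge0// Lnorm_ge0.
  rewrite /dissipation /H1norm_sq; apply: adde_ge0.
    by apply: adde_ge0; [apply: adde_ge0|]; exact: L0.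
  by rewrite lee_fin exprn_ge0.
apply: (@le_trans _ _ (\int[mu]_(s in `]0%R, t[) limn_einf (g ^~ s))%E).
  apply: ge0_integral_itvcc_le => //.
  exact: measurable_fun_limn_einf.
apply: (@le_trans _ _ (limn_einf (fun n => \int[mu]_(s in `]0%R, t[) g n s)%E)).
  by apply: fatou.
have t0T : 0 <= t <= T0 by rewrite ltW.
apply/lee_addgt0Pr => e' e'0.
(* An error e1 in the energy at each end costs (K / 2) (2 e1) = e' / 2; the remainder will cost at
   most e' / 4. *)
pose e1 := e' / (2 * K).
have e10 : 0 < e1 by rewrite divr_gt0// mulr_gt0.
(* At the right end only a lower bound for the energy is required, so Fatou's lemma and the
   pointwise convergence of [phi] at the times q n suffice. *)
have near_t : \forall n \near \oo, N t - e1 < wenergy (ep n) (q n).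
  pose f n x := (1 - profile x0 (ep n) x ^+ 2) ^+ 2 * phi x (q n) ^+ 2.
  have qT' n : 0 <= q n <= T0.
    by have := p_gt0 n; have := pq n; have := qT n => ? ? ?; apply/andP; split; lra.
  have bf n : bounded_continuous (f n).
    by have b1 := bphi (q n) (qT' n); have b2 := bc_profile x0 (ep n); rewrite /f; bc.
  have fge0 n x : 0 <= f n x by rewrite mulr_ge0// sqr_ge0.
  have cvgf x : f n x @[n --> \oo] --> phi x t ^+ 2.
    have th0 := profile_cvg0 x0 x ep_cvg.
    have w_ : 1 - profile x0 (ep n) x ^+ 2 @[n --> \oo] --> 1 - 0 * (0 : R).
      by apply: cvgB; [exact: cvg_cst|exact: cvgM].
    have pt : phi x (q n) @[n --> \oo] --> phi x t.
      apply/cvgrPdist_le => z z0.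
      have [rho rho0 Hrho] := perturbation_continuity al0 hshift hadm x t0T z0.
      have /cvgrPdist_lt/(_ _ rho0) := p_cvg; apply: filterS => n pn.
      rewrite distrC; apply: Hrho => //.
      by move: pn; rewrite sub0r /q addrAC subrr sub0r.
    have -> : phi x t ^+ 2 = (1 - 0 * 0) * (1 - 0 * 0) * (phi x t * phi x t).
      by rewrite mul0r subr0 !mul1r.
    by apply: cvgM; exact: cvgM.
  have := integral_le_limn_einf (fun n => (bf n).1) fge0 cvgf.
  have -> : (\int[mu]_x (phi x t ^+ 2)%:E = (N t)%:E)%E.
    rewrite fineK//; apply: integrable_fin_num => //.
    exact: (sqr_pert_integrable hadm t0T).
  move=> F.
  have /limn_einf_gt : ((N t - e1)%:E < limn_einf (fun n => \int[mu]_x (f n x)%:E))%E.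
    by apply: lt_le_trans F; rewrite lte_fin ltrBlDr ltrDl.
  apply: filterS => n.
  have -> : (\int[mu]_x (f n x)%:E = (wenergy (ep n) (q n))%:E)%E.
    rewrite fineK//; apply: integrable_fin_num => //.
    have b1 := bphi (q n) (qT' n); have b2 := bc_profile x0 (ep n).
    apply: (@integrable_sech2_mul _ x0 (ep n) (ep0 n) _
      (fun x => (1 - profile x0 (ep n) x ^+ 2) * phi x (q n) ^+ 2)) => [|x]; first by bc.
    by rewrite /f; ring.
  by rewrite lte_fin.
(* At the left end an upper bound is required; it comes from continuity in L2 at time 0 together
   with w <= 1. *)
have [rho rho0 Hrho] := sqr_pert_near0 al0 T00 hadm e10.
have near_0 : \forall n \near \oo, wenergy (ep n) (p n) <= N 0 + e1.
  have /cvgrPdist_lt/(_ _ rho0) := p_cvg; apply: filterS => n.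
  rewrite sub0r normrN gtr0_norm// => pr.
  have pT : 0 <= p n <= T0.
    by have := p_gt0 n; have := pq n; have := qT n => ? ? ?; apply/andP; split; lra.
  by rewrite (le_trans (weighted_energy_le al0 hadm (ep0 n) pT))// Hrho.
have near_eta : \forall n \near \oo, K * C * eta n * t < e' / 4.
  have : K * C * eta n * t @[n --> \oo] --> K * C * 0 * t.
    by apply: cvgM; [apply: cvgM => //; exact: cvg_cst|exact: cvg_cst].
  rewrite mulr0 mul0r => /cvgrPdist_lt/(_ (e' / 4)) H.
  have e40 : 0 < e' / 4 by rewrite divr_gt0.
  apply: filterS (H e40) => n; rewrite sub0r normrN.
  exact: le_lt_trans (ler_norm _).
apply: limn_einf_le_cst.
near=> n.
rewrite ig -EFinD lee_fin.
have A1 : N t - e1 < wenergy (ep n) (q n) by near: n.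
have A2 : wenergy (ep n) (p n) <= N 0 + e1 by near: n.
have A3 : K * C * eta n * t < e' / 4 by near: n.
have eta0 : 0 <= eta n.
  by rewrite addr_ge0 ?(ltW (ep0 n))//; case/andP: (defect_ge0 x0 a0 (ep n)).
have A4 : K * C * eta n * (q n - p n) <= K * C * eta n * t.
  have KCe : 0 <= K * C * eta n.
    by apply: mulr_ge0 => //; apply: mulr_ge0 => //; exact: ltW.
  apply: ler_wpM2l => //.
  by rewrite (le_trans _ (ltW (qt n)))// gerBl ltW.
have K20 : 0 <= K / 2 by rewrite divr_ge0// ltW.
have A5 : K / 2 * (wenergy (ep n) (p n) - wenergy (ep n) (q n)) <=
    K / 2 * (N 0 - N t + 2 * e1).
  by rewrite ler_wpM2l//; lra.
have E1 : K / 2 * (2 * e1) = e' / 2.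
  by rewrite /e1; field; exact: lt0r_neq0.
move: A5; rewrite [in X in _ <= X]mulrDr E1 => A5.
rewrite -[X in _ + X <= _]mulrN opprB (le_trans (lerD A4 A5))//.
move: (ltW A3); move: (K * C * eta n * t) (K / 2 * (N 0 - N t)) => X Y XY.
rewrite addrCA lerD2l (le_trans (lerD XY (lexx _)))// -subr_ge0.
have -> : e' - (e' / 4 + e' / 2) = e' / 4 by field.
by rewrite divr_ge0// ltW.
Unshelve. all: by end_near. Qed.

End dissipation_bound.

Theorem proposition2p2 (R : realType) (um up kappa alpha x0 : R)
    (hu : um < up) (hkappa : 0 < kappa) (halpha : 0 < alpha <= 1 / 2) :
  exists eps1 c0 : R, 0 < eps1 /\ 0 < c0 /\
    forall (T0 : R) (u : R -> R -> R) (delta : R -> R),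
      0 < T0 ->
      is_shift um up kappa x0 T0 u delta ->
      admissible um up kappa x0 alpha T0 u delta ->
      let phi := perturbation um up kappa x0 u delta in
      (ereal_sup [set L2norm (fun x => phi x t) | t in `[0%R, T0]]
         <= eps1%:E)%E ->
      forall t : R, 0 <= t <= T0 ->
        (L2norm (fun x => phi x t) ^+ 2
         + c0%:E * \int[lebesgue_measure]_(s in `[0%R, t])
                     dissipation um up kappa x0 T0 u delta s
         <= L2norm (fun x => phi x 0%R) ^+ 2)%E.
Proof.
have a0 : 0 < kappa * (up - um) / 2 by exact: front_rate_gt0.
have [e [y [e0 y0 Hdis]]] := weighted_dissipation x0 hkappa a0.
set a := kappa * (up - um) / 2 in a0 Hdis.
pose K := (1 + a ^+ 2 / kappa) / y.
have K0 : 0 < K by rewrite divr_gt0// ltr_pwDl// divr_ge0 ?sqr_ge0// ltW.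
(* The integrated estimate bounds the dissipation by K / 2 times the loss of energy; 2 / K inverts
   this factor. *)
exists e, (2 / K); split; first exact: e0.
split; first by rewrite divr_gt0.
move=> T0 u delta T00 hshift hadm phi hsup t tT.
have al0 : 0 < alpha by case/andP: halpha.
have T0T : 0 <= (0 : R) <= T0 by apply/andP; split => //; exact: ltW.
rewrite (sqr_L2norm_pert hadm tT) (sqr_L2norm_pert hadm T0T).
have [t0|t0] := eqVneq t 0.
  by rewrite t0 set_itv1 integral_set1 mule0 adde0.
have {t0} t0 : 0 < t by rewrite lt_neqAle eq_sym t0; case/andP: tT.
have small s : 0 <= s <= T0 -> \int[lebesgue_measure]_x phi x s ^+ 2 <= e ^+ 2.
  move=> sT; rewrite -lee_fin -(sqr_L2norm_pert hadm sT).
  have Le : (L2norm (phi ^~ s) <= e%:E)%E.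
    apply: le_trans hsup; apply: ereal_sup_ubound.
    by exists s => //; rewrite /= in_itv.
  have L0 : (0 <= L2norm (phi ^~ s))%E by exact: Lnorm_ge0.
  by rewrite EFin_expe !expe2 lee_pmul.
have /andP[_ tT0] := tT.
have := dissipation_integral_le hu hkappa al0 T00 hshift hadm y0 Hdis small t0 tT0.
rewrite -/K; set D := (\int[_]_(s in _) _)%E => HD.
have c0 : (0 <= (2 / K)%:E)%E by rewrite lee_fin divr_ge0// ltW.
apply: (le_trans (leeD2l _ (lee_wpmul2l c0 HD))).
rewrite -EFinM -EFinD lee_fin le_eqVlt; apply/orP; left; apply/eqP.
by field; exact: lt0r_neq0.
Qed.
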